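(* Let $p$ be a prime, $0\le t<n$, $h=n-t$ and $k\ge1$. The map on global sections of the $p^k$-torsion of $p$-divisible groups $$(\mathbb{G}_0\oplus_{\mathbb{Z}_p^{h}}\mathbb{Q}_p^{h})[p^k]\longrightarrow\mathbb{G}_{E_n}[p^k]$$ lying over $\operatorname{Spf}_{I_t+(\bar q)}(B_t)\to\operatorname{Spec}(E_n^0)$ is recovered by the twisted character map $\Upsilon_{\mathbb{Z}/p^k}( * )$ for the group $\mathbb{Z}/p^k$ and the one-point space. That is, under the identifications $E_n^0(B\mathbb{Z}/p^k)\cong\mathcal{O}_{\mathbb{G}_{E_n}[p^k]}$ and $B_t\otimes_{L_{K(t)}E_n^0(B(\mathbb{Q}_p/\mathbb{Z}_p)^h)}L_{K(t)}E_n^0(\mathrm{Twist}_h^{\mathbb{Z}/p^k}( * ))\cong\mathcal{O}_{(\mathbb{G}_0\oplus_{\mathbb{Z}_p^h}\mathbb{Q}_p^h)[p^k]}$ described in the context, the degree-zero part of $\Upsilon_{\mathbb{Z}/p^k}( * )$ equals the ring homomorphism on global sections.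
   Context: Setting. $h=n-t$. $E_n$ is a Morava $E$-theory of height $n$ over a perfect field $k$ of characteristic $p$, $E_n^0\cong W(k)[[u_1,\dots,u_{n-1}]]$; $\mathbb{G}_{E_n}$ is its formal group viewed as a $p$-divisible group with fixed coordinate $x$, $\mathcal{O}_{\mathbb{G}_{E_n}[p^j]}=E_n^0[[x]]/[p^j](x)$. $L_t=L_{K(t)}E_n^0\cong W(k)[[u_1,\dots,u_{n-1}]][u_t^{-1}]^\wedge_{I_t}$, $I_t=(p,u_1,\dots,u_{t-1})$ ($u_0=p$, $I_0=(0)$). $\mathbb{G}=L_t\otimes_{E_n^0}\mathbb{G}_{E_n}$ has connected-étale sequence $0\to\mathbb{G}_0\to\mathbb{G}\to\mathbb{G}_{et}\to0$ with $\mathbb{G}_0$ the $p$-divisible group of the formal group of $L_{K(t)}E_n$, $\mathcal{O}_{\mathbb{G}_0[p^j]}=L_t[[x]]/[p^j](x)$. The ring $B_t$. With $\bar q=\{q_1,\dots,q_h\}$, $\bar A=\{A_1,\dots,A_h\}$, $$B_t'=\Big(\operatorname{colim}_m L_t[[\bar q]]\otimes_{E_n^0[[\bar q]]}E_n^0[[\bar q,\bar A]]/([p^m](A_1)-q_1,\dots,[p^m](A_h)-q_h)\Big)^\wedge_{I_t+(\bar q)},$$ transition maps $A_j\mapsto[p](A_j)$; $A_j^{(m)}$ denotes the image of $A_j$ from stage $m$. For $t=0$, $L_t[[\bar q]]$ is replaced by $L_{K(0)}E_n^0(B(\mathbb{Q}_p/\mathbb{Z}_p)^h)=L_0$, i.e.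 $\bar q=0$. Over $B_t'$ there is $\mathbb{Q}_p^h\to\mathbb{G}$, $b_j/p^m\mapsto A_j^{(m)}$ ($b_j$ the standard basis), sending $b_j$ to $q_j\in\mathbb{G}_0$, hence $\phi:(\mathbb{Q}_p/\mathbb{Z}_p)^h\to\mathbb{G}_{et}$. Put $\Lambda_m=(\mathbb{Z}/p^m)^h$, $\mathcal{O}_{\mathbb{G}_{et}[p^m]}\cong L_t[y]/(j_m(y))$ with $y$ a generator vanishing at the zero section, $\phi_y(i)\in B_t'$ the image of $y$ under the point $\phi(i)$, $R=\{\phi_y(i):m\ge1,\,0\neq i\in\Lambda_m\}$, $B_t=(R^{-1}B_t')^\wedge_{I_t+(\bar q)}$, $B_t^*=B_t\otimes_{E_n^0}E_n^*$. For an ideal $I$ in an $I$-complete ring $S$, $\operatorname{Spf}_I S=\operatorname{colim}_m\operatorname{Spec}(S/I^m)$. The map of $p$-divisible groups. On a complete $B_t$-algebra $S$, elements of $\mathbb{G}_0\oplus_{\mathbb{Z}_p^h}\mathbb{Q}_p^h$ are tuples $(r,a_1,\dots,a_h)$, $r\in\mathbb{G}_0(S)$, $a_j\in\mathbb{Q}_p$ represented by fractions $i/p^m\in[0,1)$; addition is the formal sum in the first variable and addition in $\mathbb{Q}_p$ in the others, where if some $a_j\ge1$ results one subtracts $1$ from it and formally subtracts $q_j$ from the first entry. For $i=(i_1,\dots,i_h)\in\Lambda_k$ (with $0\le i_j<p^k$) put $[i](\bar q)=[i_1](q_1)+_{\mathbb{G}_0}\cdots+_{\mathbb{G}_0}[i_h](q_h)$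 and $[i](\bar A)=[i_1](A_1^{(k)})+_{\mathbb{G}_{E_n}}\cdots+_{\mathbb{G}_{E_n}}[i_h](A_h^{(k)})$. Then $\mathcal{O}_{(\mathbb{G}_0\oplus_{\mathbb{Z}_p^h}\mathbb{Q}_p^h)[p^k]}\cong\prod_{i\in\Lambda_k}B_t[[x_i]]/([p^k](x_i)-[i](\bar q))$ (the factor $i$ corresponds to tuples with second part $(i_1/p^k,\dots,i_h/p^k)$), and the map to $\mathbb{G}_{E_n}[p^k]$ is given on global sections by $$E_n^0[[x]]/[p^k](x)\to\prod_{i\in\Lambda_k}B_t[[x_i]]/([p^k](x_i)-[i](\bar q)),\qquad x\mapsto(x_i-_{\mathbb{G}_{E_n}}[i](\bar A))_{i\in\Lambda_k}.$$ Twist for $G=\mathbb{Z}/p^k$, $X=*$. For a continuous homomorphism $\alpha:\mathbb{Z}_p^h\to G$, $T(\alpha)$ is the discrete group of classes $[g,s]$, $g\in C(\operatorname{im}\alpha)$ (the centralizer), $s\in\mathbb{Q}_p^h$, modulo $[g,s+j]=[g\alpha(j),s]$ for $j\in\mathbb{Z}_p^h$, with $[g,s][g',s']=[gg',s+s']$; it maps to $(\mathbb{Q}_p/\mathbb{Z}_p)^h$ by $[g,s]\mapsto s$. $\mathrm{Twist}_h^G(X)=\coprod_{[\alpha]}ET(\alpha)\times_{T(\alpha)}X^{\operatorname{im}\alpha}$ over conjugacy classes, with $[g,s]x=gx$. So $\mathrm{Twist}_h^{\mathbb{Z}/p^k}( * )=\coprod_{\alpha}BT(\alpha)$. The map $\Upsilon_{\mathbb{Z}/p^k}(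 * )$. Let $\gamma_k:\mathbb{Z}_p^h\to\Lambda_k$ be the quotient. $T(\gamma_k)\cong(\mathbb{Q}_p/\mathbb{Z}_p)^h$ via $[l,s]\mapsto((l_j+s_j)/p^k)_j$, giving $E_n^0(BT(\gamma_k))\cong E_n^0[[\bar q,\bar A]]/([p^k](A_j)-q_j)_j$. For each $\alpha$, $T(\gamma_k\times\alpha)=T(\gamma_k)\times_{(\mathbb{Q}_p/\mathbb{Z}_p)^h}T(\alpha)$ has elements $[l,g,s]$, and there is a homomorphism $s_\alpha:T(\gamma_k\times\alpha)\to\mathbb{Z}/p^k$, $[l,g,s]\mapsto g-\alpha(l)$. $\Upsilon_{\mathbb{Z}/p^k}( * )$ is the composite of $\prod_\alpha E_n^*(Bs_\alpha):E_n^*(B\mathbb{Z}/p^k)\to\prod_\alpha E_n^*(BT(\gamma_k\times\alpha))\cong E_n^*(BT(\gamma_k))\otimes_{E_n^*(B(\mathbb{Q}_p/\mathbb{Z}_p)^h)}\prod_\alpha E_n^*(BT(\alpha))$ with the map to $B_t^*\otimes_{L_{K(t)}E_n^*(B(\mathbb{Q}_p/\mathbb{Z}_p)^h)}\prod_\alpha L_{K(t)}E_n^*(BT(\alpha))$ given by $q_j\mapsto q_j$, $A_j\mapsto A_j^{(k)}$ on the left factor and localization $E_n\to L_{K(t)}E_n$ on the right factor. Identifications. $E_n^0(B\mathbb{Z}/p^k)\cong E_n^0[[x]]/[p^k](x)$ via the coordinate and the inclusion $\mathbb{Z}/p^k\to\mathbb{Q}_p/\mathbb{Z}_p$, $i\mapsto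 i/p^k$. A homomorphism $\alpha:\mathbb{Z}_p^h\to\mathbb{Z}/p^k$ is identified with $i=(\alpha(b_1),\dots,\alpha(b_h))\in\Lambda_k$; then $L_{K(t)}E_n^0(BT(\alpha))\cong L_t[[\bar q,x_i]]/([p^k](x_i)-[i](\bar q))$, where $q_j$ comes from the character $[g,s]\mapsto s_j$ and $x_i$ from the character $[g,s]\mapsto g/p^k+\sum_j i_js_j/p^k$ of $T(\alpha)$ (with $\bar q=0$ when $t=0$). *)

(* Defs.v *)
From HB Require Import structures.
From mathcomp Require Import all_boot all_order all_algebra.
From mathcomp Require Import boolp.
Set Implicit Arguments.
Unset Strict Implicit.
Unset Printing Implicit Defensive.
Import GRing.Theory.
Local Open Scope ring_scope.
Local Open Scope quotient_scope.

Section Ideals.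
Variable R : comPzRingType.

Inductive in_ideal (G : R -> Prop) : R -> Prop :=
| in_ideal0 : in_ideal G 0
| in_idealD a g x : G g -> in_ideal G x -> in_ideal G (a * g + x).

Fixpoint ideal_pow (G : R -> Prop) (m : nat) : R -> Prop :=
  if m is m'.+1 then
    in_ideal (fun x => exists g y, [/\ G g, ideal_pow G m' y & x = g * y])
  else fun=> True.

Lemma in_idealDD G x y : in_ideal G x -> in_ideal G y -> in_ideal G (x + y).
Proof.
elim=> [|a g z Gg _ IH] Gy; first by rewrite add0r.
by rewrite -addrA; apply: in_idealD => //; apply: IH.
Qed.

Lemma in_idealM G b x : in_ideal G x -> in_ideal G (b * x).
Proof.
elim=> [|a g z Gg _ IH]; first by rewrite mulr0; constructor.
by rewrite mulrDr mulrA; apply: in_idealD.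
Qed.

Definition ideal_pred (G : R -> Prop) : {pred R} := fun x => `[<in_ideal G x>].

Lemma ideal_predP G x : reflect (in_ideal G x) (x \in ideal_pred G).
Proof. exact: asboolP. Qed.

Lemma ideal_zmod_closed G : zmod_closed (ideal_pred G).
Proof.
split=> [|x y /ideal_predP Gx /ideal_predP Gy]; apply/ideal_predP.
  exact: in_ideal0.
by apply: in_idealDD => //; rewrite -mulN1r; apply: in_idealM.
Qed.

HB.instance Definition _ G :=
  GRing.isZmodClosed.Build R (ideal_pred G) (ideal_zmod_closed G).

Section Quot.
Variable G : R -> Prop.

Definition ring_quot : Type := @Quotient.quot R (ideal_pred G).
HB.instance Definition _ := GRing.Zmodule.on ring_quot.

Definition rpi (x : R) : ring_quot := \pi_(@Quotient.quot R (ideal_pred G)) x.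

Lemma rpiP x y : rpi x = rpi y <-> in_ideal G (x - y).
Proof.
split=> [/eqP|H].
  by rewrite /rpi -Quotient.idealrBE => /ideal_predP.
by apply/eqP; rewrite /rpi -Quotient.idealrBE; apply/ideal_predP.
Qed.

Lemma rpi_repr (x : ring_quot) : rpi (repr x) = x.
Proof. exact: reprK. Qed.

Lemma rpi_surj (x : ring_quot) : exists y, x = rpi y.
Proof. by exists (repr x); rewrite rpi_repr. Qed.

Lemma rpiD : {morph rpi : x y / x + y}.
Proof. by move=> x y; rewrite /rpi [LHS]raddfD. Qed.

Definition rq_one : ring_quot := rpi 1.
Definition rq_mul (x y : ring_quot) : ring_quot := rpi (repr x * repr y).

Lemma rpiM x y : rpi (x * y) = rq_mul (rpi x) (rpi y).
Proof.
apply/rpiP.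
have /rpiP Hx : rpi x = rpi (repr (rpi x)) by rewrite rpi_repr.
have /rpiP Hy : rpi y = rpi (repr (rpi y)) by rewrite rpi_repr.
set x' := repr _ in Hx *; set y' := repr _ in Hy *.
have -> : x * y - x' * y' = y * (x - x') + x' * (y - y').
  by rewrite !mulrBr [y * x]mulrC [y * x']mulrC addrA subrK.
by apply: in_idealDD; apply: in_idealM.
Qed.

Let rq_mulA : associative rq_mul.
Proof.
move=> x y z; have [x' ->] := rpi_surj x; have [y' ->] := rpi_surj y.
by have [z' ->] := rpi_surj z; rewrite -!rpiM mulrA.
Qed.
Let rq_mulC : commutative rq_mul.
Proof. by move=> x y; rewrite /rq_mul mulrC. Qed.
Let rq_mul1 : left_id rq_one rq_mul.
Proof. by move=> x; have [x' ->] := rpi_surj x; rewrite -rpiM mul1r. Qed.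
Let rq_mulD : left_distributive rq_mul +%R.
Proof.
move=> x y z; have [x' ->] := rpi_surj x; have [y' ->] := rpi_surj y.
by have [z' ->] := rpi_surj z; rewrite -!(rpiM, rpiD) mulrDl.
Qed.

HB.instance Definition _ := GRing.Zmodule_isComPzRing.Build ring_quot
  rq_mulA rq_mulC rq_mul1 rq_mulD.

Let rpi_zmod : zmod_morphism rpi.
Proof. by move=> x y; rewrite /rpi [LHS]raddfB. Qed.
Let rpi_monoid : monoid_morphism rpi.
Proof. by split=> // x y; rewrite rpiM. Qed.
HB.instance Definition _ := GRing.isZmodMorphism.Build R ring_quot rpi rpi_zmod.
HB.instance Definition _ := GRing.isMonoidMorphism.Build R ring_quot rpi rpi_monoid.
End Quot.
End Ideals.

(* Power series in the variables indexed by the finite type I *)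
Section MPS.
Variables (R : comPzRingType) (I : finType).

Definition mindex := {ffun I -> nat}.
Record mps := Mps { mcoef :> mindex -> R }.

Definition mdeg (nu : mindex) : nat := (\sum_s nu s)%N.
Definition mle (mu nu : mindex) : bool := [forall s, mu s <= nu s]%N.
Definition msub (nu mu : mindex) : mindex := [ffun s => nu s - mu s]%N.
Definition madd (nu mu : mindex) : mindex := [ffun s => nu s + mu s]%N.
Definition m0 : mindex := [ffun=> 0%N].
Definition below (nu : mindex) : seq mindex :=
  [seq mu <- [seq [ffun s => val (a s)] | a : {ffun I -> 'I_(mdeg nu).+1}] | mle mu nu].

Lemma mps_ext (f g : mps) : f =1 g -> f = g.
Proof. by case: f g => f [g] /= fg; congr Mps; apply/funext. Qed.

Lemma below_uniq nu : uniq (below nu).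
Proof.
apply: filter_uniq; rewrite map_inj_uniq ?enum_uniq // => a b ab.
by apply/ffunP => s; apply: val_inj; move/ffunP: ab => /(_ s); rewrite !ffunE.
Qed.

Lemma mem_below nu mu : (mu \in below nu) = mle mu nu.
Proof.
rewrite mem_filter; case le: (mle mu nu) => //=; apply/mapP.
have lt s : (mu s < (mdeg nu).+1)%N.
  rewrite ltnS (leq_trans (forallP le s)) // /mdeg (bigD1 s) //=.
  exact: leq_addr.
exists [ffun s => Ordinal (lt s)]; first exact: mem_enum.
by apply/ffunP => s; rewrite !ffunE.
Qed.

Definition mps_add (f g : mps) := Mps (fun nu => f nu + g nu).
Definition mps_opp (f : mps) := Mps (fun nu => - f nu).
Definition mpsC (c : R) := Mps (fun nu => if nu == m0 then c else 0).
Definition mps_mul (f g : mps) :=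
  Mps (fun nu => \sum_(mu <- below nu) f mu * g (msub nu mu)).
Definition mpsX (s : I) : mps :=
  Mps (fun nu => (nu == [ffun r => nat_of_bool (r == s)])%:R).

HB.instance Definition _ := gen_eqMixin mps.
HB.instance Definition _ := gen_choiceMixin mps.

Let addA : associative mps_add.
Proof. by move=> f g h; apply: mps_ext => nu /=; rewrite addrA. Qed.
Let addC : commutative mps_add.
Proof. by move=> f g; apply: mps_ext => nu /=; rewrite addrC. Qed.
Let add0 : left_id (mpsC 0) mps_add.
Proof. by move=> f; apply: mps_ext => nu /=; rewrite if_same add0r. Qed.
Let addN : left_inverse (mpsC 0) mps_opp mps_add.
Proof. by move=> f; apply: mps_ext => nu /=; rewrite if_same addNr. Qed.
HB.instance Definition _ := GRing.isZmodule.Build mps addA addC add0 addN.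

Lemma msubK nu mu : mle mu nu -> msub nu (msub nu mu) = mu.
Proof. by move=> /forallP le; apply/ffunP=> s; rewrite !ffunE subKn. Qed.
Lemma mle_sub nu mu : mle (msub nu mu) nu.
Proof. by apply/forallP=> s; rewrite ffunE leq_subr. Qed.

Let mulC : commutative mps_mul.
Proof.
move=> f g; apply: mps_ext => nu /=.
have /(perm_big _) -> : perm_eq (below nu) [seq msub nu mu | mu <- below nu].
  apply: uniq_perm; first exact: below_uniq.
    rewrite map_inj_in_uniq ?below_uniq // => a b.
    by rewrite !mem_below => la lb /(congr1 (msub nu)); rewrite !msubK.
  move=> mu; rewrite mem_below; apply/idP/mapP => [le|[a _ ->]]; last exact: mle_sub.
  by exists (msub nu mu); rewrite ?msubK // mem_below mle_sub.
rewrite big_map big_seq [RHS]big_seq; apply: eq_bigr => mu.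
by rewrite mem_below => le; rewrite msubK // mulrC.
Qed.

Let mulA : associative mps_mul.
Proof.
move=> f g h; rewrite [mps_mul f (mps_mul g h)]mulC.
apply: mps_ext => nu; rewrite -/(mps_mul _ _ nu).
have -> : mps_mul (mps_mul g h) f nu = mps_mul f (mps_mul g h) nu by rewrite mulC.
rewrite /=.
transitivity (\sum_(a <- below nu) \sum_(b <- below (msub nu a))
   f a * g b * h (msub (msub nu a) b)).
  by apply: eq_bigr => a _; rewrite big_distrr /=; apply: eq_bigr => b _; rewrite mulrA.
transitivity (\sum_(k <- below nu) \sum_(a <- below k)
   f a * g (msub k a) * h (msub nu k)); last first.
  by apply: eq_bigr => a _; rewrite big_distrl.
pose F1 (c : mindex * mindex) := f c.1 * g c.2 * h (msub (msub nu c.1) c.2).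
pose F2 (c : mindex * mindex) := f c.2 * g (msub c.1 c.2) * h (msub nu c.1).
rewrite -[LHS](big_allpairs_dep (I2 := fun=> mindex) (h := fun a b => (a, b)) (F := F1)).
rewrite -[RHS](big_allpairs_dep (I2 := fun=> mindex) (h := fun a b => (a, b)) (F := F2)).
set s1 := (X in \big[_/_]_(i <- X) _ = _); set s2 := (X in _ = \big[_/_]_(i <- X) _).
have mle_add k a : mle a k -> madd a (msub k a) = k.
  by move=> /forallP le; apply/ffunP=> s; rewrite !ffunE subnKC.
have addK a b : msub (madd a b) a = b.
  by apply/ffunP=> s; rewrite !ffunE addKn.
have u1 : uniq s1.
  apply: allpairs_uniq_dep => [|? _|[a b] [c d] _ _ /= [-> ->]]; by rewrite ?below_uniq.
have u2 : uniq s2.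
  apply: allpairs_uniq_dep => [|? _|[a b] [c d] _ _ /= [-> ->]]; by rewrite ?below_uniq.
have m1 c : (c \in s1) = mle c.1 nu && mle c.2 (msub nu c.1).
  case: c => a b; apply/allpairsPdep/andP => [[x [y [hx hy [-> ->]]]]|[ha hb]].
    by rewrite -!mem_below.
  by exists a, b; rewrite !mem_below.
have m2 c : (c \in s2) = mle c.1 nu && mle c.2 c.1.
  case: c => a b; apply/allpairsPdep/andP => [[x [y [hx hy [-> ->]]]]|[ha hb]].
    by rewrite -!mem_below.
  by exists a, b; rewrite !mem_below.
have /(perm_big _) -> : perm_eq s1 [seq (c.2, msub c.1 c.2) | c <- s2].
  apply: uniq_perm => //.
    rewrite map_inj_in_uniq // => -[k a] [k' a'].
    rewrite !m2 /= => /andP[_ l1] /andP[_ l2] [e]; subst a'.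
    by move=> /(congr1 (madd a)); rewrite !mle_add // => ->.
  move=> [a b]; rewrite m1 /=; apply/andP/mapP => [[/forallP la /forallP lb]|].
    exists (madd a b, a); rewrite ?addK //= m2 /=; apply/andP; split; apply/forallP=> s.
      have := lb s; rewrite !ffunE => lb'.
      by rewrite -(subnKC (la s)) leq_add2l.
    by rewrite ffunE leq_addr.
  case=> -[k c]; rewrite m2 /= => /andP[/forallP lk /forallP lc] [-> ->].
  split; apply/forallP=> s; first exact: leq_trans (lc s) (lk s).
  by rewrite !ffunE leq_sub2r.
rewrite big_map big_seq [RHS]big_seq; apply: eq_bigr => -[k a] /=.
rewrite m2 /= => /andP[/forallP lk /forallP lc]; congr (_ * h _).
by apply/ffunP => s; rewrite !ffunE -subnDA subnKC.
Qed.

Let mul1 : left_id (mpsC 1) mps_mul.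
Proof.
move=> f; apply: mps_ext => nu /=.
rewrite (bigD1_seq (m0)) ?below_uniq //=; last first.
  by rewrite mem_below; apply/forallP => s; rewrite ffunE.
rewrite eqxx mul1r big1 ?addr0 => [|mu /negPf ->]; last by rewrite mul0r.
by congr (f _); apply/ffunP => s; rewrite !ffunE subn0.
Qed.
Let mulD : left_distributive mps_mul +%R.
Proof.
move=> f g h; apply: mps_ext => nu /=; rewrite -big_split /=.
by apply: eq_bigr => mu _; rewrite mulrDl.
Qed.
HB.instance Definition _ :=
  GRing.Zmodule_isComPzRing.Build mps mulA mulC mul1 mulD.
End MPS.
Arguments m0 {I}.
Arguments mpsX {R I} s.
Arguments mpsC {R} I c.

Definition unitdeg (n : nat) : mindex unit := [ffun=> n].

Definition map_mps (R S : comPzRingType) (I : finType) (phi : R -> S)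
  (f : mps R I) : mps S I := Mps (fun nu => phi (f nu)).

(* f(a), for f in R[[I]] and a family of series a without constant term: only
   the monomials nu of f with all exponents <= |mu| contribute in degree mu. *)
Definition subst (R : comPzRingType) (I J : finType) (f : mps R I)
    (a : I -> mps R J) : mps R J :=
  Mps (fun mu => \sum_(nu : {ffun I -> 'I_(mdeg mu).+1})
    f [ffun s => val (nu s)] * (\prod_s a s ^+ nu s) mu).

Definition rename (R : comPzRingType) (I J : finType) (v : I -> J)
  (f : mps R I) : mps R J := subst f (fun s => mpsX (v s)).

(* [coef_in_right f n]: the coefficient of y^n in f in R[[I]][[y]]. *)
Definition coef_in_right (R : comPzRingType) (I : finType)
    (f : mps R (I + unit)%type) (n : mindex unit) : mps R I :=
  Mps (fun mu => f [ffun s => match s with inl i => mu i | inr j => n j end]).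

Section Predicates.

Definition image_of (A B : Type) (f : A -> B) (G : A -> Prop) : B -> Prop :=
  fun y => exists2 x, G x & y = f x.

(* For a finitely generated ideal (G) this says that S, with the map f, is
   lim_m R/(G)^m. *)
Definition is_completion (R S : comPzRingType) (f : {rmorphism R -> S})
    (G : R -> Prop) : Prop :=
  let J := ideal_pow (image_of f G) in
  [/\ forall m x, J m (f x) <-> ideal_pow G m x,
      forall m y, exists x, J m (y - f x),
      forall y, (forall m, J m y) -> y = 0
    & forall s : nat -> S, (forall m, J m (s m.+1 - s m)) ->
        exists y, forall m, J m (y - s m)].

Definition inverts (R S : comPzRingType) (f : R -> S) (M : R -> Prop) : Prop :=
  forall x, M x -> exists y, f x * y = 1.

Definition is_localization (R S : comPzRingType) (f : {rmorphism R -> S})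
    (M : R -> Prop) : Prop :=
  inverts f M /\
  forall (T : comPzRingType) (g : {rmorphism R -> T}), inverts g M ->
    exists h : {rmorphism S -> T}, h \o f =1 g /\
      forall h' : {rmorphism S -> T}, h' \o f =1 g -> h' =1 h.

(* P, with g1 and g2, is the tensor product of A1 and A2 over R. *)
Definition is_tensor (R A1 A2 P : comPzRingType) (f1 : R -> A1) (f2 : R -> A2)
    (g1 : {rmorphism A1 -> P}) (g2 : {rmorphism A2 -> P}) : Prop :=
  g1 \o f1 =1 g2 \o f2 /\
  forall (T : comPzRingType) (k1 : {rmorphism A1 -> T}) (k2 : {rmorphism A2 -> T}),
    k1 \o f1 =1 k2 \o f2 ->
    exists h : {rmorphism P -> T}, (h \o g1 =1 k1 /\ h \o g2 =1 k2) /\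
      forall h' : {rmorphism P -> T},
        h' \o g1 =1 k1 -> h' \o g2 =1 k2 -> h' =1 h.

Definition is_seq_colim (C : nat -> comPzRingType)
    (tr : forall m, {rmorphism C m -> C m.+1}) (D : comPzRingType)
    (c : forall m, {rmorphism C m -> D}) : Prop :=
  (forall m, c m.+1 \o tr m =1 c m) /\
  forall (T : comPzRingType) (k : forall m, {rmorphism C m -> T}),
    (forall m, k m.+1 \o tr m =1 k m) ->
    exists h : {rmorphism D -> T}, (forall m, h \o c m =1 k m) /\
      forall h' : {rmorphism D -> T}, (forall m, h' \o c m =1 k m) -> h' =1 h.

End Predicates.

Section FormalGroupLaws.
Variable R : comPzRingType.

(* [law_add] is F(x, y), with x and y the variables inl tt and inr tt;
   [law_opp] is the inverse series. *)
Record group_law := GroupLaw {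
  law_add : mps R (unit + unit)%type;
  law_opp : mps R unit }.

Variable F : group_law.

Section Operations.
Variable I : finType.
Implicit Types a b : mps R I.
Definition fadd a b : mps R I :=
  subst (law_add F) (fun s => if s is inl _ then a else b).
Definition fopp a : mps R I := subst (law_opp F) (fun=> a).
Definition fmul (m : nat) a : mps R I := iter m (fadd a) 0.
(* [i_1](a_1) +_F ... +_F [i_h](a_h) *)
Definition fcomb (h : nat) (i : 'I_h -> nat) (a : 'I_h -> mps R I) : mps R I :=
  \big[fadd/0]_(j < h) fmul (i j) (a j).
End Operations.

Definition is_group_law : Prop :=
  [/\ fadd (mpsX tt) 0 = mpsX tt,
      fadd (mpsX (inr tt)) (mpsX (inl tt)) = law_add F,
      let x := mpsX (inl (inl tt)) in
      let y := mpsX (inl (inr tt)) in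
      let z : mps R ((unit + unit) + unit)%type := mpsX (inr tt) in
        fadd (fadd x y) z = fadd x (fadd y z),
      law_opp F m0 = 0
    & fadd (mpsX tt) (law_opp F) = 0].

(* If P is the function f |-> f(b) of an R-point b of the formal group, then
   [translate P f] is the series f(b +_F x), expanded in powers of x. The
   point b need not be topologically nilpotent in S. *)
Definition translate (S : comPzRingType) (P : mps R unit -> S)
    (f : mps R unit) : mps S unit :=
  Mps (fun n => P (coef_in_right (subst f (fun=> law_add F)) n)).

End FormalGroupLaws.

Definition map_law (R S : comPzRingType) (phi : R -> S) (F : group_law R) :=
  GroupLaw (map_mps phi (law_add F)) (map_mps phi (law_opp F)).

(* Over a field of characteristic p. *)
Definition has_height (R : comPzRingType) (F : group_law R) (p n : nat) : Prop :=
  let px := fmul F p (mpsX tt) in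
  (forall m, (m < p ^ n)%N -> px (unitdeg m) = 0) /\ px (unitdeg (p ^ n)) <> 0.

Section Values.
Variables (R S : comPzRingType) (phi : R -> S) (Fil : nat -> S -> Prop).
Variables (I : finType) (a : I -> S).

Definition partial_sum (f : mps R I) (M : nat) : S :=
  \sum_(nu : {ffun I -> 'I_M} | (\sum_s nu s < M)%N)
    phi (f [ffun s => val (nu s)]) * \prod_s a s ^+ nu s.

(* y = f(a), for the topology given by the filtration Fil *)
Definition is_value (f : mps R I) (y : S) : Prop :=
  forall s, exists N, forall M, (N <= M)%N -> Fil s (y - partial_sum f M).

(* f |-> f(a) is an isomorphism from R[[I]]/(G) to S. *)
Definition is_presented (G : mps R I -> Prop) : Prop :=
  [/\ forall f, exists y, is_value f y,
      forall f y y', is_value f y -> is_value f y' -> y = y',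
      forall y, exists f, is_value f y
    & forall f, is_value f 0 <-> in_ideal G f].
End Values.

Section SimplicialSets.
Local Open Scope nat_scope.

Definition monotone m n (f : 'I_m.+1 -> 'I_n.+1) : Prop :=
  forall i j : 'I_m.+1, i <= j -> f i <= f j.

Lemma monotone_comp l m n (g : 'I_l.+1 -> 'I_m.+1) (f : 'I_m.+1 -> 'I_n.+1) :
  monotone f -> monotone g -> monotone (f \o g).
Proof. by move=> hf hg i j ij; exact: hf (hg _ _ ij). Qed.

Record sSet := SSet {
  simp :> nat -> Type;
  sact : forall m n (f : 'I_m.+1 -> 'I_n.+1), monotone f -> simp n -> simp m;
  sact_id : forall n (f : 'I_n.+1 -> 'I_n.+1) (hf : monotone f) x,
    f =1 id -> sact hf x = x;
  sact_comp : forall l m n (g : 'I_l.+1 -> 'I_m.+1) (f : 'I_m.+1 -> 'I_n.+1)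
    (e : 'I_l.+1 -> 'I_n.+1) (hg : monotone g) (hf : monotone f)
    (he : monotone e) x, e =1 f \o g -> sact he x = sact hg (sact hf x) }.

Record smap (X Y : sSet) := SMap {
  sfun :> forall n, X n -> Y n;
  sfun_act : forall m n (f : 'I_m.+1 -> 'I_n.+1) (hf : monotone f) x,
    sfun (sact hf x) = sact hf (sfun x) }.

Definition scomp (X Y Z : sSet) (g : smap Y Z) (f : smap X Y) : smap X Z.
Proof.
by exists (fun n x => g n (f n x)) => m n e he x; rewrite !sfun_act.
Defined.

Record spair := SPair {
  total :> sSet;
  sub : forall n, total n -> Prop;
  sub_act : forall m n (f : 'I_m.+1 -> 'I_n.+1) (hf : monotone f) x,
    sub x -> sub (sact hf x) }.

Record pmap (P Q : spair) := PMap {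
  pfun :> smap P Q;
  pfun_sub : forall n x, @sub P n x -> sub (pfun n x) }.

Definition absolute (X : sSet) : spair := @SPair X (fun _ _ => False) (fun _ _ _ _ _ H => H).

Definition absmap (X Y : sSet) (f : smap X Y) : pmap (absolute X) (absolute Y) :=
  @PMap (absolute X) (absolute Y) f (fun _ _ H => H).

Definition to_pair (P : spair) : pmap (absolute P) P.
Proof.
by exists (SMap (X := absolute P) (Y := P) (sfun := fun n x => x) (fun _ _ _ _ _ => erefl)).
Defined.

Definition subspace (P : spair) : sSet.
Proof.
exists (fun n => {x : P n | @sub P n x})
  (fun m n f hf x => exist _ (sact hf (sval x)) (sub_act hf (svalP x))).
- by move=> n f hf [x hx] fid; apply: eq_exist; rewrite /= sact_id.
- move=> l m n g f e hg hf he [x hx] efg; apply: eq_exist => /=.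
  exact: sact_comp.
Defined.

Definition sub_incl (P : spair) : smap (subspace P) P.
Proof. by exists (fun n x => sval x). Defined.

Definition sub_map (P Q : spair) (f : pmap P Q) : smap (subspace P) (subspace Q).
Proof.
exists (fun n x => exist _ (f n (sval x)) (pfun_sub f (svalP x))).
by move=> m n e he [x hx]; apply: eq_exist => /=; rewrite sfun_act.
Defined.

(* For subcomplexes A and B of X: the pairs (X, A) and (B, A n B). *)
Definition excised (P : spair) (B : forall n, P n -> Prop)
  (hB : forall m n (f : 'I_m.+1 -> 'I_n.+1) (hf : monotone f) x,
     B n x -> B m (sact hf x)) : spair :=
  @SPair (subspace (SPair hB)) (fun n x => @sub P n (sval x))
    (fun m n f hf x H => @sub_act P m n f hf (sval x) H).

Definition excision_map (P : spair) (B : forall n, P n -> Prop) hB :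
  pmap (@excised P B hB) P :=
  @PMap (@excised P B hB) P (sub_incl (SPair hB)) (fun _ _ H => H).

Definition spoint : sSet.
Proof. by exists (fun=> unit) (fun _ _ _ _ x => x). Defined.

Definition sconst (X : sSet) : smap X spoint.
Proof. by exists (fun n x => tt). Defined.

(* P x Delta^1 *)
Definition cylinder_total (X : sSet) : sSet.
Proof.
exists (fun n => (X n * {d : 'I_n.+1 -> 'I_2 | monotone d})%type)
  (fun m n f hf x => (sact hf x.1,
     exist _ (sval x.2 \o f) (monotone_comp (svalP x.2) hf))).
- move=> n f hf [x [d hd]] fid; congr pair; first exact: sact_id.
  by apply: eq_exist; apply/funext => i /=; rewrite fid.
- move=> l m n g f e hg hf he [x [d hd]] efg; congr pair; first exact: sact_comp.
  by apply: eq_exist; apply/funext => i /=; rewrite efg.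
Defined.

Definition cylinder (P : spair) : spair.
Proof.
exists (cylinder_total P) (fun n x => @sub P n x.1).
by move=> m n f hf x; apply: sub_act.
Defined.

Definition cylinder_proj (P : spair) : pmap (cylinder P) P.
Proof.
unshelve eexists; first by exists (fun n (x : cylinder P n) => x.1).
by [].
Defined.

Definition scoprod (T : Type) (X : T -> sSet) : sSet.
Proof.
exists (fun n => {t : T & X t n}) (fun m n f hf x => existT (fun t => X t m) (tag x) (sact hf (tagged x))).
- by move=> n f hf [t x] fid /=; rewrite sact_id.
- by move=> l m n g f e hg hf he [t x] efg /=; rewrite (sact_comp hg hf he).
Defined.

Definition sincl (T : Type) (X : T -> sSet) (t : T) : smap (X t) (scoprod X).
Proof. by exists (fun n x => existT (fun t => X t n) t x). Defined.

Definition scase (T : Type) (X : T -> sSet) (Y : sSet)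
  (f : forall t, smap (X t) Y) : smap (scoprod X) Y.
Proof.
exists (fun n x => f (tag x) n (tagged x)).
by move=> m n e he [t x] /=; rewrite sfun_act.
Defined.

Definition scoprod_map (T : Type) (X Y : T -> sSet)
  (f : forall t, smap (X t) (Y t)) : smap (scoprod X) (scoprod Y) :=
  scase (fun t => scomp (sincl Y t) (f t)).

Definition skeleton (s : nat) (X : sSet) : spair.
Proof.
exists X (fun n x => exists m (f : 'I_n.+1 -> 'I_m.+1) (hf : monotone f) y,
  m <= s /\ x = sact hf y).
move=> l n g hg x [m [f [hf [y [ms ->]]]]].
have hfg := monotone_comp hf hg.
by exists m, (f \o g), hfg, y; split=> //; rewrite (sact_comp hg hf hfg).
Defined.

End SimplicialSets.

(* The nerve of an abelian group G; an n-simplex is a functor from the poset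
   {0 < ... < n} to G, extended to all pairs (i, j) by inversion. *)
Section Nerve.
Definition is_cocycle (G : zmodType) n (g : 'I_n.+1 -> 'I_n.+1 -> G) : Prop :=
  forall i j l, g i j + g j l = g i l.

Definition nerve_simplex (G : zmodType) n :=
  {g : 'I_n.+1 -> 'I_n.+1 -> G | is_cocycle g}.

Definition classifying (G : zmodType) : sSet.
Proof.
exists (nerve_simplex G) (fun m n f hf (g : nerve_simplex G n) =>
  exist (@is_cocycle G m) (fun i j => sval g (f i) (f j))
    (fun i j l => svalP g (f i) (f j) (f l))).
- move=> n f hf [g hg] fid; apply: eq_exist; apply/funext => i; apply/funext => j /=.
  by rewrite !fid.
- move=> l m n g f e hg hf he [x hx] efg; apply: eq_exist.
  by apply/funext => i; apply/funext => j /=; rewrite !efg.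
Defined.

Definition classifying_map (G H : zmodType) (f : {additive G -> H}) :
  smap (classifying G) (classifying H).
Proof.
unshelve eexists.
  move=> n g; exists (fun i j => f (sval (g : nerve_simplex G n) i j)).
  by move=> i j l; rewrite -raddfD (svalP g).
by move=> m n e he x; apply: eq_exist.
Defined.
End Nerve.

Section CohomologyTheories.

Definition castdeg (C : int -> Type) i j (e : i = j) (x : C i) : C j :=
  ecast l (C l) e x.
Arguments castdeg C [i j] e x.

Definition koszul (V : zmodType) (i j : int) (x : V) : V :=
  if odd (absz (i * j)) then - x else x.

(* Multiplicative generalized cohomology theories, on pairs of simplicial sets:
   the Eilenberg-Steenrod axioms without the dimension axiom, with the
   additivity axiom, and products E^i(X) x E^j(X, A) -> E^(i+j)(X, A). *)
Record cohomology := Cohomology {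
  coh : int -> spair -> zmodType;
  pull : forall i (P Q : spair), pmap P Q -> {additive coh i Q -> coh i P};
  pull_id : forall i (P : spair) (f : pmap P P) x,
    (forall n s, f n s = s) -> pull i f x = x;
  pull_comp : forall i (P Q S : spair) (f : pmap P Q) (g : pmap Q S) (h : pmap P S) x,
    (forall n s, h n s = g n (f n s)) -> pull i h x = pull i f (pull i g x);
  homotopy : forall i (P : spair), bijective (pull i (cylinder_proj P));

  bdry : forall i (P : spair), {additive coh i (absolute (subspace P)) -> coh (i + 1) P};
  bdry_nat : forall i (P Q : spair) (f : pmap P Q) x,
    bdry i P (pull i (absmap (sub_map f)) x) = pull (i + 1) f (bdry i Q x);
  exact_total : forall i (P : spair) (x : coh i (absolute P)),
    pull i (absmap (sub_incl P)) x = 0 <-> exists y, x = pull i (to_pair P) y;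
  exact_sub : forall i (P : spair) (x : coh i (absolute (subspace P))),
    bdry i P x = 0 <-> exists y, x = pull i (absmap (sub_incl P)) y;
  exact_rel : forall i (P : spair) (x : coh (i + 1) P),
    pull (i + 1) (to_pair P) x = 0 <-> exists y, x = bdry i P y;
  excision : forall i (P : spair) (B : forall n, P n -> Prop) hB,
    (forall n (x : P n), @sub P n x \/ B n x) ->
    bijective (pull i (@excision_map P B hB));
  additivity : forall i (T : Type) (X : T -> sSet)
      (x : forall t, coh i (absolute (X t))),
    exists! y : coh i (absolute (scoprod X)),
      forall t, pull i (absmap (sincl X t)) y = x t;

  cup : forall i j (P : spair), coh i (absolute P) -> coh j P -> coh (i + j) P;
  coh_unit : forall X, coh 0 (absolute X);
  cupDl : forall i j (P : spair) (x x' : coh i (absolute P)) (y : coh j P),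
    cup (x + x') y = cup x y + cup x' y;
  cupDr : forall i j (P : spair) (x : coh i (absolute P)) (y y' : coh j P),
    cup x (y + y') = cup x y + cup x y';
  cup1 : forall j (P : spair) (y : coh j P),
    cup (coh_unit P) y = castdeg (fun l => coh l P) (esym (add0r j)) y;
  cupA : forall i j l (P : spair) (x : coh i (absolute P)) (y : coh j (absolute P))
      (z : coh l P),
    cup x (cup y z) = castdeg (fun l => coh l P) (esym (addrA i j l))
      (cup (P := P) (cup (P := absolute P) x y) z);
  cupC : forall i j X (x : coh i (absolute X)) (y : coh j (absolute X)),
    cup (P := absolute X) x y = castdeg (fun l => coh l (absolute X)) (addrC j i)
      (koszul i j (cup (P := absolute X) y x));
  pull_cup : forall i j (P Q : spair) (f : pmap P Q) (x : coh i (absolute Q)) (y : coh j Q),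
    pull (i + j) f (cup x y) = cup (pull i (absmap f) x) (pull j f y);
  pull_unit : forall X Y (f : smap X Y), pull 0 (absmap f) (coh_unit Y) = coh_unit X;
  bdry_cup : forall i j (P : spair) (x : coh i (absolute P))
      (y : coh j (absolute (subspace P))),
    bdry (i + j) P (cup (P := absolute (subspace P))
      (pull i (absmap (sub_incl P)) x) y) =
    castdeg (fun l => coh l P) (addrA i j 1) (koszul i 1 (cup x (bdry j P y))) }.

Section DegreeZero.
Variable E : cohomology.

Definition coh0 (X : sSet) : Type := coh E 0 (absolute X).
HB.instance Definition _ X := GRing.Zmodule.on (coh0 X).

Section Ring.
Variable X : sSet.

Definition cup0 (x y : coh0 X) : coh0 X := cup (P := absolute X) x y.

Let cast0 (C : int -> Type) (e : 0 = 0 :> int) (x : C 0) : castdeg C e x = x.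
Proof. by rewrite (eq_irrelevance e erefl). Qed.

Let cup0A : associative cup0.
Proof. by move=> x y z; exact: etrans (@cupA E 0 0 0 (absolute X) x y z) (cast0 _ _). Qed.
Let cup0C : commutative cup0.
Proof. by move=> x y; exact: etrans (@cupC E 0 0 X x y) (cast0 _ _). Qed.
Let cup01 : left_id (coh_unit E X) cup0.
Proof. by move=> x; exact: etrans (@cup1 E 0 (absolute X) x) (cast0 _ _). Qed.
Let cup0D : left_distributive cup0 +%R.
Proof. by move=> x y z; exact: (@cupDl E 0 0 (absolute X) x y z). Qed.
HB.instance Definition _ := GRing.Zmodule_isComPzRing.Build (coh0 X)
  cup0A cup0C cup01 cup0D.
End Ring.

Definition pull0 (X Y : sSet) (f : smap X Y) : coh0 Y -> coh0 X :=
  pull E 0 (absmap f).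
Let pull0_zmod X Y (f : smap X Y) : zmod_morphism (pull0 f).
Proof. exact: raddfB. Qed.
Let pull0_monoid X Y (f : smap X Y) : monoid_morphism (pull0 f).
Proof. by split=> [|x y]; [exact: pull_unit | exact: (@pull_cup E 0 0 _ _ (absmap f) x y)]. Qed.
HB.instance Definition _ X Y (f : smap X Y) :=
  GRing.isZmodMorphism.Build (coh0 Y) (coh0 X) (pull0 f) (pull0_zmod f).
HB.instance Definition _ X Y (f : smap X Y) :=
  GRing.isMonoidMorphism.Build (coh0 Y) (coh0 X) (pull0 f) (pull0_monoid f).

Definition coef := coh0 spoint.
HB.instance Definition _ := GRing.ComPzRing.on coef.

Definition skeletal_filtration (X : sSet) (s : nat) (x : coh0 X) : Prop :=
  pull0 (sub_incl (skeleton s X)) x = 0.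

(* y = f(a) in E^0(X), for f in E^0[[I]] *)
Definition coh_value (X : sSet) (I : finType) (a : I -> coh0 X)
    (f : mps coef I) (y : coh0 X) : Prop :=
  is_value (pull0 (sconst X)) (@skeletal_filtration X) a f y.
Definition coh_presented (X : sSet) (I : finType) (a : I -> coh0 X)
    (G : mps coef I -> Prop) : Prop :=
  is_presented (pull0 (sconst X)) (@skeletal_filtration X) a G.
End DegreeZero.

Record coh_transformation (E L : cohomology) := CohTransformation {
  trans : forall i (P : spair), {additive coh E i P -> coh L i P};
  trans_pull : forall i (P Q : spair) (f : pmap P Q) x,
    trans i P (pull E i f x) = pull L i f (trans i Q x);
  trans_bdry : forall i (P : spair) x,
    trans (i + 1) P (bdry E i P x) = bdry L i P (trans i _ x);
  trans_cup : forall i j (P : spair) (x : coh E i (absolute P)) (y : coh E j P),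
    trans (i + j) P (cup x y) = cup (trans i _ x) (trans j P y);
  trans_unit : forall X, trans 0 _ (coh_unit E X) = coh_unit L X }.

Section TransformationZero.
Variables (E L : cohomology) (eta : coh_transformation E L) (X : sSet).
Definition trans0 : coh0 E X -> coh0 L X := trans eta 0 (absolute X).
Let trans0_zmod : zmod_morphism trans0.
Proof. exact: raddfB. Qed.
Let trans0_monoid : monoid_morphism trans0.
Proof. by split=> [|x y]; [exact: trans_unit | exact: (@trans_cup _ _ eta 0 0 (absolute X) x y)]. Qed.
HB.instance Definition _ :=
  GRing.isZmodMorphism.Build (coh0 E X) (coh0 L X) trans0 trans0_zmod.
HB.instance Definition _ :=
  GRing.isMonoidMorphism.Build (coh0 E X) (coh0 L X) trans0 trans0_monoid.
End TransformationZero.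

(* The odd coefficient groups vanish and E^2(pt) contains a unit. *)
Definition even_periodic (E : cohomology) : Prop :=
  (forall i (x : coh E i (absolute spoint)), odd (absz i) -> x = 0) /\
  exists (b : coh E 2 (absolute spoint)) (b' : coh E (- 2) (absolute spoint)),
    cup (P := absolute spoint) b b' =
    castdeg (fun l => coh E l (absolute spoint)) (esym (subrr 2)) (coh_unit E spoint).
End CohomologyTheories.

Definition mk_additive (U V : zmodType) (f : U -> V) (fB : zmod_morphism f) :
    {additive U -> V} :=
  HB.pack_for {additive U -> V} f (GRing.isZmodMorphism.Build U V f fB).

Section QuotientGroups.
Variables (V W : zmodType) (I : zmodClosed V) (phi : {additive V -> W}).
Hypothesis phiI : forall x, x \in I -> phi x = 0.

Definition quot_lift_fun (x : Quotient.quot I) : W := phi (repr x).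

Lemma quot_lift_pi x : quot_lift_fun (\pi_(Quotient.quot I) x) = phi x.
Proof.
apply/eqP; rewrite -subr_eq0 -raddfB; apply/eqP/phiI.
by rewrite Quotient.idealrBE reprK.
Qed.

Lemma quot_lift_zmod : zmod_morphism quot_lift_fun.
Proof.
move=> x y; rewrite -[x]reprK -[y]reprK -raddfB /=.
by rewrite !quot_lift_pi raddfB.
Qed.

Definition quot_lift : {additive Quotient.quot I -> W} := mk_additive quot_lift_zmod.
End QuotientGroups.

(* The p-adic integers: the completion of int at p. *)
Record padic_integers (p : nat) := PadicIntegers {
  Zp :> idomainType;
  padic_completion :
    is_completion (intmul 1 : {rmorphism int -> Zp}) (eq p%:R) }.

Section TwistGroups.
Variables (p : nat) (Z : padic_integers p) (h : nat).

Definition Qp : fieldType := {fraction Z}.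
Definition Zp_in_Qp (z : Z) : Qp := @FracField.tofrac Z z.
HB.instance Definition _ := GRing.RMorphism.copy Zp_in_Qp (@FracField.tofrac Z).

Definition Zp_pred : {pred Qp} := fun s => `[<exists z : Z, s = Zp_in_Qp z>].
Lemma Zp_pred_closed : zmod_closed Zp_pred.
Proof.
split=> [|_ _ /asboolP[x ->] /asboolP[y ->]]; apply/asboolP.
  by exists 0; rewrite raddf0.
by exists (x - y); rewrite raddfB.
Qed.
HB.instance Definition _ := GRing.isZmodClosed.Build Qp Zp_pred Zp_pred_closed.

Definition QpZp : zmodType := Quotient.quot Zp_pred.
Definition modZp : {additive Qp -> QpZp} := \pi_(Quotient.quot Zp_pred).

Lemma modZp_eq0 z : modZp (Zp_in_Qp z) = 0.
Proof.
apply/eqP; rewrite -(raddf0 modZp) -Quotient.idealrBE subr0.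
by apply/asboolP; exists z.
Qed.

Section Twist.
Variables (G : zmodType) (a : {additive 'rV[Z]_h -> G}).

Definition twist_rel : {pred (G * 'rV[Qp]_h)%type} :=
  fun x => `[<exists j, x = (a j, - map_mx Zp_in_Qp j)>].
Lemma twist_rel_closed : zmod_closed twist_rel.
Proof.
split=> [|_ _ /asboolP[x ->] /asboolP[y ->]]; apply/asboolP.
  by exists 0; rewrite raddf0 map_mx0 oppr0.
by exists (x - y); rewrite raddfB map_mxB opprD.
Qed.
HB.instance Definition _ :=
  GRing.isZmodClosed.Build (G * 'rV[Qp]_h)%type twist_rel twist_rel_closed.

(* T(a), for an abelian group G, so that the centralizer of im a is G. *)
Definition twist : zmodType := Quotient.quot twist_rel.

(* [g, s] *)
Definition twist_class : {additive (G * 'rV[Qp]_h)%type -> twist} :=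
  \pi_(Quotient.quot twist_rel).

Section Lift.
Variables (W : zmodType) (phi : {additive (G * 'rV[Qp]_h)%type -> W}).
Hypothesis phi0 : forall j, phi (a j, - map_mx Zp_in_Qp j) = 0.
Lemma twist_lift_rel x : x \in twist_rel -> phi x = 0.
Proof. by move=> /asboolP[j ->]. Qed.
Definition twist_lift : {additive twist -> W} := quot_lift twist_lift_rel.
Lemma twist_liftE x : twist_lift (twist_class x) = phi x.
Proof. exact: (quot_lift_pi twist_lift_rel). Qed.
End Lift.

(* [g, s] |-> s_j mod Zp *)
Definition char_q_fun (j : 'I_h) (x : G * 'rV[Qp]_h) : QpZp := modZp (x.2 0 j).
Lemma char_q_zmod j : zmod_morphism (char_q_fun j).
Proof. by move=> x y; rewrite /char_q_fun /= !mxE raddfB. Qed.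
Lemma char_q_rel j z : char_q_fun j (a z, - map_mx Zp_in_Qp z) = 0.
Proof. by rewrite /char_q_fun /= !mxE raddfN modZp_eq0 oppr0. Qed.
Definition char_q j : {additive twist -> QpZp} :=
  twist_lift (phi := mk_additive (@char_q_zmod j)) (char_q_rel j).

Definition twist_proj_fun (x : twist) : 'rV[QpZp]_h := \row_j char_q j x.
Lemma twist_proj_zmod : zmod_morphism twist_proj_fun.
Proof. by move=> x y; apply/rowP => j; rewrite !mxE raddfB. Qed.
Definition twist_proj : {additive twist -> 'rV[QpZp]_h} := mk_additive twist_proj_zmod.
End Twist.

Section TwistMap.
Variables (G G' : zmodType) (a : {additive 'rV[Z]_h -> G})
  (a' : {additive 'rV[Z]_h -> G'}) (psi : {additive G -> G'}).
Hypothesis psi_a : forall j, psi (a j) = a' j.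

(* [g, s] |-> [psi g, s] *)
Definition twist_map_fun (x : G * 'rV[Qp]_h) : twist a' :=
  twist_class a' (psi x.1, x.2).
Lemma twist_map_zmod : zmod_morphism twist_map_fun.
Proof. by move=> x y; rewrite /twist_map_fun -raddfB /= raddfB. Qed.
Lemma twist_map_rel j : twist_map_fun (a j, - map_mx Zp_in_Qp j) = 0.
Proof.
apply/eqP; rewrite /twist_map_fun /= psi_a -(raddf0 (twist_class a')).
by rewrite -Quotient.idealrBE subr0; apply/asboolP; exists j.
Qed.
Definition twist_map : {additive twist a -> twist a'} :=
  twist_lift (phi := mk_additive twist_map_zmod) twist_map_rel.
End TwistMap.

Section Cyclic.
Variable k : nat.
Hypotheses (p_pr : prime p) (k_gt0 : (0 < k)%N).
Local Notation N := (p ^ k)%N.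
Local Notation Lam := 'rV['Z_N]_h.

Lemma N_gt1 : (1 < N)%N.
Proof. by rewrite -(exp1n k) ltn_exp2r // prime_gt1. Qed.

Lemma ideal_pow_principal (R : comPzRingType) (g : R) m x :
  ideal_pow (eq g) m x <-> exists w, x = g ^+ m * w.
Proof.
elim: m x => [|m IH] x; first by split=> // _; exists x; rewrite expr0 mul1r.
split=> [|[w ->]].
  elim=> [|c _ y [_ [z [<- /IH[w ->] ->]]] _ [v ->]].
    by exists 0; rewrite mulr0.
  by exists (c * w + v); rewrite exprS mulrDr -!mulrA; congr (_ + _); rewrite mulrCA; congr (_ * _); rewrite mulrCA.
rewrite -[X in ideal_pow _ _ X]addr0 -[_ * w]mul1r; apply: in_idealD; last exact: in_ideal0.
exists g, (g ^+ m * w); split=> //; last by rewrite exprS mulrA.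
by apply/IH; exists w.
Qed.

Lemma padic_image m (z : Z) :
  ideal_pow (image_of (intmul 1 : {rmorphism int -> Z}) (eq p%:R)) m z <->
  exists w, z = p%:R ^+ m * w.
Proof.
rewrite -ideal_pow_principal.
suff -> : image_of (intmul 1 : {rmorphism int -> Z}) (eq p%:R) = eq p%:R by [].
apply/funext => y; apply/propext; split=> [[_ <- ->]|<-]; first by rewrite /= rmorph_nat.
by exists p%:R => //=; rewrite rmorph_nat.
Qed.

Lemma dvd_padic m (x : int) (w : Z) : x%:~R = p%:R ^+ m * w -> (p ^ m %| absz x)%N.
Proof.
move=> e; have [H _ _ _] := padic_completion Z.
have /H/ideal_pow_principal[v ->] : ideal_pow (image_of
  (intmul 1 : {rmorphism int -> Z}) (eq p%:R)) m x%:~R by apply/padic_image; exists w.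
by rewrite abszM abszX natz absz_nat dvdn_mulr.
Qed.

Lemma padic_residue (z : Z) :
  exists a : 'Z_N, exists w, z - (a : nat)%:R = N%:R * w.
Proof.
have [_ H _ _] := padic_completion Z.
have [n /padic_image[w e]] := H k z.
have N0 : N%:Z != 0 by rewrite eqz_nat -lt0n ltnW // N_gt1.
have lt : (absz (n %% N)%Z < (Zp_trunc N).+2)%N.
  by rewrite Zp_cast ?N_gt1 // -ltz_nat gez0_abs ?modz_ge0 // ltz_pmod // ltz_nat ltnW // N_gt1.
exists (Ordinal lt) => /=; exists (w + (n %/ N)%Z%:~R).
have -> : (absz (n %% N)%Z)%:R = (n %% N)%Z%:~R :> Z.
  by rewrite -[in RHS](gez0_abs (modz_ge0 n N0)) pmulrn.
have en : n%:~R = N%:R * (n %/ N)%Z%:~R + (n %% N)%Z%:~R :> Z.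
  by rewrite [in LHS](divz_eq n N) intrD intrM mulrC -pmulrn.
move: e; rewrite -natrX mulrDr => <-.
by rewrite /= en opprD [- _ - _]addrC addrA subrK.
Qed.

(* Z_p -> Z/p^k *)
Definition residue (z : Z) : 'Z_N := sval (cid (padic_residue z)).
Lemma residueP z : exists w, z - (residue z : nat)%:R = N%:R * w.
Proof. by rewrite /residue; case: cid. Qed.

Lemma N_neq0 : N%:R != 0 :> Qp.
Proof.
have -> : N%:R = Zp_in_Qp N%:R :> Qp by rewrite /Zp_in_Qp rmorph_nat.
rewrite /Zp_in_Qp tofrac_eq0; apply/eqP => N0.
have /(dvd_padic (m := k.+1)) : (N : int)%:~R = p%:R ^+ k.+1 * (0 : Z).
  by rewrite mulr0 -pmulrn.
by rewrite absz_nat dvdn_Pexp2l ?prime_gt1 // ltnn.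
Qed.

Lemma intr_ZN_eq0 (x : int) : (N %| absz x)%N -> x%:~R = 0 :> 'Z_N.
Proof.
move=> /dvdnP[c e]; have : (absz x)%:R = 0 :> 'Z_N.
  by rewrite e natrM pchar_Zp ?mulr0 // N_gt1.
by case: x {e} => n H //; rewrite NegzE rmorphN /= -pmulrn H oppr0.
Qed.

Lemma residue_int (z w : Z) (x : int) : z - x%:~R = N%:R * w -> residue z = x%:~R.
Proof.
move=> e; have [w' e'] := residueP z.
apply/eqP; rewrite eq_sym -subr_eq0; apply/eqP.
rewrite -[residue z]natr_Zp pmulrn -rmorphB /=; apply: intr_ZN_eq0.
apply: (@dvd_padic _ _ (w' - w)).
rewrite -natrX mulrBr -e -e' rmorphB /= -pmulrn.
by rewrite opprB [RHS]addrC addrA subrK.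
Qed.

Lemma residue_zmod : zmod_morphism residue.
Proof.
move=> x y; have [w e] := residueP x; have [v e'] := residueP y.
rewrite (@residue_int _ (w - v) ((residue x : nat)%:Z - (residue y : nat)%:Z)).
  by rewrite rmorphB /= -!pmulrn !natr_Zp.
rewrite mulrBr -e -e' rmorphB /= -!pmulrn !opprD !opprK.
by rewrite addrACA.
Qed.

(* gamma_k : Z_p^h -> Lambda_k *)
Definition gamma_fun (z : 'rV[Z]_h) : Lam := map_mx residue z.
Lemma gamma_zmod : zmod_morphism gamma_fun.
Proof. by move=> x y; apply/rowP => j; rewrite !mxE residue_zmod. Qed.
Definition gamma : {additive 'rV[Z]_h -> Lam} := mk_additive gamma_zmod.

(* A homomorphism from Z_p^h to Z/p^k is automatically continuous. *)
Definition hom_index (a : {additive 'rV[Z]_h -> 'Z_N}) (j : 'I_h) : 'Z_N :=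
  a (delta_mx 0 j).

Lemma hom_residue (a : {additive 'rV[Z]_h -> 'Z_N}) (z : 'rV[Z]_h) :
  a z = \sum_j residue (z 0 j) * hom_index a j.
Proof.
rewrite {1}(row_sum_delta z) raddf_sum /=; apply: eq_bigr => j _.
have [w e] := residueP (z 0 j).
rewrite -[in LHS](subrK (residue (z 0 j) : nat)%:R (z 0 j)) e scalerDl raddfD.
rewrite -scalerA !scaler_nat !raddfMn /= -mulr_natl pchar_Zp ?N_gt1 // mul0r add0r.
by rewrite -mulr_natl natr_Zp.
Qed.

Definition over_N (x : nat) : Qp := x%:R / N%:R.

Lemma modZp_over_N (u : 'Z_N) (x : int) :
  u = x%:~R -> modZp (over_N u) = modZp (x%:~R / N%:R).
Proof.
move=> e; apply/eqP; rewrite -subr_eq0 -raddfB /over_N -mulrBl /=.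
have [c ec] : exists c, (u : nat)%:Z - x = c * N%:Z.
  have N0 : N%:Z != 0 by rewrite eqz_nat -lt0n ltnW // N_gt1.
  exists (- (x %/ N)%Z); rewrite {1}(divz_eq x N).
  suff -> : (u : nat)%:Z = (x %% N)%Z by rewrite opprD addrCA subrr addr0 mulNr.
  have r0 := modz_ge0 x N0.
  have -> : u = (absz (x %% N)%Z)%:R.
    rewrite e {1}(divz_eq x N) rmorphD rmorphM /= -!pmulrn pchar_Zp ?N_gt1 //.
    by rewrite mulr0 add0r -[in LHS](gez0_abs r0) -pmulrn.
  rewrite val_Zp_nat ?N_gt1 // modn_small ?gez0_abs //.
  by rewrite -ltz_nat gez0_abs // ltz_pmod // ltz_nat ltnW // N_gt1.
have -> : (u : nat)%:R - x%:~R = c%:~R * N%:R :> Qp.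
  by rewrite pmulrn -rmorphB ec rmorphM.
rewrite mulfK ?N_neq0 //; apply/eqP.
have -> : c%:~R = Zp_in_Qp c%:~R by rewrite /Zp_in_Qp rmorph_int.
exact: modZp_eq0.
Qed.

Lemma modZp_over_N0 (z : Z) : modZp (Zp_in_Qp (N%:R * z) / N%:R) = 0.
Proof.
rewrite /Zp_in_Qp rmorphM rmorph_nat /= mulrC mulKf ?N_neq0 //.
exact: modZp_eq0.
Qed.

(* Z/p^k -> Q_p/Z_p, i |-> i/p^k *)
Definition char_std_fun (g : 'Z_N) : QpZp := modZp (over_N g).
Lemma char_std_zmod : zmod_morphism char_std_fun.
Proof.
move=> x y; rewrite /char_std_fun.
rewrite (@modZp_over_N _ ((x : nat)%:Z - (y : nat)%:Z)).
  by rewrite -raddfB /over_N -mulrBl rmorphB /= -!pmulrn.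
by rewrite rmorphB /= -!pmulrn !natr_Zp.
Qed.
Definition char_std : {additive 'Z_N -> QpZp} := mk_additive char_std_zmod.

(* T(gamma_k) -> Q_p/Z_p, [l, s] |-> (l_j + s_j)/p^k *)
Definition char_A_fun (j : 'I_h) (x : Lam * 'rV[Qp]_h) : QpZp :=
  char_std (x.1 0 j) + modZp (x.2 0 j / N%:R).
Lemma char_A_zmod j : zmod_morphism (char_A_fun j).
Proof.
move=> x y; rewrite /char_A_fun /= !mxE.
have -> : char_std_fun = char_std by [].
by rewrite raddfB mulrBl raddfB opprD addrACA.
Qed.
Lemma char_A_rel j z : char_A_fun j (gamma z, - map_mx Zp_in_Qp z) = 0.
Proof.
rewrite /char_A_fun /= !mxE; have [w e] := residueP (z 0 j).
rewrite /char_std_fun -raddfD /over_N -mulrDl /=.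
have -> : (residue (z 0 j))%:R - Zp_in_Qp (z 0 j) = - Zp_in_Qp (N%:R * w).
  by rewrite -e rmorphB rmorph_nat opprB.
by rewrite mulNr raddfN /= modZp_over_N0 oppr0.
Qed.
Definition char_A j : {additive twist gamma -> QpZp} :=
  twist_lift (phi := mk_additive (@char_A_zmod j)) (char_A_rel j).

Section Hom.
Variable a : {additive 'rV[Z]_h -> 'Z_N}.

(* T(a) -> Q_p/Z_p, [g, s] |-> g/p^k + \sum_j i_j s_j/p^k *)
Definition char_x_fun (x : 'Z_N * 'rV[Qp]_h) : QpZp :=
  char_std x.1 + \sum_j modZp ((hom_index a j : nat)%:R * x.2 0 j / N%:R).
Lemma char_x_zmod : zmod_morphism char_x_fun.
Proof.
move=> x y; rewrite /char_x_fun; have -> : (x - y).1 = x.1 - y.1 by [].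
rewrite raddfB opprD addrACA; congr (_ + _).
rewrite -sumrB; apply: eq_bigr => j _.
by rewrite -raddfB /= !mxE mulrBr mulrBl.
Qed.
Lemma char_x_rel z : char_x_fun (a z, - map_mx Zp_in_Qp z) = 0.
Proof.
rewrite /char_x_fun /= /char_std_fun.
pose r j := (residue (z 0 j) : nat); pose i j := (hom_index a j : nat).
rewrite (@modZp_over_N _ (\sum_j (r j)%:Z * (i j)%:Z)); last first.
  rewrite hom_residue rmorph_sum; apply: eq_bigr => j _.
  by rewrite rmorphM /= -!pmulrn !natr_Zp.
rewrite rmorph_sum mulr_suml raddf_sum -big_split big1 //= => j _.
rewrite !mxE rmorphM /= -!pmulrn -raddfD -mulrDl /=.
have [w e] := residueP (z 0 j).
have -> : (r j)%:R * (i j)%:R + (hom_index a j)%:R * - Zp_in_Qp (z 0 j)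
  = - Zp_in_Qp (N%:R * ((i j)%:R * w)) :> Qp.
  rewrite mulrCA -e rmorphM rmorphB !rmorph_nat.
  by rewrite -mulrN opprB mulrBr mulrN [(r j)%:R * _]mulrC.
by rewrite mulNr raddfN /= modZp_over_N0 oppr0.
Qed.
Definition char_x : {additive twist a -> QpZp} :=
  twist_lift (phi := mk_additive char_x_zmod) char_x_rel.

(* gamma_k x a *)
Definition gamma_prod_fun (z : 'rV[Z]_h) : (Lam * 'Z_N)%type := (gamma z, a z).
Lemma gamma_prod_zmod : zmod_morphism gamma_prod_fun.
Proof. by move=> x y; rewrite /gamma_prod_fun !raddfB. Qed.
Definition gamma_prod : {additive 'rV[Z]_h -> (Lam * 'Z_N)%type} :=
  mk_additive gamma_prod_zmod.

Definition fst_add : {additive (Lam * 'Z_N)%type -> Lam} := fst.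
Definition snd_add : {additive (Lam * 'Z_N)%type -> 'Z_N} := snd.
Lemma fst_gamma_prod z : fst_add (gamma_prod z) = gamma z. Proof. by []. Qed.
Lemma snd_gamma_prod z : snd_add (gamma_prod z) = a z. Proof. by []. Qed.

(* T(gamma_k x a) -> T(gamma_k) and T(gamma_k x a) -> T(a) *)
Definition twist_fst : {additive twist gamma_prod -> twist gamma} :=
  twist_map fst_gamma_prod.
Definition twist_snd : {additive twist gamma_prod -> twist a} :=
  twist_map snd_gamma_prod.

(* [l, g, s] |-> g - a(l), where a(l) = \sum_j i_j l_j *)
Definition s_hom_fun (x : (Lam * 'Z_N) * 'rV[Qp]_h) : 'Z_N :=
  x.1.2 - \sum_j x.1.1 0 j * hom_index a j.
Lemma s_hom_zmod : zmod_morphism s_hom_fun.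
Proof.
move=> x y; rewrite /s_hom_fun /= opprD addrACA; congr (_ + _).
rewrite -opprD -sumrB; congr (- _); apply: eq_bigr => j _.
by rewrite !mxE mulrBl.
Qed.
Lemma s_hom_rel z : s_hom_fun (gamma_prod z, - map_mx Zp_in_Qp z) = 0.
Proof.
rewrite /s_hom_fun /= hom_residue; apply/eqP; rewrite subr_eq0; apply/eqP.
by apply: eq_bigr => j _; rewrite !mxE.
Qed.
Definition s_hom : {additive twist gamma_prod -> 'Z_N} :=
  twist_lift (phi := mk_additive s_hom_zmod) s_hom_rel.
End Hom.
End Cyclic.
End TwistGroups.

Section MoravaETheories.

(* R is the ring of Witt vectors of the perfect field k: it is p-torsion free
   and p-adically complete, with residue ring k. *)
Definition is_witt_ring (p : nat) (R : comPzRingType) (k : fieldType)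
    (res : {rmorphism R -> k}) : Prop :=
  [/\ is_completion (idfun : {rmorphism R -> R}) (eq p%:R),
      forall x : R, x *+ p = 0 -> x = 0,
      forall a, exists x, res x = a
    & forall x, res x = 0 <-> exists y, x = y *+ p].

(* Every deformation F' of the reduction of F, to a complete local ring S with
   residue field l over k, comes from a unique pair of a map phi : R -> S and a
   star-isomorphism g from phi_* F to F'. *)
Definition is_universal_deformation (R : comPzRingType) (k : fieldType)
    (rho : {rmorphism R -> k}) (F : group_law R) : Prop :=
  forall (S : comPzRingType) (l : fieldType) (rhoS : {rmorphism S -> l})
    (i : {rmorphism k -> l}) (m : seq S) (F' : group_law S),
    (forall a, exists x, rhoS x = a) ->
    (forall x, rhoS x = 0 <-> in_ideal (fun y => y \in m) x) ->
    is_completion (idfun : {rmorphism S -> S}) (fun y => y \in m) ->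
    is_group_law F' -> map_law rhoS F' = map_law (i \o rho) F ->
    let lifts (phi : {rmorphism R -> S}) (g : mps S unit) :=
      [/\ rhoS \o phi =1 i \o rho, g m0 = 0, map_mps rhoS g = mpsX tt
        & subst g (fun=> law_add (map_law phi F)) =
          fadd F' (rename (fun=> inl tt) g) (rename (fun=> inr tt) g)] in
    exists (phi : {rmorphism R -> S}) (g : mps S unit), lifts phi g /\
      forall (phi' : {rmorphism R -> S}) (g' : mps S unit),
        lifts phi' g' -> phi' =1 phi /\ g' = g.

(* generators of I_t *)
Definition low_ideal (R : Type) (u : nat -> R) (t : nat) : R -> Prop :=
  fun y => exists2 i, (i < t)%N & y = u i.

Definition coord_rV (V : zmodType) (r : nat) (j : 'I_r) : {additive 'rV[V]_r -> V} :=
  mk_additive (f := fun v : 'rV[V]_r => v 0 j)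
    (fun v w => etrans (mxE _ _ _ _) (congr1 (+%R (v 0 j)) (mxE _ _ _ _))).

Definition prod_fst (V : zmodType) : {additive (V * V)%type -> V} := fst.
Definition prod_snd (V : zmodType) : {additive (V * V)%type -> V} := snd.
Definition prod_add (V : zmodType) : {additive (V * V)%type -> V} :=
  mk_additive (f := fun v : (V * V)%type => v.1 + v.2)
    (fun v w => etrans (addrACA _ _ _ _)
      (congr1 (+%R (v.1 + v.2)) (esym (opprD _ _)))).

Section Euler.
Variables (p : nat) (Z : padic_integers p) (E : cohomology).
Variable x : coh0 E (classifying (QpZp Z)).

Definition euler (G : zmodType) (chi : {additive G -> QpZp Z}) :
    coh0 E (classifying G) := pull0 (classifying_map chi) x.
End Euler.

(* Morava E-theory of height n over k. The coordinate x lives on B(Q_p/Z_p),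
   which is CP^oo after p-completion. *)
Record morava_E (p : nat) (Z : padic_integers p) (n : nat) (k : fieldType)
    (E : cohomology) := MoravaE {
  mE_witt : comPzRingType;
  mE_res : {rmorphism mE_witt -> k};
  mE_wittP : is_witt_ring p mE_res;
  mE_coef : {rmorphism mps mE_witt 'I_n.-1 -> coef E};
  mE_coefP : bijective mE_coef;
  mE_even : even_periodic E;

  mE_x : coh0 E (classifying (QpZp Z));
  mE_x0 : skeletal_filtration 0 mE_x;
  mE_xP : forall r, coh_presented
    (fun j : 'I_r => euler mE_x (coord_rV (QpZp Z) j)) (fun=> False);
  mE_law : group_law (coef E);
  mE_lawP : is_group_law mE_law;
  mE_addP : coh_value
    (fun s : (unit + unit)%type =>
       euler mE_x (if s is inl _ then prod_fst (QpZp Z) else prod_snd (QpZp Z)))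
    (law_add mE_law) (euler mE_x (prod_add (QpZp Z)));

  mE_rho : {rmorphism coef E -> k};
  mE_rhoP : forall f, mE_rho (mE_coef f) = mE_res (f m0);
  mE_height : has_height (map_law mE_rho mE_law) p n;
  mE_univ : is_universal_deformation mE_rho mE_law;

  mE_u : nat -> coef E;
  mE_u0 : mE_u 0%N = p%:R;
  mE_uS : forall i : 'I_n.-1, mE_u i.+1 = mE_coef (mpsX i);
  (* [p](x) = u_i x^(p^i) modulo (u_0, ..., u_(i-1)) and x^(p^i + 1) *)
  mE_uP : forall i, (0 < i < n)%N ->
    let px := fmul mE_law p (mpsX tt) in
    (forall m, (m < p ^ i)%N -> in_ideal (low_ideal mE_u i) (px (unitdeg m))) /\
    in_ideal (low_ideal mE_u i) (px (unitdeg (p ^ i)) - mE_u i) }.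

(* L = L_{K(t)} E: a multiplicative theory under E with odd coefficients zero and
   L^0 the completion of E^0[1/u_t] at I_t. As E is Landweber exact and even
   periodic and L^0 is flat over E^0, this determines L under E. *)
Definition is_Kt_localization (E L : cohomology) (eta : coh_transformation E L)
    (u : nat -> coef E) (t : nat) : Prop :=
  (forall i (y : coh L i (absolute spoint)), odd (absz i) -> y = 0) /\
  exists (M : comPzRingType) (a : {rmorphism coef E -> M})
    (b : {rmorphism M -> coef L}),
    [/\ is_localization a (eq (u t)), is_completion b (low_ideal (a \o u) t)
      & b \o a =1 trans0 eta (X := spoint)].
End MoravaETheories.

Section TheRingBt.
Variables (p h t : nat) (R : comPzRingType) (F : group_law R) (u : nat -> R).
Variables (Lt : comPzRingType) (ell : {rmorphism R -> Lt}).

(* S[[x]]/([N](x) - c) for an R-algebra S *)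
Definition division_rel (S : comPzRingType) (phi : R -> S) (N : nat) (c : S) :
    mps S unit -> Prop :=
  eq (map_mps phi (fmul F N (mpsX tt)) - mpsC _ c).
Definition division_ring (S : comPzRingType) (phi : R -> S) (N : nat) (c : S) :=
  ring_quot (division_rel phi N c).
Definition to_division (S : comPzRingType) (phi : R -> S) (N : nat) (c : S)
  (f : mps S unit) : division_ring phi N c := rpi _ f.

(* the ring of functions R[[x]]/[p^m](x) of the p^m-torsion *)
Definition torsion_ring (m : nat) := ring_quot (eq (fmul F (p ^ m) (mpsX tt))).
Definition to_torsion m (f : mps R unit) : torsion_ring m := rpi _ f.

Section Etale.
Variable m : nat.

(* O_{G_et[p^m]} = Lt[y]/(j_m(y)) inside O_{G[p^m]}, as the functions on G[p^m]
   invariant under translation by G_0[p^m]. *)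
Section Invariants.
Variables (OG : comPzRingType) (o1 : {rmorphism Lt -> OG})
  (o2 : {rmorphism torsion_ring m -> OG}).

Definition translation_invariant (f : OG) : Prop :=
  exists act : {rmorphism OG -> division_ring (o1 \o ell) (p ^ m) 0},
    [/\ forall c, act (o1 c) = to_division _ _ _ (mpsC _ (o1 c)),
        forall g, act (o2 (to_torsion m g)) =
          to_division _ _ _ (translate F (o2 \o to_torsion m) g)
      & act f = to_division _ _ _ (mpsC _ f)].
End Invariants.

Record etale_coordinate := EtaleCoordinate {
  et_ring : comPzRingType;
  et_1 : {rmorphism Lt -> et_ring};
  et_2 : {rmorphism torsion_ring m -> et_ring};
  et_tensor : is_tensor ell (to_torsion m \o mpsC unit) et_1 et_2;
  et_y : et_ring;
  (* 1, y, ..., y^(d-1) is a basis of the invariants, so that j_m is monic of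
     degree d *)
  et_gen : exists d, forall f, translation_invariant et_1 et_2 f <->
    exists! c : {ffun 'I_d -> Lt}, f = \sum_(i < d) et_1 (c i) * et_y ^+ i;
  et_zero : exists eps : {rmorphism et_ring -> Lt},
    [/\ forall c, eps (et_1 c) = c,
        forall f, eps (et_2 (to_torsion m f)) = ell (f m0)
      & eps et_y = 0] }.
End Etale.

Definition var_q (j : 'I_h) : mps R ('I_h + 'I_h)%type := mpsX (inl j).
Definition var_A (j : 'I_h) : mps R ('I_h + 'I_h)%type := mpsX (inr j).

(* R[[q, A]]/([p^m](A_j) - q_j) *)
Definition stage_rel (m : nat) : mps R ('I_h + 'I_h)%type -> Prop :=
  fun y => exists j, y = fmul F (p ^ m) (var_A j) - var_q j.
Definition stage_ring (m : nat) := ring_quot (stage_rel m).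
Definition to_stage m (f : mps R ('I_h + 'I_h)%type) : stage_ring m := rpi _ f.

(* Lt[[q]], and Lt if t = 0 *)
Definition Lq_rel : mps Lt 'I_h -> Prop :=
  fun y => t = 0%N /\ exists j, y = mpsX j.
Definition Lq_ring := ring_quot Lq_rel.
Definition to_Lq (f : mps Lt 'I_h) : Lq_ring := rpi _ f.

Definition torsion_vectors (m : nat) := 'rV['Z_(p ^ m)]_h.
(* [i](v) = [i_1](v_1) +_F ... +_F [i_h](v_h), with 0 <= i_j < p^m *)
Definition vcomb (I : finType) m (i : torsion_vectors m) (v : 'I_h -> mps R I) :=
  fcomb F (fun j => i 0 j : nat) v.

Record Bt_model := BtModel {
  Bt_C : nat -> comPzRingType;
  Bt_CL : forall m, {rmorphism Lq_ring -> Bt_C m};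
  Bt_CE : forall m, {rmorphism stage_ring m -> Bt_C m};
  Bt_CP : forall m, is_tensor (to_Lq \o map_mps ell)
    (fun f : mps R 'I_h => to_stage m (rename inl f)) (Bt_CL m) (Bt_CE m);
  Bt_tr : forall m, {rmorphism Bt_C m -> Bt_C m.+1};
  Bt_trL : forall m c, Bt_tr m (Bt_CL m c) = Bt_CL m.+1 c;
  Bt_trE : forall m f, Bt_tr m (Bt_CE m (to_stage m f)) =
    Bt_CE m.+1 (to_stage m.+1 (subst f (fun s =>
      match s with inl j => var_q j | inr j => fmul F p (var_A j) end)));
  Bt_colim : comPzRingType;
  Bt_in : forall m, {rmorphism Bt_C m -> Bt_colim};
  Bt_inP : is_seq_colim Bt_tr Bt_in;

  Bt_prime : comPzRingType;
  Bt_comp1 : {rmorphism Bt_colim -> Bt_prime};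
  (* generators of I_t + (q) *)
  Bt_gens : Bt_colim -> Prop :=
    fun y => (exists2 i, (i < t)%N &
                y = Bt_in 0 (Bt_CL 0 (to_Lq (mpsC _ (ell (u i)))))) \/
             (exists j, y = Bt_in 0 (Bt_CL 0 (to_Lq (mpsX j))));
  Bt_comp1P : is_completion Bt_comp1 Bt_gens;

  Bt_et : forall m, etale_coordinate m;
  Bt_loc : comPzRingType;
  Bt_locmap : {rmorphism Bt_prime -> Bt_loc};
  Bt_Lq' : Lq_ring -> Bt_prime := fun c => Bt_comp1 (Bt_in 0 (Bt_CL 0 c));
  Bt_Lt' : Lt -> Bt_prime := fun c => Bt_Lq' (to_Lq (mpsC _ c));
  Bt_stage' : forall m, mps R ('I_h + 'I_h)%type -> Bt_prime :=
    fun m f => Bt_comp1 (Bt_in m (Bt_CE m (to_stage m f)));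
  (* z = phi_y(i): let g be the universal point of G_0 with [p^m](g) = -_F [i](q).
     The point [i](A^(m)) +_F g of G is p^m-torsion, with image phi(i) in
     G_et[p^m], so y takes the value z on it. *)
  Bt_phi : forall m, torsion_vectors m -> Bt_prime -> Prop :=
    fun m i z =>
    let phi := Bt_Lt' \o ell in
    let c := Bt_Lq' (to_Lq (map_mps ell (fopp F (vcomb i (fun j => mpsX j))))) in
    exists ev : {rmorphism et_ring (Bt_et m) -> division_ring phi (p ^ m) c},
      [/\ forall a, ev (et_1 _ a) = to_division _ _ _ (mpsC _ (Bt_Lt' a)),
          forall f, ev (et_2 _ (to_torsion m f)) = to_division _ _ _
            (translate F (fun g => Bt_stage' m (subst g (fun=> vcomb i var_A))) f)
        & ev (et_y _) = to_division _ _ _ (mpsC _ z)];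
  Bt_locP : is_localization Bt_locmap (fun z => exists m, (0 < m)%N /\
    exists i : torsion_vectors m, i <> 0 /\ Bt_phi i z);

  Bt_ring :> comPzRingType;
  Bt_comp2 : {rmorphism Bt_loc -> Bt_ring};
  Bt_comp2P : is_completion Bt_comp2
    (image_of (Bt_locmap \o Bt_comp1) Bt_gens) }.

Variable B : Bt_model.

(* Lt[[q]] -> B_t *)
Definition Bt_of_Lq (f : mps Lt 'I_h) : B :=
  Bt_comp2 B (Bt_locmap B (Bt_Lq' B (to_Lq f))).
(* R -> B_t *)
Definition Bt_of_coef (c : R) : B := Bt_of_Lq (mpsC _ (ell c)).
(* R[[q, A]] -> B_t, A_j |-> A_j^(m) *)
Definition Bt_of_stage (m : nat) (f : mps R ('I_h + 'I_h)%type) : B :=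
  Bt_comp2 B (Bt_locmap B (Bt_stage' B m f)).

Section TorsionSum.
Variables (m : nat) (i : torsion_vectors m).

(* The factor B_t[[x_i]]/([p^m](x_i) - [i](q)) of the ring of functions on the
   p^m-torsion of G_0 (+) Q_p^h. *)
Definition sum_q : B := Bt_of_Lq (map_mps ell (vcomb i (fun j => mpsX j))).
Definition factor_ring := division_ring Bt_of_coef (p ^ m) sum_q.
Definition to_factor (f : mps B unit) : factor_ring :=
  to_division Bt_of_coef (p ^ m) sum_q f.

(* f |-> f(x_i -_F [i](A)) *)
Definition difference (f : mps R unit) : factor_ring :=
  to_factor (translate F (fun g =>
    Bt_of_stage m (subst g (fun=> fopp F (vcomb i var_A)))) f).

(* Lt[[q, x_i]] -> B_t[[x_i]]/([p^m](x_i) - [i](q)) *)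
Definition factor_of_Lqx (f : mps Lt ('I_h + unit)%type) : factor_ring :=
  to_factor (Mps (fun n => Bt_of_Lq (coef_in_right f n))).
End TorsionSum.
End TheRingBt.

Section TwistedCharacterMap.
Variables (p : nat) (Z : padic_integers p) (n t k : nat).
Hypotheses (p_pr : prime p) (k_gt0 : (0 < k)%N).
Variables (kk : fieldType) (E : cohomology) (M : morava_E Z n kk E).
Variables (L : cohomology) (eta : coh_transformation E L).

Let h := (n - t)%N.
Let F := mE_law M.
Let gam : {additive 'rV[Z]_h -> 'rV['Z_(p ^ k)]_h} := gamma Z h p_pr k_gt0.
Let hom_type := {additive 'rV[Z]_h -> 'Z_(p ^ k)}.

Definition trans_coef : {rmorphism coef E -> coef L} := trans0 eta (X := spoint).

(* B(Q_p/Z_p)^h *)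
Definition B_QpZp : sSet := classifying 'rV[QpZp Z]_h.
Definition B_cyclic : sSet := classifying 'Z_(p ^ k).
Definition BT_gamma : sSet := classifying (twist gam).

(* Twist_h^{Z/p^k}( * ), the disjoint union of the spaces BT(a) *)
Definition twist_space : sSet :=
  scoprod (fun a : hom_type => classifying (twist a)).
(* the disjoint union of the spaces BT(gamma_k x a) *)
Definition twist_gamma_space : sSet :=
  scoprod (fun a : hom_type => classifying (twist (gamma_prod p_pr k_gt0 a))).

Definition gamma_to_B : smap BT_gamma B_QpZp := classifying_map (twist_proj gam).
Definition twist_to_B : smap twist_space B_QpZp :=
  scase (fun a => classifying_map (twist_proj a)).
Definition prod_to_gamma : smap twist_gamma_space BT_gamma :=
  scase (fun a => classifying_map (twist_fst p_pr k_gt0 a)).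
Definition prod_to_twist : smap twist_gamma_space twist_space :=
  scoprod_map (fun a => classifying_map (twist_snd p_pr k_gt0 a)).
(* the maps Bs_a *)
Definition prod_to_cyclic : smap twist_gamma_space B_cyclic :=
  scase (fun a => classifying_map (s_hom p_pr k_gt0 a)).

Let e_class (G : zmodType) (chi : {additive G -> QpZp Z}) : coh0 E (classifying G) :=
  euler (mE_x M) chi.

Definition x_cyclic (s : unit) : coh0 E B_cyclic := e_class (char_std Z p_pr k_gt0).
Definition qA_gamma (s : 'I_h + 'I_h) : coh0 E BT_gamma :=
  match s with
  | inl j => e_class (char_q gam j)
  | inr j => e_class (char_A Z p_pr k_gt0 j)
  end.
Definition q_B (j : 'I_h) : coh0 L B_QpZp :=
  trans0 eta (e_class (coord_rV (QpZp Z) j)).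
Definition qx_twist (a : hom_type) (s : 'I_h + unit) :
    coh0 L (classifying (twist a)) :=
  trans0 eta match s with
  | inl j => e_class (char_q a j)
  | inr j => e_class (char_x p_pr k_gt0 a)
  end.

(* [p^k](x_i) - [i](q), and the q_j if t = 0 *)
Definition twist_relations (i : torsion_vectors p h k) :
    mps (coef L) ('I_h + unit)%type -> Prop :=
  let FL := map_law trans_coef F in
  fun y =>
    y = fmul FL (p ^ k) (mpsX (inr tt)) - vcomb FL i (fun j => mpsX (inl j)) \/
    t = 0%N /\ exists j, y = mpsX (inl j).

Definition index_of (a : hom_type) : torsion_vectors p h k := \row_j hom_index a j.

(* The computations of the cohomology of the spaces BT(a) by power series, and
   the Kunneth isomorphism. *)
Record standard_identifications : Prop := StandardIdentifications {
  id_cyclic : coh_presented x_cyclic (eq (fmul F (p ^ k) (mpsX tt)));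
  id_gamma : coh_presented qA_gamma (@stage_rel p h _ F k);
  id_B : coh_presented q_B (@Lq_rel h t (coef L));
  id_twist : forall a, coh_presented (qx_twist a) (twist_relations (index_of a));
  id_kunneth : is_tensor (pull0 (E := E) gamma_to_B) (pull0 (E := E) twist_to_B)
    (pull0 (E := E) prod_to_gamma) (pull0 (E := E) prod_to_twist) }.

Variable B : Bt_model p h t F (mE_u M) trans_coef.

(* B_t (x) L^0(Twist_h( * )) over L^0(B(Q_p/Z_p)^h), with its identification with
   the ring of functions on (G_0 (+) Q_p^h)[p^k]. *)
Record twisted_target := TwistedTarget {
  tt_base : {rmorphism coh0 L B_QpZp -> B};
  tt_baseP : forall f y, coh_value q_B f y -> tt_base y = Bt_of_Lq B f;
  tt_ring :> comPzRingType;
  tt_B : {rmorphism B -> tt_ring};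
  tt_L : {rmorphism coh0 L twist_space -> tt_ring};
  tt_tensor : is_tensor tt_base (pull0 (E := L) twist_to_B) tt_B tt_L;
  tt_comp : forall i : torsion_vectors p h k, {rmorphism tt_ring -> factor_ring B i};
  tt_compB : forall i b, tt_comp i (tt_B b) = to_factor i (mpsC _ b);
  tt_compL : forall i (a : hom_type) f y, index_of a = i ->
    coh_value (qx_twist a) f
      (pull0 (sincl (fun a => classifying (twist a)) a) y) ->
    tt_comp i (tt_L y) = factor_of_Lqx B i f;
  tt_iso : forall z : (forall i, factor_ring B i),
    exists! w, forall i, tt_comp i w = z i }.

Variable P : twisted_target.

(* v is the map out of the Kunneth tensor product that is lam, with values
   A_j^(k) on A_j, on the left factor and localization on the right factor. *)
Definition is_twisted_character_map (U : {rmorphism coh0 E B_cyclic -> P}) : Prop :=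
  exists (lam : {rmorphism coh0 E BT_gamma -> B})
    (v : {rmorphism coh0 E twist_gamma_space -> P}),
    [/\ forall f y, coh_value qA_gamma f y -> lam y = Bt_of_stage B k f,
        forall y, v (pull0 prod_to_gamma y) = tt_B P (lam y),
        forall y, v (pull0 prod_to_twist y) = tt_L P (trans0 eta y)
      & forall y, U y = v (pull0 prod_to_cyclic y)].
End TwistedCharacterMap.

(* Main.v *)
(** Since E^0(B(Q_p/Z_p)^r) is E^0[[x_1, ..., x_r]], characters of an abelian group
    G turn power series over E^0 into elements of E^0(BG), and series that represent
    homomorphisms (Q_p/Z_p)^r -> Q_p/Z_p substitute accordingly.  On T(gamma_k x a),
    with a the homomorphism of index i, the composite of s_a with 1/p^k is
    char_x - \sum_j i_j char_A_j, so Bs_a takes f to the element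
    f(x -_F [i](A)) of E^0(BT(gamma_k x a)).

    The map v out of the Kunneth tensor product is not assumed continuous, so this
    series in x is first made finite: by Weierstrass division in E^0[[q, A, x]],
    f(x -_F [i](A)) = Q ([p^k](x) - [i](q)) + \sum_(j < d) r_j(q, A) x^j, where the
    first term has value 0 on BT(gamma_k x a).  Applying v to the finite sum gives
    \sum_j r_j(q, A^(k)) x_i^j, and the same division, pushed forward to B_t[[x_i]],
    identifies this with f(x_i -_F [i](A)) modulo [p^k](x_i) - [i](q). *)
Require Import Defs.
From HB Require Import structures.
From mathcomp Require Import all_boot all_order all_algebra.
From mathcomp Require Import boolp.
Set Implicit Arguments.
Unset Strict Implicit.
Unset Printing Implicit Defensive.
Import GRing.Theory.
Local Open Scope ring_scope.

(** The elements A_j^(k) of B_t need not be topologically nilpotent, so a series in A has no meaning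
    there as a limit: it acts only through the ring map [Bt_of_stage], while x remains a formal
    variable. Series in A and x are therefore regarded as series in x with coefficients in
    E^0[[q, A]] before they are sent to B_t.

    On the side of topology the obstacle is that no presentation of E^0(BT(gamma_k x a)) by power
    series is given, so values of series in it are not known to be unique. They are unique on the
    tori B(Q_p/Z_p)^r; identities of classes are proved there and pulled back along tuples of
    characters.

    The division rests on finite height: over the residue field [p^k](x) is a nonzero series, hence
    a unit times some x^d. Its divisor depends on i, so components of different index need different
    remainders; classes supported on the components of one index keep them apart. *)

Definition mk_rmorphism (R S : comPzRingType) (f : R -> S)
    (fB : zmod_morphism f) (fM : monoid_morphism f) : {rmorphism R -> S} :=
  HB.pack_for {rmorphism R -> S} f (GRing.isZmodMorphism.Build R S f fB)
    (GRing.isMonoidMorphism.Build R S f fM).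

Lemma big_sub_seq (V : nmodType) (T : eqType) (r1 r2 : seq T) (F : T -> V) :
  uniq r1 -> uniq r2 -> {subset r1 <= r2} ->
  (forall x, x \in r2 -> x \notin r1 -> F x = 0) ->
  \sum_(x <- r2) F x = \sum_(x <- r1) F x.
Proof.
move=> u1 u2 r12 F0; rewrite (bigID (mem r1)) /= [X in _ + X]big1_seq ?addr0.
  rewrite -big_filter; apply: perm_big; apply: uniq_perm; rewrite ?filter_uniq //.
  by move=> x; rewrite mem_filter; apply: andb_idr => /r12.
by move=> x /andP[nx xr]; apply: F0.
Qed.

(** * Power series and their values *)

Section Coefficients.
Variables (R : comPzRingType) (I : finType).
Implicit Types (f g : mps R I) (nu mu : mindex I).

Lemma mcoefD f g nu : (f + g) nu = f nu + g nu. Proof. by []. Qed.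
Lemma mcoefB f g nu : (f - g) nu = f nu - g nu. Proof. by []. Qed.
Lemma mcoef0 nu : (0 : mps R I) nu = 0.
Proof. by rewrite /= if_same. Qed.
Lemma mcoef1 nu : (1 : mps R I) nu = (nu == m0)%:R.
Proof. by rewrite /=; case: ifP. Qed.
Lemma mcoefM f g nu :
  (f * g) nu = \sum_(mu <- below nu) f mu * g (msub nu mu).
Proof. by []. Qed.
Lemma mcoef_sum (T : Type) (r : seq T) (P : pred T) (F : T -> mps R I) nu :
  (\sum_(x <- r | P x) F x) nu = \sum_(x <- r | P x) F x nu.
Proof. by elim/big_rec2: _ => [|x u v _ <-]; rewrite ?mcoef0 // mcoefD. Qed.

Lemma mpsC_zmod : zmod_morphism (@mpsC R I).
Proof.
move=> x y; apply: mps_ext => nu; rewrite mcoefB /=.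
by case: ifP => _; rewrite ?subr0.
Qed.

Lemma m0_below nu : m0 \in below nu.
Proof. by rewrite mem_below; apply/forallP => s; rewrite ffunE. Qed.

Lemma msub0 nu : msub nu m0 = nu.
Proof. by apply/ffunP => s; rewrite !ffunE subn0. Qed.

Lemma mcoefCM c f nu : (mpsC I c * f) nu = c * f nu.
Proof.
rewrite mcoefM (bigD1_seq m0) ?m0_below ?below_uniq //= eqxx msub0 big1 ?addr0 //.
by move=> mu /negPf ->; rewrite mul0r.
Qed.

Lemma mpsC_monoid : monoid_morphism (@mpsC R I).
Proof.
split=> // x y; apply: mps_ext => nu; rewrite mcoefCM /=.
by case: ifP; rewrite ?mulr0.
Qed.
End Coefficients.

HB.instance Definition _ (R : comPzRingType) (I : finType) :=
  GRing.isZmodMorphism.Build R (mps R I) (@mpsC R I) (@mpsC_zmod R I).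
HB.instance Definition _ (R : comPzRingType) (I : finType) :=
  GRing.isMonoidMorphism.Build R (mps R I) (@mpsC R I) (@mpsC_monoid R I).

Section Degree.
Variable I : finType.
Implicit Types nu mu : mindex I.

Lemma mdeg_add nu mu : mdeg (madd nu mu) = (mdeg nu + mdeg mu)%N.
Proof. by rewrite /mdeg -big_split /=; apply: eq_bigr => s _; rewrite ffunE. Qed.
Lemma mdeg0 : mdeg (m0 : mindex I) = 0%N.
Proof. by rewrite /mdeg big1 // => s _; rewrite ffunE. Qed.
Lemma mdeg_eq0 nu : (mdeg nu == 0%N) = (nu == m0).
Proof.
apply/idP/eqP => [|->]; last by rewrite mdeg0.
rewrite sum_nat_eq0 => /forallP H; apply/ffunP => s; rewrite ffunE.
by apply/eqP; apply: H.
Qed.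
Lemma le_mdeg nu s : (nu s <= mdeg nu)%N.
Proof. by rewrite /mdeg (bigD1 s) //= leq_addr. Qed.
Lemma maddK nu mu : msub (madd mu nu) mu = nu.
Proof. by apply/ffunP => s; rewrite !ffunE addKn. Qed.
Lemma msubKC nu mu : mle mu nu -> madd mu (msub nu mu) = nu.
Proof. by move=> /forallP le; apply/ffunP => s; rewrite !ffunE subnKC. Qed.
Lemma mle_addr nu mu : mle mu (madd mu nu).
Proof. by apply/forallP => s; rewrite ffunE leq_addr. Qed.
Lemma maddC nu mu : madd nu mu = madd mu nu.
Proof. by apply/ffunP => s; rewrite !ffunE addnC. Qed.
Lemma mdeg_sub nu mu : mle mu nu -> (mdeg mu + mdeg (msub nu mu))%N = mdeg nu.
Proof. by move=> le; rewrite -mdeg_add msubKC. Qed.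

(** Sums over functions into ['I_M] have an index type that changes with the bound; as sums over
    duplicate-free sequences of exponents they can be compared by [big_sub_seq]. *)
Definition mons M : seq (mindex I) :=
  [seq nu : mindex I <- [seq [ffun s => val (a s)] | a : {ffun I -> 'I_M}]
     | (mdeg nu < M)%N].

Lemma mons_uniq M : uniq (mons M).
Proof.
apply: filter_uniq; rewrite map_inj_uniq ?enum_uniq // => a b ab.
by apply/ffunP => s; apply: val_inj; move/ffunP: ab => /(_ s); rewrite !ffunE.
Qed.

Lemma mem_mons M nu : (nu \in mons M) = (mdeg nu < M)%N.
Proof.
rewrite mem_filter; apply: andb_idr => lt; apply/mapP.
have lts s : (nu s < M)%N by apply: leq_ltn_trans lt; apply: le_mdeg.
exists ([ffun s => Ordinal (lts s)]); first exact: mem_enum.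
by apply/ffunP => s; rewrite !ffunE.
Qed.

Lemma big_exponents (V : nmodType) M (P : pred (mindex I)) (G : mindex I -> V) :
  \sum_(a : {ffun I -> 'I_M} | P [ffun s => val (a s)]) G [ffun s => val (a s)]
  = \sum_(nu <- [seq [ffun s => val (a s)] | a : {ffun I -> 'I_M}] | P nu) G nu.
Proof. by rewrite big_map big_enum_cond. Qed.
End Degree.

Section Monomials.
Variables (S : comPzRingType) (I : finType) (a : I -> S).

Definition mono (nu : mindex I) : S := \prod_s a s ^+ nu s.

Lemma mono_add nu mu : mono (madd nu mu) = mono nu * mono mu.
Proof. by rewrite /mono -big_split; apply: eq_bigr => s _; rewrite ffunE exprD. Qed.
Lemma mono0 : mono m0 = 1.
Proof. by rewrite /mono big1 // => s _; rewrite ffunE. Qed.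
End Monomials.

Lemma rmorph_mono (S T : comPzRingType) (I : finType) (h : {rmorphism S -> T})
  (a : I -> S) nu : h (mono a nu) = mono (h \o a) nu.
Proof. by rewrite rmorph_prod; apply: eq_bigr => s _; rewrite rmorphXn. Qed.

Section Values.
Variables (R S : comPzRingType) (phi : {rmorphism R -> S}).
Variables (Fil : nat -> S -> Prop).
Hypothesis Fil0 : forall s, Fil s 0.
Hypothesis FilB : forall s x y, Fil s x -> Fil s y -> Fil s (x - y).
Hypothesis FilM : forall s x y, Fil s y -> Fil s (x * y).

Let FilD s x y : Fil s x -> Fil s y -> Fil s (x + y).
Proof.
by move=> Fx Fy; rewrite -[y]opprK; apply: FilB => //; rewrite -sub0r; apply: FilB.
Qed.
Let Fil_sum s (T : eqType) (r : seq T) (P : pred T) (F : T -> S) :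
  (forall x, x \in r -> P x -> Fil s (F x)) -> Fil s (\sum_(x <- r | P x) F x).
Proof.
move=> H; rewrite big_seq_cond; elim/big_rec: _ => // x y /andP[xr Px] Fy.
by apply: FilD => //; apply: H.
Qed.

Section Fixed.
Variables (I : finType) (a : I -> S).
Implicit Types f g : mps R I.
Notation is_value := (is_value phi Fil a).

Lemma partial_sumE f M :
  partial_sum phi a f M = \sum_(nu <- mons I M) phi (f nu) * mono a nu.
Proof.
rewrite /mons big_filter -(big_exponents _ (fun nu => (mdeg nu < M)%N)).
apply: eq_big => nu; last first.
  by move=> _; congr (_ * _); apply: eq_bigr => s _; rewrite ffunE.
by congr (_ < _)%N; apply: eq_bigr => s _; rewrite ffunE.
Qed.

Lemma is_valueB f g y z : is_value f y -> is_value g z -> is_value (f - g) (y - z).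
Proof.
move=> Hf Hg s; have [N1 H1] := Hf s; have [N2 H2] := Hg s.
exists (maxn N1 N2) => M; rewrite geq_max => /andP[/H1 F1 /H2 F2].
have -> : partial_sum phi a (f - g) M = partial_sum phi a f M - partial_sum phi a g M.
  by rewrite !partial_sumE -sumrB; apply: eq_bigr => nu _; rewrite rmorphB mulrBl.
have e (b c d e : S) : b - c - (d - e) = b - d - (c - e).
  by rewrite !opprB [LHS]addrACA [RHS]addrACA [- c - d]addrC.
by rewrite e; apply: FilB.
Qed.

Definition mps_delta (nu : mindex I) : mps R I := Mps (fun mu => (mu == nu)%:R).

Lemma partial_sum_delta nu c M : (mdeg nu < M)%N ->
  partial_sum phi a (mpsC I c * mps_delta nu) M = phi c * mono a nu.
Proof.
move=> lt; rewrite partial_sumE (bigD1_seq nu) ?mons_uniq ?mem_mons //.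
rewrite mcoefCM [mps_delta nu nu]/= eqxx mulr1 big1 => [|mu /negPf ne]; first exact: addr0.
by rewrite mcoefCM /= ne mulr0 rmorph0 mul0r.
Qed.

Lemma is_value_delta nu c : is_value (mpsC I c * mps_delta nu) (phi c * mono a nu).
Proof.
by move=> s; exists (mdeg nu).+1 => M lt; rewrite partial_sum_delta // subrr.
Qed.

(** The monomials at [a] tend to zero. This makes f |-> f(a) continuous for the order of series and
    compatible with products. *)
Definition continuous_at := forall s, exists N, forall nu : mindex I,
  (N <= mdeg nu)%N -> Fil s (mono a nu).

Lemma partial_sumS f M : partial_sum phi a f M.+1 - partial_sum phi a f M =
  \sum_(nu <- mons I M.+1 | mdeg nu == M) phi (f nu) * mono a nu.
Proof.
rewrite !partial_sumE (bigID (fun nu => mdeg nu == M)) /=.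
rewrite -[X in _ + X - _]big_filter (@big_sub_seq _ _ (mons I M)) ?addrK //.
- exact: mons_uniq.
- by rewrite filter_uniq ?mons_uniq.
- by move=> nu; rewrite mem_mons mem_filter mem_mons ltnS ltn_neqAle.
move=> nu; rewrite mem_mons mem_filter => /andP[ne].
by rewrite mem_mons ltnS ltn_neqAle ne => ->.
Qed.

(* A series with one coefficient 1 at a bad monomial in each degree that has one
   could not converge. *)
Lemma values_continuous : (forall f, exists y, is_value f y) -> continuous_at.
Proof.
move=> ex s; apply: contrapT => bad.
have {}bad N : exists nu, (N <= mdeg nu)%N /\ ~ Fil s (mono a nu).
  apply: contrapT => H; apply: bad; exists N => nu le.
  by apply: contrapT => nF; apply: H; exists nu.
pose B M nu := mdeg nu = M /\ ~ Fil s (mono a nu).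
pose b M := if pselect (exists nu, B M nu) is left e then Some (sval (cid e)) else None.
pose f : mps R I := Mps (fun nu => (b (mdeg nu) == Some nu)%:R).
have [y /(_ s)[N HN]] := ex f.
have [nu [leN nF]] := bad N; set M := mdeg nu in leN.
have [mu bM [dM nFmu]] : exists2 mu, b M = Some mu & B M mu.
  rewrite /b; case: pselect => [e|[]]; last by exists nu.
  by exists (sval (cid e)) => //; exact: (svalP (cid e)).
apply: nFmu; have -> : mono a mu = partial_sum phi a f M.+1 - partial_sum phi a f M.
  rewrite partial_sumS -big_filter (bigD1_seq mu) /=; first last.
  - by rewrite filter_uniq ?mons_uniq.
  - by rewrite mem_filter mem_mons dM eqxx ltnSn.
  rewrite dM bM eqxx rmorph1 mul1r big_seq_cond big1 ?addr0 // => ka.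
  rewrite mem_filter => /andP[/andP[/eqP dk _] ne]; rewrite dk bM.
  by rewrite (inj_eq Some_inj) eq_sym (negPf ne) rmorph0 mul0r.
have -> : partial_sum phi a f M.+1 - partial_sum phi a f M =
  (y - partial_sum phi a f M) - (y - partial_sum phi a f M.+1).
  by rewrite opprB [RHS]addrC addrA subrK.
by apply: FilB; apply: HN => //; apply: leqW.
Qed.

(** The product of two partial sums contains the partial sum of the product, and all surplus terms
    are multiples of monomials of degree at least M, which continuity puts in [Fil s]. *)
Lemma is_valueM : continuous_at -> forall f g y z,
  is_value f y -> is_value g z -> is_value (f * g) (y * z).
Proof.
move=> cts f g y z Hf Hg s; have [N1 H1] := Hf s; have [N2 H2] := Hg s.
have [N3 H3] := cts s.
exists (maxn (maxn N1 N2) N3) => M; rewrite !geq_max => /andP[/andP[/H1 F1 /H2 F2] le3].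
set u := partial_sum phi a f M in F1; set v := partial_sum phi a g M in F2.
suff F : Fil s (u * v - partial_sum phi a (f * g) M).
  have -> : y * z - partial_sum phi a (f * g) M =
     (z * (y - u) + u * (z - v)) + (u * v - partial_sum phi a (f * g) M).
    rewrite !mulrBr [z * y]mulrC [z * u]mulrC !addrA subrK.
    by rewrite subrK.
  by apply: FilD F; apply: FilD; apply: FilM.
pose T (c : mindex I * mindex I) := phi (f c.1) * phi (g c.2) * mono a (madd c.1 c.2).
pose sq := [seq (nu, mu) | nu <- mons I M, mu <- mons I M].
have -> : u * v = \sum_(c <- sq) T c.
  rewrite big_allpairs_dep /u /v !partial_sumE mulr_suml; apply: eq_bigr => nu _.
  rewrite mulr_sumr; apply: eq_bigr => mu _.
  by rewrite /T /= mono_add mulrACA.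
have usq : uniq sq.
  apply: allpairs_uniq_dep => [|? _|[? ?] [? ?] _ _ /= [-> ->]] //; exact: mons_uniq.
have msq c : (c \in sq) = (mdeg c.1 < M)%N && (mdeg c.2 < M)%N.
  case: c => c1 c2; apply/allpairsPdep/andP => [[n [m [hn hm [-> ->]]]]|[hn hm]].
    by rewrite -!mem_mons.
  by exists c1, c2; rewrite !mem_mons.
have -> : partial_sum phi a (f * g) M =
   \sum_(c <- sq | (mdeg c.1 + mdeg c.2 < M)%N) T c.
  (* Pairs of a total exponent and its left factor; (ka, mu) |-> (mu, ka - mu) matches them with the
     pairs in [sq] of total degree below M. *)
  pose sb := [seq (ka, mu) | ka <- mons I M, mu <- below ka].
  have usb : uniq sb.
    apply: allpairs_uniq_dep => [|? _|[? ?] [? ?] _ _ /= [-> ->]] //.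
      exact: mons_uniq.
    exact: below_uniq.
  have msb c : (c \in sb) = (mdeg c.1 < M)%N && mle c.2 c.1.
    case: c => c1 c2; apply/allpairsPdep/andP => [[n [m [hn hm [-> ->]]]]|[hn hm]].
      by rewrite -mem_mons -mem_below.
    by exists c1, c2; rewrite mem_mons mem_below.
  transitivity (\sum_(c <- sb) T (c.2, msub c.1 c.2)).
    rewrite big_allpairs_dep partial_sumE; apply: eq_bigr => ka _.
    rewrite mcoefM rmorph_sum mulr_suml; apply: eq_big_seq => mu.
    by rewrite mem_below /T /= => le; rewrite msubKC // rmorphM.
  rewrite -(big_map (fun c => (c.2, msub c.1 c.2)) predT T) -[RHS]big_filter.
  apply: perm_big; apply: uniq_perm; rewrite ?filter_uniq //.
    rewrite map_inj_in_uniq // => -[k1 m1] [k2 m2]; rewrite !msb /=.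
    move=> /andP[_ l1] /andP[_ l2] [e]; rewrite -{}e in l2 * => e.
    by congr pair; rewrite -(msubKC l1) -(msubKC l2) e.
  move=> [c1 c2]; rewrite mem_filter msq /=; apply/mapP/andP.
    move=> [[ka mu]]; rewrite msb /= => /andP[lt le] [-> ->].
    rewrite mdeg_sub //; split=> //; rewrite -(mdeg_sub le) in lt.
    by rewrite (leq_ltn_trans (leq_addr _ _) lt) (leq_ltn_trans (leq_addl _ _) lt).
  move=> [lt _]; exists (madd c1 c2, c1); last by rewrite /= maddK.
  by rewrite msb /= mdeg_add lt mle_addr.
rewrite [X in X - _](bigID (fun c => (mdeg c.1 + mdeg c.2 < M)%N)) /= addrAC subrr add0r.
apply: Fil_sum => c _; rewrite -leqNgt => le; apply: FilM; apply: H3.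
by rewrite mdeg_add (leq_trans le3).
Qed.
End Fixed.
End Values.

(** The m-th power of the ideal of the variables. With this filtration as [Fil], substitution of
    series becomes a case of [is_value]. *)
Definition order_ge (R : comPzRingType) (I : finType) m (f : mps R I) : Prop :=
  forall nu, (mdeg nu < m)%N -> f nu = 0.

Section Order.
Variables (R : comPzRingType) (I : finType).
Implicit Types (f g : mps R I).

Lemma order_ge_zero m : order_ge m (0 : mps R I).
Proof. by move=> nu _; rewrite mcoef0. Qed.
Lemma order_geB m f g : order_ge m f -> order_ge m g -> order_ge m (f - g).
Proof. by move=> Hf Hg nu lt; rewrite mcoefB Hf // Hg // subrr. Qed.
Lemma order_geMM a b f g : order_ge a f -> order_ge b g -> order_ge (a + b) (f * g).
Proof.
move=> Hf Hg nu lt; rewrite mcoefM big_seq big1 // => mu; rewrite mem_below => le.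
have [lta|lea] := ltnP (mdeg mu) a; first by rewrite Hf ?mul0r.
rewrite Hg ?mulr0 // -(ltn_add2l (mdeg mu)) mdeg_sub //.
by apply: leq_trans lt _; rewrite leq_add2r.
Qed.
Lemma order_geM m f g : order_ge m g -> order_ge m (f * g).
Proof. by move=> Hg; rewrite -[m]add0n; apply: order_geMM. Qed.
Lemma order_ge_eq0 f : (forall m, order_ge m f) -> f = 0.
Proof. by move=> H; apply: mps_ext => nu; rewrite mcoef0; apply: (H (mdeg nu).+1). Qed.
Lemma order_ge1 f : f m0 = 0 -> order_ge 1 f.
Proof. by move=> f0 nu; rewrite ltnS leqn0 mdeg_eq0 => /eqP ->. Qed.

Lemma order_ge_mono (J : finType) (a : J -> mps R I) nu :
  (forall s, a s m0 = 0) -> order_ge (mdeg nu) (mono a nu).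
Proof.
move=> a0; rewrite /mono /mdeg; elim/big_ind2: _ => [|x1 x2 y1 y2|s _] //.
  exact: order_geMM.
elim: (nu s) => [|n IH]; first by [].
by rewrite exprS -add1n; apply: order_geMM => //; apply: order_ge1.
Qed.
End Order.

Section MoreValues.
Variables (R S : comPzRingType) (phi : {rmorphism R -> S}).
Variables (Fil : nat -> S -> Prop).
Hypothesis Fil0 : forall s, Fil s 0.
Hypothesis FilB : forall s x y, Fil s x -> Fil s y -> Fil s (x - y).
Hypothesis FilM : forall s x y, Fil s y -> Fil s (x * y).

Let FilD s x y : Fil s x -> Fil s y -> Fil s (x + y).
Proof.
by move=> Fx Fy; rewrite -[y]opprK; apply: FilB => //; rewrite -sub0r; apply: FilB.
Qed.

(** The bound N comes from the continuity of [b] alone, so it serves all series at once: terms of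
    degree below N vanish, and the others lie in the ideal [Fil s]. *)
Lemma value_order_ge (J : finType) (b : J -> S) : continuous_at Fil b ->
  forall s, exists N, forall f y, order_ge N f -> is_value phi Fil b f y -> Fil s y.
Proof.
move=> cts s; have [N HN] := cts s; exists N => f y of_ /(_ s)[N' H].
have := H _ (leqnn N'); set u := partial_sum _ _ _ _ => F.
rewrite -[y](subrK u); apply: FilD => //.
rewrite /u partial_sumE; elim/big_rec: _ => // nu z _ Fz.
apply: FilD => //.
have [lt|le] := ltnP (mdeg nu) N; first by rewrite of_ // rmorph0 mul0r.
by apply: FilM; apply: HN.
Qed.

(** Evaluating f(a) at b is evaluating f at a(b): a partial sum of f(a) is a finite expression, with
    which the ring morphism [ev] commutes, and the rest has high order, hence a small value by
    [value_order_ge]. *)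
Lemma is_value_subst_partial (I J : finType) (b : J -> S) (a : I -> mps R J)
    (ev : {rmorphism mps R J -> S}) (f : mps R I) (g : mps R J) :
  continuous_at Fil b -> (forall f, is_value phi Fil b f (ev f)) ->
  (forall c, ev (mpsC J c) = phi c) ->
  is_value (mpsC J) (@order_ge R J) a f g ->
  is_value phi Fil (fun s => ev (a s)) f (ev g).
Proof.
move=> cts evP evC Hg s; have [N HN] := value_order_ge cts s.
have [N' HN'] := Hg N; exists N' => M le.
have -> : partial_sum phi (fun s => ev (a s)) f M = ev (partial_sum (mpsC J) a f M).
  rewrite !partial_sumE rmorph_sum; apply: eq_bigr => nu _.
  by rewrite rmorphM rmorph_mono /= evC.
by rewrite -rmorphB; apply: HN (evP _); apply: HN'.
Qed.
End MoreValues.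

(** * Substitution of power series *)

Section Subst.
Variables (R : comPzRingType).

Section Fixed.
Variables (I J : finType) (a : I -> mps R J).
Hypothesis a0 : forall s, a s m0 = 0.
Implicit Types f g : mps R I.

(** As the series [a] have no constant term, monomials of degree above |mu| do not reach degree mu;
    any cut-off beyond |mu| gives the same coefficient. *)
Lemma subst_coef f mu M : (mdeg mu < M)%N ->
  subst f a mu = \sum_(nu <- mons I M) f nu * mono a nu mu.
Proof.
move=> lt; set G := fun nu => f nu * mono a nu mu.
have -> : subst f a mu =
  \sum_(nu <- [seq [ffun s => val (b s)] | b : {ffun I -> 'I_(mdeg mu).+1}]) G nu.
  rewrite big_image /=; apply: eq_bigr => nu _; rewrite /G; congr (_ * mcoef _ _).
  by apply: eq_bigr => s _; rewrite ffunE.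
have G0 nu : (mdeg mu < mdeg nu)%N -> G nu = 0.
  by move=> lt'; rewrite /G (order_ge_mono a0) ?mulr0.
rewrite (@big_sub_seq _ _ (mons I (mdeg mu).+1)); first last.
- move=> nu _; rewrite mem_mons -leqNgt; exact: G0.
- by move=> nu; rewrite mem_filter => /andP[].
- rewrite map_inj_uniq ?enum_uniq // => b c bc.
  by apply/ffunP => s; apply: val_inj; move/ffunP: bc => /(_ s); rewrite !ffunE.
- exact: mons_uniq.
apply/esym/big_sub_seq; try exact: mons_uniq.
  by move=> nu; rewrite !mem_mons => /leq_trans; apply.
by move=> nu _; rewrite !mem_mons -leqNgt; apply: G0.
Qed.

Lemma subst_value f : is_value (mpsC J) (@order_ge R J) a f (subst f a).
Proof.
move=> s; exists s => M le mu lt; rewrite mcoefB (@subst_coef _ _ M) ?(leq_trans lt) //.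
rewrite partial_sumE mcoef_sum; apply/eqP; rewrite subr_eq0; apply/eqP.
by apply: eq_bigr => nu _; rewrite mcoefCM.
Qed.

(** Characterizes [subst] as a limit, so that its ring laws and associativity reduce to the rules
    for [is_value]. *)
Lemma subst_unique f (g : mps R J) : is_value (mpsC J) (@order_ge R J) a f g -> g = subst f a.
Proof.
move=> H; apply/eqP; rewrite -subr_eq0; apply/eqP; apply: order_ge_eq0 => m.
have := is_valueB (@order_geB R J) H (subst_value f).
move=> /(_ m)[N /(_ _ (leqnn N))].
have -> : partial_sum (mpsC J) a (f - f) N = 0.
  by rewrite partial_sumE big1 // => nu _; rewrite subrr mcoef0 rmorph0 mul0r.
by rewrite subr0.
Qed.

Lemma subst_continuous : continuous_at (@order_ge R J) a.
Proof.
by move=> s; exists s => nu le ka lt; apply: (order_ge_mono a0); apply: leq_trans le.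
Qed.

Lemma subst_delta nu c : subst (mpsC I c * mps_delta R nu) a = mpsC J c * mono a nu.
Proof.
apply/esym/subst_unique; apply: is_value_delta; exact: order_ge_zero.
Qed.

Lemma delta0 : mps_delta R m0 = 1 :> mps R I.
Proof. by apply: mps_ext => nu; rewrite mcoef1. Qed.
Lemma deltaX s : mpsX s = mps_delta R [ffun r => nat_of_bool (r == s)] :> mps R I.
Proof. by []. Qed.

Lemma mono_unit (S : comPzRingType) (b : I -> S) s :
  mono b [ffun r => nat_of_bool (r == s)] = b s.
Proof.
rewrite /mono (bigD1 s) //= ffunE eqxx expr1 big1 ?mulr1 // => r /negPf ne.
by rewrite ffunE ne.
Qed.

Lemma subst_C c : subst (mpsC I c) a = mpsC J c.
Proof. by have := subst_delta m0 c; rewrite delta0 mulr1 mono0 mulr1. Qed.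
Lemma subst_X s : subst (mpsX s) a = a s.
Proof.
have := subst_delta [ffun r => nat_of_bool (r == s)] 1.
by rewrite !rmorph1 !mul1r -deltaX mono_unit.
Qed.

Lemma subst_zmod : zmod_morphism (fun f => subst f a).
Proof.
move=> f g; apply/esym/subst_unique; apply: is_valueB (subst_value _) (subst_value _).
exact: order_geB.
Qed.
Lemma subst_monoid : monoid_morphism (fun f => subst f a).
Proof.
split=> [|f g]; first by have := subst_C 1; rewrite !rmorph1.
apply/esym/subst_unique; apply: is_valueM (subst_value _) (subst_value _).
- exact: order_ge_zero.
- exact: order_geB.
- exact: order_geM.
- exact: subst_continuous.
Qed.
Definition subst_rmorphism : {rmorphism mps R I -> mps R J} :=
  mk_rmorphism subst_zmod subst_monoid.

Lemma substB f g : subst (f - g) a = subst f a - subst g a.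
Proof. exact: (rmorphB subst_rmorphism). Qed.
Lemma substM f g : subst (f * g) a = subst f a * subst g a.
Proof. exact: (rmorphM subst_rmorphism). Qed.

Lemma subst_const0 f : f m0 = 0 -> subst f a m0 = 0.
Proof.
move=> f0; rewrite (@subst_coef _ _ 1) ?mdeg0 // big_seq big1 // => nu.
by rewrite mem_mons ltnS leqn0 mdeg_eq0 => /eqP ->; rewrite f0 mul0r.
Qed.
End Fixed.

Lemma subst_comp (I J K : finType) (f : mps R I) (a : I -> mps R J) (b : J -> mps R K) :
  (forall s, a s m0 = 0) -> (forall s, b s m0 = 0) ->
  subst (subst f a) b = subst f (fun s => subst (a s) b).
Proof.
move=> a0 b0; apply: subst_unique => [s|]; first exact: subst_const0.
refine (@is_value_subst_partial _ _ (mpsC K) (@order_ge R K) _ _ _ _ _ b a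
  (subst_rmorphism b0) f _ _ _ _ _).
- exact: order_ge_zero.
- exact: order_geB.
- exact: order_geM.
- exact: subst_continuous.
- exact: subst_value.
- exact: subst_C.
- exact: subst_value.
Qed.

Lemma eq_subst (I J : finType) (f : mps R I) (a b : I -> mps R J) :
  a =1 b -> subst f a = subst f b.
Proof. by move=> /funext ->. Qed.

Lemma mpsX0 (I : finType) (s : I) : mpsX s m0 = 0 :> R.
Proof.
rewrite /=; case: eqP => // /ffunP/(_ s); by rewrite !ffunE eqxx.
Qed.

Lemma deltaM (I : finType) (nu mu : mindex I) :
  mps_delta R (madd nu mu) = mps_delta R nu * mps_delta R mu.
Proof.
apply: mps_ext => ka; rewrite mcoefM.
have [->|ne] := eqVneq ka (madd nu mu).
  rewrite (bigD1_seq nu) ?below_uniq ?mem_below ?mle_addr //=.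
  by rewrite maddK !eqxx mulr1 big1 ?addr0 // => c /negPf ->; rewrite mul0r.
rewrite /= (negPf ne) big_seq big1 // => c; rewrite mem_below => le.
have [e1|_] := eqVneq c nu; last by rewrite mul0r.
have [e2|_] := eqVneq (msub ka c) mu; last by rewrite mulr0.
by move: ne; rewrite -e1 -e2 msubKC // eqxx.
Qed.

Lemma mpsX_exp (I : finType) (s : I) j :
  mpsX s ^+ j = mps_delta R [ffun r => (s == r) * j]%N.
Proof.
elim: j => [|j IH]; last rewrite exprS IH [mpsX s]deltaX -deltaM.
  by rewrite expr0 -delta0; congr mps_delta; apply/ffunP => r; rewrite !ffunE muln0.
by congr mps_delta; apply/ffunP => r; rewrite !ffunE mulnS eq_sym.
Qed.

Definition push_index (I J : finType) (v : I -> J) (nu : mindex I) : mindex J :=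
  [ffun r => \sum_(s | v s == r) nu s]%N.

Lemma mono_X (I J : finType) (v : I -> J) nu :
  mono (fun s => mpsX (v s)) nu = mps_delta R (push_index v nu).
Proof.
transitivity (\prod_s mps_delta R [ffun r' => (v s == r') * nu s]%N).
  by apply: eq_bigr => s _; rewrite mpsX_exp.
rewrite -(big_morph (@mps_delta R J) (@deltaM J) (delta0 J)); congr mps_delta.
apply/ffunP => r; rewrite ffunE.
rewrite (big_morph (fun m : mindex J => m r) (op1 := addn) (id1 := 0%N)) ?ffunE //; last first.
  by move=> x y; rewrite ffunE.
rewrite [RHS]big_mkcond /=; apply: eq_bigr => s _; rewrite ffunE.
by case: eqP; rewrite ?mul1n ?mul0n.
Qed.

Lemma subst_id (I : finType) (f : mps R I) : subst f mpsX = f.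
Proof.
apply: mps_ext => mu; rewrite (@subst_coef _ _ _ _ _ _ (mdeg mu).+1) //; last exact: mpsX0.
have e (nu : mindex I) : mono mpsX nu = mps_delta R nu.
  apply: etrans (mono_X id nu) _; congr mps_delta.
  by apply/ffunP => s; rewrite ffunE big_pred1_eq.
rewrite (bigD1_seq mu) ?mons_uniq ?mem_mons // e [mps_delta _ _ _]/= eqxx mulr1.
rewrite big1 => [|nu /negPf ne]; first exact: addr0.
by rewrite e /= eq_sym ne mulr0.
Qed.
End Subst.

Section MapSeries.
Variables (R S : comPzRingType) (phi : {rmorphism R -> S}).

Lemma map_mps_zmod (I : finType) : zmod_morphism (@map_mps R S I phi).
Proof. by move=> f g; apply: mps_ext => nu /=; rewrite rmorphB. Qed.
Lemma map_mps_monoid (I : finType) : monoid_morphism (@map_mps R S I phi).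
Proof.
split=> [|f g]; apply: mps_ext => nu.
  by rewrite mcoef1 /= (fun_if phi) rmorph0 rmorph1; case: eqP.
by rewrite mcoefM /= rmorph_sum; apply: eq_bigr => mu _; rewrite rmorphM.
Qed.
Definition map_mps_rmorphism I : {rmorphism mps R I -> mps S I} :=
  mk_rmorphism (@map_mps_zmod I) (@map_mps_monoid I).

Lemma map_mpsX (I : finType) (s : I) : map_mps phi (mpsX s) = mpsX s.
Proof. by apply: mps_ext => nu /=; rewrite rmorph_nat. Qed.
Lemma map_mpsC (I : finType) c : map_mps phi (mpsC I c) = mpsC I (phi c).
Proof. by apply: mps_ext => nu /=; rewrite (fun_if phi) rmorph0. Qed.

Lemma map_subst (I J : finType) (f : mps R I) (a : I -> mps R J) :
  map_mps phi (subst f a) = subst (map_mps phi f) (fun s => map_mps phi (a s)).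
Proof.
apply: mps_ext => mu /=; rewrite rmorph_sum; apply: eq_bigr => nu _.
rewrite rmorphM; congr (_ * _).
have -> (x : mps R J) : phi (x mu) = map_mps_rmorphism J x mu by [].
rewrite rmorph_prod; congr (mcoef _ mu); apply: eq_bigr => s _.
by rewrite rmorphXn.
Qed.
End MapSeries.

(** * Series in I and one further variable *)

Section Rename.
Variables (R : comPzRingType) (I J : finType) (v : I -> J).
Hypothesis v_inj : injective v.

Definition pull_index (mu : mindex J) : mindex I := [ffun s => mu (v s)].

Lemma push_indexK : cancel (push_index v) pull_index.
Proof.
move=> nu; apply/ffunP => s; rewrite !ffunE (big_pred1 s) // => r.
by rewrite inj_eq.
Qed.

Lemma mdeg_push nu : mdeg (push_index v nu) = mdeg nu.
Proof.
rewrite /mdeg (eq_bigr (fun r => \sum_(s | v s == r) nu s)%N); last by move=> ? _; rewrite ffunE.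
rewrite (exchange_big_dep predT) //=; apply: eq_bigr => s _.
by rewrite (big_pred1 (v s)) // => r; rewrite eq_sym.
Qed.

Lemma rename_coef (f : mps R I) mu :
  rename v f mu = if mu == push_index v (pull_index mu) then f (pull_index mu) else 0.
Proof.
rewrite /rename (@subst_coef _ _ _ _ _ _ _ (mdeg mu).+1) //; last by move=> s; apply: mpsX0.
case: eqP => [e|ne].
  have le : (mdeg (pull_index mu) < (mdeg mu).+1)%N by rewrite -mdeg_push -e.
  rewrite (bigD1_seq (pull_index mu)) ?mons_uniq ?mem_mons //.
  rewrite mono_X -e [mps_delta _ _ _]/= eqxx mulr1 big1 => [|nu ne]; first exact: addr0.
  rewrite mono_X /=; case: eqP => [e'|]; last by rewrite mulr0.
  by rewrite e' push_indexK eqxx in ne.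
rewrite big1 // => nu _; rewrite mono_X /=; case: eqP => [e|]; last by rewrite mulr0.
by case: ne; rewrite e push_indexK.
Qed.
End Rename.

Section Nest.
Variables (R : comPzRingType) (I : finType).
Local Notation K := (I + unit)%type.

Definition join_index (mu : mindex I) (n : mindex unit) : mindex K :=
  [ffun s => match s with inl i => mu i | inr j => n j end].

(** The passage from R[[I, x]] to R[[I]][[x]]. It separates x, which stays formal, from the
    variables that a ring map later sends to B_t. *)
Definition nest (f : mps R K) : mps (mps R I) unit := Mps (coef_in_right f).

Lemma nestE f n mu : nest f n mu = f (join_index mu n). Proof. by []. Qed.

Lemma join_indexK (c : mindex K) : join_index (pull_index inl c) (pull_index inr c) = c.
Proof. by apply/ffunP => -[s|s]; rewrite !ffunE. Qed.
Lemma join_index_inl mu n : pull_index inl (join_index mu n) = mu.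
Proof. by apply/ffunP => s; rewrite !ffunE. Qed.
Lemma join_index_inr mu n : pull_index inr (join_index mu n) = n.
Proof. by apply/ffunP => s; rewrite !ffunE. Qed.
Lemma mdeg_join mu n : mdeg (join_index mu n) = (mdeg mu + mdeg n)%N.
Proof.
by rewrite /mdeg big_sumType /=; congr addn; apply: eq_bigr => s _; rewrite ffunE.
Qed.
Lemma join_eq mu n mu' n' :
  (join_index mu n == join_index mu' n') = (mu == mu') && (n == n').
Proof.
apply/eqP/andP => [e|[/eqP -> /eqP -> //]].
have := congr1 (pull_index inl) e; rewrite !join_index_inl => ->.
by have := congr1 (pull_index inr) e; rewrite !join_index_inr => ->.
Qed.
Lemma join00 : join_index m0 m0 = m0.
Proof. by apply/ffunP => -[s|s]; rewrite !ffunE. Qed.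
Lemma msub_join mu n mu' n' :
  msub (join_index mu n) (join_index mu' n') = join_index (msub mu mu') (msub n n').
Proof. by apply/ffunP => -[s|s]; rewrite !ffunE. Qed.
Lemma mle_join mu n c :
  mle c (join_index mu n) = mle (pull_index inl c) mu && mle (pull_index inr c) n.
Proof.
apply/forallP/andP => [H|[/forallP H1 /forallP H2] [s|s]].
- by split; apply/forallP => s; [have := H (inl s)|have := H (inr s)]; rewrite !ffunE.
- by have := H1 s; rewrite !ffunE.
- by have := H2 s; rewrite !ffunE.
Qed.

Lemma nest_inj : injective nest.
Proof.
move=> f g e; apply: mps_ext => c; rewrite -(join_indexK c).
by rewrite -!nestE e.
Qed.

Lemma nest_zmod : zmod_morphism nest.
Proof. by move=> f g; apply: mps_ext => n; apply: mps_ext => mu. Qed.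

Lemma nest_monoid : monoid_morphism nest.
Proof.
split=> [|f g]; apply: mps_ext => n; apply: mps_ext => mu.
  rewrite nestE !mcoef1 -join00 join_eq andbC; case: (n == m0) => /=.
    by rewrite -[RHS]/((1 : mps R I) mu) mcoef1.
  by rewrite -[RHS]/((0 : mps R I) mu) mcoef0.
rewrite nestE !mcoefM mcoef_sum.
pose T c := f c * g (msub (join_index mu n) c).
transitivity (\sum_(c <- [seq join_index mu' n' | n' <- below n, mu' <- below mu]) T c).
  apply: perm_big; apply: uniq_perm; first exact: below_uniq.
    apply: allpairs_uniq; rewrite ?below_uniq // => -[a b] [a' b'] _ _ /= /eqP.
    by rewrite join_eq => /andP[/eqP -> /eqP ->].
  move=> c; rewrite mem_below mle_join; apply/andP/allpairsP => [[h1 h2]|].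
    exists (pull_index inr c, pull_index inl c) => /=.
    by rewrite !mem_below join_indexK.
  move=> [[a b] /= [ha hb ->]]; rewrite join_index_inl join_index_inr.
  by rewrite -!mem_below.
rewrite big_allpairs_dep; apply: eq_bigr => n' _; rewrite mcoefM.
by apply: eq_bigr => mu' _; rewrite /T !nestE msub_join.
Qed.

Definition nest_rmorphism : {rmorphism mps R K -> mps (mps R I) unit} :=
  mk_rmorphism nest_zmod nest_monoid.

Lemma nest_rmorphismE f : nest f = nest_rmorphism f. Proof. by []. Qed.

Lemma nest_inl (f : mps R I) : nest (rename inl f) = mpsC unit f.
Proof.
apply: mps_ext => n; apply: mps_ext => mu; rewrite nestE.
rewrite rename_coef; last by move=> ? ? [].
rewrite join_index_inl.
have -> : push_index inl mu = join_index mu m0.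
  apply/ffunP => -[s|s]; rewrite !ffunE; last by rewrite big_pred0.
  by rewrite (big_pred1 s) // => r; rewrite (inj_eq (@inl_inj _ _)).
rewrite join_eq eqxx /=; case: eqP => // _.
by rewrite -[RHS]/((0 : mps R I) mu) mcoef0.
Qed.

Lemma nest_inr (f : mps R unit) : nest (rename inr f) = map_mps (@mpsC R I) f.
Proof.
apply: mps_ext => n; apply: mps_ext => mu; rewrite nestE.
rewrite rename_coef; last by move=> ? ? [].
rewrite join_index_inr.
have -> : push_index inr n = join_index m0 n.
  apply/ffunP => -[s|s]; rewrite !ffunE; first by rewrite big_pred0.
  by rewrite (big_pred1 s) // => r; rewrite (inj_eq (@inr_inj _ _)).
by rewrite join_eq eqxx andbT.
Qed.

Lemma rename_X (J L : finType) (v : J -> L) s : rename v (mpsX s) = mpsX (v s) :> mps R L.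
Proof. by rewrite /rename subst_X // => r; apply: mpsX0. Qed.

Lemma nest_X : nest (mpsX (inr tt)) = mpsX tt.
Proof. by rewrite -rename_X nest_inr -[mpsC (R:=R) I]/(GRing.RMorphism.sort _) map_mpsX. Qed.

Lemma mono_unit_index (S : comPzRingType) (a : unit -> S) c : mono a c = a tt ^+ c tt.
Proof. by rewrite /mono (big_pred1 tt) // => -[]. Qed.

Lemma mpsX_unit_exp (S : comPzRingType) j : mpsX tt ^+ j = mps_delta S (unitdeg j).
Proof.
by rewrite mpsX_exp; congr mps_delta; apply/ffunP => -[]; rewrite !ffunE mul1n.
Qed.

(** A remainder of bounded degree in x becomes a finite sum, to which arbitrary ring morphisms apply
    term by term. *)
Lemma nest_poly d (r : mps R K) :
  (forall c : mindex K, (d <= c (inr tt))%N -> r c = 0) ->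
  r = \sum_(j < d) rename inl (coef_in_right r (unitdeg j)) * mpsX (inr tt) ^+ j.
Proof.
move=> r0; apply: nest_inj; rewrite [RHS]nest_rmorphismE rmorph_sum.
apply: mps_ext => n; rewrite mcoef_sum.
under eq_bigr => j _.
  rewrite rmorphM rmorphXn -!nest_rmorphismE nest_inl nest_X mpsX_unit_exp mcoefCM.
  over.
have en : n = unitdeg (n tt) by apply/ffunP => -[]; rewrite ffunE.
have [lt|le] := ltnP (n tt) d; last first.
  rewrite big1 => [|j _]; last first.
    rewrite /=; case: eqP => [e|]; last by rewrite mulr0.
    by move: le; rewrite e ffunE leqNgt ltn_ord.
  by apply: mps_ext => mu; rewrite nestE mcoef0 r0 // ffunE.
rewrite (bigD1 (Ordinal lt)) //= -en eqxx mulr1 big1 ?addr0 // => j ne.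
case: eqP => [e|]; last by rewrite mulr0.
by case/eqP: ne; apply: val_inj; rewrite /= e ffunE.
Qed.

Definition inl_or_x (w : mps R I) (s : unit + unit) : mps R K :=
  if s is inl _ then rename inl w else mpsX (inr tt).

Lemma inl_or_x0 (w : mps R I) s : w m0 = 0 -> inl_or_x w s m0 = 0.
Proof.
move=> w0; case: s => s; last exact: mpsX0.
by apply: subst_const0 => // r; apply: mpsX0.
Qed.
End Nest.

(** [translate] expands in powers of x and only then evaluates the coefficients, which makes sense
    even at points that are not nilpotent. At a series [w] without constant term this agrees with
    ordinary substitution: the coefficient of x^n collects the monomials w^a x^b with b = n. *)
Lemma nest_translate (R : comPzRingType) (I : finType) (H : mps R (unit + unit)%type)
    (w : mps R I) : w m0 = 0 ->
  nest (subst H (inl_or_x w)) = Mps (fun n => subst (coef_in_right H n) (fun=> w)).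
Proof.
move=> w0; apply: mps_ext => n; apply: mps_ext => mu; rewrite nestE.
(* With this bound, the indices of x-exponent n that occur are exactly the [join_index e n] with |e|
   <= |mu|. *)
rewrite (@subst_coef _ _ _ _ _ _ _ ((mdeg mu).+1 + mdeg n)); first last.
- by rewrite mdeg_join addSn ltnS.
- by move=> s; apply: inl_or_x0.
rewrite -[RHS]/(subst (coef_in_right H n) (fun=> w) mu).
rewrite [RHS](@subst_coef _ _ _ _ _ _ _ (mdeg mu).+1) //.
have T c : mono (inl_or_x w) c (join_index mu n) =
   mono (fun=> w) (pull_index inl c) mu * (n == pull_index inr c)%:R.
  have -> : mono (inl_or_x w) c = rename inl w ^+ c (inl tt) * mpsX (inr tt) ^+ c (inr tt).
    by rewrite /mono big_sumType /=; congr (_ * _); rewrite (big_pred1 tt) // => -[].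
  rewrite -nestE mono_unit_index ffunE.
  rewrite nest_rmorphismE rmorphM !rmorphXn -!nest_rmorphismE nest_inl nest_X mpsX_unit_exp.
  rewrite -rmorphXn mcoefCM [mps_delta _ _ _]/= mulr_natr.
  have -> : pull_index inr c = unitdeg (c (inr tt)) by apply/ffunP => -[]; rewrite !ffunE.
  by case: eqP => _; rewrite ?mulr1n ?mulr1 // mulr0n mulr0 mcoef0.
rewrite (@big_sub_seq _ _ [seq join_index e n | e <- mons _ (mdeg mu).+1]).
- rewrite big_map; apply: eq_bigr => e _.
  by rewrite T join_index_inl join_index_inr eqxx mulr1.
- rewrite map_inj_uniq ?mons_uniq // => a b /eqP; rewrite join_eq eqxx andbT.
  by move/eqP.
- exact: mons_uniq.
- move=> c /mapP[e]; rewrite !mem_mons => lt ->.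
  by rewrite mdeg_join ltn_add2r.
move=> c _ nc; rewrite T; case: eqP => [e|]; last by rewrite !mulr0.
rewrite mulr1 (order_ge_mono (fun=> w0)) ?mulr0 // ltnNge; apply: contra nc => le.
apply/mapP; exists (pull_index inl c); last by rewrite e join_indexK.
by rewrite mem_mons ltnS.
Qed.

(** * Formal group laws *)

Section FormalGroup.
Variables (R : comPzRingType) (F : group_law R).

Lemma subst_coef0 (I J : finType) (f : mps R I) (a : I -> mps R J) :
  (forall s, a s m0 = 0) -> subst f a m0 = f m0.
Proof.
move=> a0; have := subst_const0 a0 (f := f - mpsC I (f m0)).
rewrite substB // subst_C // !mcoefB /= !eqxx subrr => /(_ erefl)/eqP.
by rewrite subr_eq0 => /eqP.
Qed.

Lemma subst0 (I J : finType) (a : I -> mps R J) :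
  (forall s, a s m0 = 0) -> subst 0 a = 0.
Proof. by move=> a0; rewrite -(subrr 0) substB // subrr. Qed.

Hypothesis FP : is_group_law F.

(** Not among the axioms of [is_group_law]: it is the constant term of F(x, 0) = x. *)
Lemma law_add0 : law_add F m0 = 0.
Proof.
have [H _ _ _ _] := FP; have := congr1 (fun f : mps R unit => f m0) H.
rewrite mpsX0 /fadd subst_coef0 // => -[s|s]; first exact: mpsX0.
exact: mcoef0.
Qed.

Section Const0.
Variable I : finType.
Implicit Types a b c : mps R I.

Lemma fadd_const0 a b : a m0 = 0 -> b m0 = 0 -> fadd F a b m0 = 0.
Proof. by move=> a0 b0; apply: subst_const0 law_add0; case. Qed.
Lemma fopp_const0 a : a m0 = 0 -> fopp F a m0 = 0.
Proof. by move=> a0; apply: subst_const0 => //; have [_ _ _ ->] := FP. Qed.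
Lemma fmul_const0 n a : a m0 = 0 -> fmul F n a m0 = 0.
Proof.
move=> a0; elim: n => [|n IH]; first exact: mcoef0.
by rewrite /fmul iterS; apply: fadd_const0.
Qed.
Lemma fcomb_const0 h (i : 'I_h -> nat) (a : 'I_h -> mps R I) :
  (forall j, a j m0 = 0) -> fcomb F i a m0 = 0.
Proof.
move=> a0; rewrite /fcomb; elim/big_ind: _ => [|x y|j _]; first exact: mcoef0.
  exact: fadd_const0.
exact: fmul_const0.
Qed.

Section SubstLaw.
Variables (J : finType) (e : I -> mps R J).
Hypothesis e0 : forall s, e s m0 = 0.

Lemma subst_fadd a b : a m0 = 0 -> b m0 = 0 ->
  subst (fadd F a b) e = fadd F (subst a e) (subst b e).
Proof.
move=> a0 b0; rewrite /fadd subst_comp //; last by case.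
by apply: eq_subst; case.
Qed.
Lemma subst_fopp a : a m0 = 0 -> subst (fopp F a) e = fopp F (subst a e).
Proof. by move=> a0; rewrite /fopp subst_comp. Qed.
Lemma subst_fmul n a : a m0 = 0 -> subst (fmul F n a) e = fmul F n (subst a e).
Proof.
move=> a0; elim: n => [|n IH]; first exact: subst0.
by rewrite /fmul !iterS -!/(fmul F n _) subst_fadd ?IH //; apply: fmul_const0.
Qed.
Lemma subst_fcomb h (i : 'I_h -> nat) (a : 'I_h -> mps R I) :
  (forall j, a j m0 = 0) ->
  subst (fcomb F i a) e = fcomb F i (fun j => subst (a j) e).
Proof.
move=> a0; rewrite /fcomb.
pose Q x y := subst x e = y /\ x m0 = 0.
suff [] : Q (\big[fadd F (I:=I)/0]_(j < h) fmul F (i j) (a j))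
  (\big[fadd F (I:=J)/0]_(j < h) fmul F (i j) (subst (a j) e)) by [].
elim/big_rec2: _ => [|j x y _ [<- y0]]; first by split; [exact: subst0 | exact: mcoef0].
have aj0 : fmul F (i j) (a j) m0 = 0 by exact: fmul_const0.
by split; [rewrite subst_fadd // subst_fmul | exact: fadd_const0].
Qed.
End SubstLaw.
End Const0.

Lemma faddC (I : finType) (a b : mps R I) : a m0 = 0 -> b m0 = 0 ->
  fadd F a b = fadd F b a.
Proof.
move=> a0 b0; have [_ H _ _ _] := FP.
pose e (s : unit + unit) := if s is inl _ then a else b.
have e0 s : e s m0 = 0 by case: s.
have := congr1 (fun f => subst f e) H.
by rewrite /= subst_fadd ?mpsX0 // !subst_X.
Qed.

Lemma fadd0r (I : finType) (a : mps R I) : a m0 = 0 -> fadd F a 0 = a.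
Proof.
move=> a0; have [H _ _ _ _] := FP.
have := congr1 (fun f => subst f (fun _ : unit => a)) H.
by rewrite /= subst_fadd ?mpsX0 ?mcoef0 // !subst_X // subst0.
Qed.

Lemma faddA (I : finType) (a b c : mps R I) : a m0 = 0 -> b m0 = 0 -> c m0 = 0 ->
  fadd F (fadd F a b) c = fadd F a (fadd F b c).
Proof.
move=> a0 b0 c0; have [_ _ H _ _] := FP.
pose e (s : (unit + unit) + unit) :=
  match s with inl (inl _) => a | inl (inr _) => b | inr _ => c end.
have e0 s : e s m0 = 0 by case: s => [[]|].
have := congr1 (fun f => subst f e) H.
by rewrite /= !subst_fadd ?fadd_const0 ?mpsX0 // !subst_X.
Qed.

(** Allows a series obtained in another way to be recognized as the formal inverse. *)
Lemma fopp_unique (I : finType) (a b : mps R I) : a m0 = 0 -> b m0 = 0 ->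
  fadd F a b = 0 -> b = fopp F a.
Proof.
move=> a0 b0 ab; have [_ _ _ o0 H] := FP.
have ao : fadd F a (fopp F a) = 0.
  have := congr1 (fun f => subst f (fun _ : unit => a)) H.
  by rewrite /= subst_fadd ?mpsX0 // subst_X // subst0.
have oa0 := fopp_const0 a0.
rewrite -[LHS]fadd0r // -ao -faddA // (faddC b0) // ab faddC ?mcoef0 //.
exact: fadd0r.
Qed.
Lemma fmul_add (I : finType) m n (a : mps R I) : a m0 = 0 ->
  fmul F (m + n) a = fadd F (fmul F m a) (fmul F n a).
Proof.
move=> a0; elim: m => [|m IH].
  by rewrite add0n faddC ?mcoef0 ?fadd0r // fmul_const0.
by rewrite addSn /fmul !iterS -!/(fmul F _ a) IH faddA // fmul_const0.
Qed.

Lemma fmul_mul (I : finType) m n (a : mps R I) : a m0 = 0 ->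
  fmul F (m * n) a = fmul F m (fmul F n a).
Proof.
by move=> a0; elim: m => [|m IH] //; rewrite mulSn fmul_add // IH /fmul iterS.
Qed.
End FormalGroup.

Section MapLaw.
Variables (R S : comPzRingType) (phi : {rmorphism R -> S}) (F : group_law R).

Lemma map_fadd (I : finType) (a b : mps R I) :
  map_mps phi (fadd F a b) = fadd (map_law phi F) (map_mps phi a) (map_mps phi b).
Proof. by rewrite /fadd map_subst; apply: eq_subst; case. Qed.

Lemma map_mps0 (I : finType) : map_mps phi (0 : mps R I) = 0.
Proof. exact: (rmorph0 (map_mps_rmorphism phi I)). Qed.

Lemma map_fmul (I : finType) n (a : mps R I) :
  map_mps phi (fmul F n a) = fmul (map_law phi F) n (map_mps phi a).
Proof.
elim: n => [|n IH]; first exact: map_mps0.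
by rewrite /fmul !iterS -!/(fmul _ n _) map_fadd IH.
Qed.

End MapLaw.

(** * Weierstrass division *)

(** A complete Hausdorff filtration by ideals, compatible with products. It is indexed by weights
    rather than by powers of one ideal, so that generators can be given different weights. *)
Record complete_filtration (R : comPzRingType) (F : nat -> R -> Prop) : Prop := {
  cf_all : forall x, F 0%N x;
  cf0 : forall m, F m 0;
  cfB : forall m x y, F m x -> F m y -> F m (x - y);
  cfM : forall a b x y, F a x -> F b y -> F (a + b)%N (x * y);
  cfS : forall m x, F m.+1 x -> F m x;
  cf_sep : forall x, (forall m, F m x) -> x = 0;
  cf_lim : forall s : nat -> R, (forall m, F m (s m.+1 - s m)) ->
    exists y, forall m, F m (y - s m) }.

Section FiltrationTheory.
Variables (R : comPzRingType) (F : nat -> R -> Prop) (CF : complete_filtration F).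

Lemma cf_le a b x : (a <= b)%N -> F b x -> F a x.
Proof.
by move/subnKC <-; elim: (b - a)%N => [|c IH]; rewrite ?addn0 // addnS => /(cfS CF).
Qed.
Lemma cfN m x : F m x -> F m (- x).
Proof. by rewrite -sub0r; apply: (cfB CF); apply: (cf0 CF). Qed.
Lemma cfD m x y : F m x -> F m y -> F m (x + y).
Proof. by move=> Fx Fy; rewrite -[y]opprK; apply: (cfB CF) => //; apply: cfN. Qed.
Lemma cf_sum m (T : eqType) (r : seq T) (P : pred T) (G : T -> R) :
  (forall x, x \in r -> P x -> F m (G x)) -> F m (\sum_(x <- r | P x) G x).
Proof.
move=> H; rewrite big_seq_cond; elim/big_rec: _ => [|x y /andP[xr Px] Fy].
  exact: (cf0 CF).
by apply: cfD => //; apply: H.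
Qed.
Lemma cfMr m x y : F m y -> F m (x * y).
Proof. by rewrite -[m]add0n; apply: (cfM CF); apply: (cf_all CF). Qed.
End FiltrationTheory.

Section SeriesFiltration.
Variables (R : comPzRingType) (F : nat -> R -> Prop) (CF : complete_filtration F).
Variables (I : finType) (wt : I -> nat).

Definition wdeg (nu : mindex I) : nat := (\sum_s wt s * nu s)%N.
(** A coefficient of weight w at nu gives a term of weight w + [wdeg nu]; the truncated subtraction
    imposes nothing on terms whose monomial alone weighs at least m. *)
Definition mps_filtration (m : nat) (f : mps R I) : Prop :=
  forall nu, F (m - wdeg nu) (f nu).

Lemma wdeg_add nu mu : wdeg (madd nu mu) = (wdeg nu + wdeg mu)%N.
Proof. by rewrite /wdeg -big_split /=; apply: eq_bigr => s _; rewrite ffunE mulnDr. Qed.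

Lemma mps_filtrationP : complete_filtration mps_filtration.
Proof.
split.
- by move=> f nu; rewrite sub0n; apply: (cf_all CF).
- by move=> m nu; rewrite mcoef0; apply: (cf0 CF).
- by move=> m f g Hf Hg nu; rewrite mcoefB; apply: (cfB CF).
- move=> a b f g Hf Hg nu; rewrite mcoefM; apply: (cf_sum CF) => mu.
  rewrite mem_below => /msubKC e _; rewrite -{1}e wdeg_add.
  apply: (cf_le CF) (cfM CF (Hf mu) (Hg (msub nu mu))).
  by rewrite leq_subLR addnACA leq_add // -leq_subLR.
- by move=> m f Hf nu; apply: (cf_le CF) (Hf nu); rewrite leq_sub2r.
- move=> f H; apply: mps_ext => nu; rewrite mcoef0; apply: (cf_sep CF) => m.
  by rewrite -(addnK (wdeg nu) m); apply: H.
move=> s H.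
(* The coefficient at nu is controlled only to weight m - [wdeg nu]; reading the sequence [wdeg nu]
   steps later restores weight m. *)
have L nu : exists y, forall m, F m (y - s (m + wdeg nu)%N nu).
  apply: (cf_lim CF (s := fun m => s (m + wdeg nu)%N nu)) => m.
  by have := H (m + wdeg nu)%N nu; rewrite addnK addSn.
exists (Mps (fun nu => sval (cid (L nu)))) => m nu; rewrite mcoefB /=.
have [le|lt] := leqP (wdeg nu) m; last first.
  by rewrite (eqP (ltnW lt : _ - _ == 0)%N); apply: (cf_all CF).
by have := svalP (cid (L nu)) (m - wdeg nu)%N; rewrite subnK.
Qed.

(** As f has no constant term, each of its monomials contains some [a s], which carries the whole
    weight m. *)
Lemma mps_filtration_subst (J : finType) m (f : mps R J) (a : J -> mps R I) :
  f m0 = 0 -> (forall s, mps_filtration m (a s)) -> mps_filtration m (subst f a).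
Proof.
move=> f0 Ha mu /=; apply: (cf_sum CF) => nu _ _.
have [e|ne] := eqVneq [ffun s => val (nu s)] (m0 : mindex J).
  by rewrite e f0 mul0r; apply: (cf0 CF).
apply: (cfMr CF); suff : mps_filtration m (\prod_s a s ^+ nu s) by exact.
have [s ns] : exists s, nu s != 0%N :> nat.
  apply/existsP; apply: contraR ne; rewrite negb_exists => /forallP H.
  by apply/eqP/ffunP => s; rewrite !ffunE; apply/eqP; rewrite -[_ == _]negbK; apply: H.
rewrite (bigD1 s) //= -(prednK (n := nu s)) ?lt0n // exprS -mulrA mulrC.
by apply: (cfMr mps_filtrationP).
Qed.
End SeriesFiltration.

(* With x of weight 1, the hypothesis says that c g is x^d up to terms of weight
   greater than d, so dividing the high part by x^d instead of g leaves a remainder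
   of weight one more; completeness sums the corrections. *)
Section Weierstrass.
Variables (R : comPzRingType) (F : nat -> R -> Prop) (CF : complete_filtration F).
Variables (I : finType) (wt : I + unit -> nat) (d : nat) (c : R).
Hypothesis wtx : wt (inr tt) = 1%N.
Local Notation K := (I + unit)%type.
Local Notation A := (mps R K).
Local Notation FA := (mps_filtration F wt).
Variable g : A.
Hypothesis gP : FA d.+1 (mpsC K c * g - mpsX (inr tt) ^+ d).

Let CA : complete_filtration FA := mps_filtrationP CF wt.
Definition x_index : mindex K := [ffun s => if s is inr _ then d else 0%N].
Definition low_part (f : A) : A := Mps (fun nu => if (d <= nu (inr tt))%N then 0 else f nu).
Definition high_part (f : A) : A := Mps (fun nu => f (madd nu x_index)).

Let Xd : mpsX (inr tt) ^+ d = mps_delta R x_index.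
Proof.
have := mono_X R (fun _ : unit => inr tt : K) (unitdeg d).
rewrite mono_unit_index ffunE => ->; congr mps_delta; apply/ffunP => -[s|[]].
  by rewrite !ffunE big_pred0.
by rewrite !ffunE (big_pred1 tt) ?ffunE // => -[].
Qed.

Let split_low f : f = low_part f + mpsX (inr tt) ^+ d * high_part f.
Proof.
apply: mps_ext => nu; rewrite mcoefD mcoefM Xd.
have le_x : mle x_index nu = (d <= nu (inr tt))%N.
  apply/forallP/idP => [/(_ (inr tt))|le [s|[]]]; rewrite ffunE //.
rewrite [low_part f nu]/=; case: leqP => le.
  rewrite add0r (bigD1_seq x_index) ?below_uniq ?mem_below ?le_x //=.
  rewrite eqxx mul1r maddC msubKC ?le_x // big1 ?addr0 // => mu /negPf ->.
  by rewrite mul0r.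
rewrite big_seq big1 ?addr0 // => mu; rewrite mem_below => H /=.
case: eqP => [e|]; last by rewrite mul0r.
by move: H; rewrite e le_x leqNgt le.
Qed.

Lemma low_partB f h : low_part (f - h) = low_part f - low_part h.
Proof. by apply: mps_ext => nu; rewrite mcoefB /=; case: ifP; rewrite ?subrr. Qed.

Let FA_low m f : FA m f -> FA m (low_part f).
Proof. by move=> H nu /=; case: ifP => _; [apply: (cf0 CF) | apply: H]. Qed.

Let FA_high m f : FA m f -> FA (m - d) (high_part f).
Proof.
move=> H nu /=; have := H (madd nu x_index); rewrite wdeg_add.
suff -> : wdeg wt x_index = d by rewrite [(_ + d)%N]addnC subnDA.
rewrite /wdeg big_sumType /= big1 => [|s _]; last by rewrite ffunE muln0.
by rewrite (big_pred1 tt) => [|[]] //; rewrite ffunE wtx mul1n.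
Qed.

Let quo f := mpsC K c * high_part f.
Let next f := f - quo f * g - low_part f.

Let next_FA m f : FA m f -> FA m.+1 (next f).
Proof.
(* x^d times [high_part f] is f minus its low part, so what remains is a multiple of c g - x^d: the
   high part loses weight d and this factor brings d + 1. *)
move=> H; have -> : next f = - ((mpsC K c * g - mpsX (inr tt) ^+ d) * high_part f).
  rewrite /next {1}(split_low f) /quo addrAC [low_part f + _]addrC addrK.
  by rewrite mulrBl opprB; congr (_ - _); rewrite mulrAC.
apply: (cfN CA); apply: (cf_le CA) (cfM CA gP (FA_high H)).
by rewrite addSn ltnS -leq_subLR.
Qed.

Lemma weierstrass_division f : exists q r : A,
  f = q * g + r /\ forall nu : mindex K, (d <= nu (inr tt))%N -> r nu = 0.
Proof.
pose fs m := iter m next f.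
have fsP m : FA m (fs m).
  by elim: m => [|m /next_FA //]; apply: (cf_all CA).
pose qs m := \sum_(i < m) quo (fs i); pose rs m := \sum_(i < m) low_part (fs i).
have e m : f = qs m * g + rs m + fs m.
  elim: m => [|m IH]; first by rewrite /qs /rs !big_ord0 mul0r !add0r.
  rewrite {1}IH /qs /rs !big_ord_recr /= -/(qs m) -/(rs m) mulrDl.
  set a := quo _ * g; set b := low_part _; set x := fs m.
  rewrite -{1}(subrK a x) -{1}(subrK b (x - a)) [_ + a + (_ + b)]addrACA -!addrA.
  by congr (_ + (_ + _)); rewrite [RHS]addrA [RHS]addrC [a + b]addrC -!addrA.
(* Quotients lose weight d, hence the shift of the sequence by d. *)
have [q qP] : exists q, forall m, FA m (q - qs (m + d)%N).
  apply: (cf_lim CA (s := fun m => qs (m + d)%N)) => m.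
  rewrite addSn /qs big_ord_recr /= addrAC subrr add0r; apply: (cfMr CA).
  by have := FA_high (fsP (m + d)%N); rewrite addnK.
have [r rP] : exists r, forall m, FA m (r - rs m).
  apply: (cf_lim CA) => m; rewrite /rs big_ord_recr /= addrAC subrr add0r.
  exact: FA_low.
exists q, (low_part r); split; last by move=> nu le /=; rewrite le.
apply/eqP; rewrite -subr_eq0; apply/eqP; apply: (cf_sep CA) => m.
rewrite {1}(e (m + d)%N).
have lrs : low_part (rs (m + d)%N) = rs (m + d)%N.
  apply: mps_ext => nu /=; case: ifP => // le; rewrite mcoef_sum big1 // => i _.
  by rewrite /= le.
have -> : low_part r = rs (m + d)%N + low_part (r - rs (m + d)%N).
  by rewrite low_partB lrs addrC subrK.
have -> : q = qs (m + d)%N + (q - qs (m + d)%N) by rewrite addrC subrK.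
set u := qs _; set v := rs _; set x := q - u; set y := low_part _.
rewrite mulrDl [u * g + x * g + _]addrACA opprD addrACA subrr add0r opprD addrA.
apply: (cfB CA); last by apply: FA_low; apply: (cf_le CA) (rP _); rewrite leq_addr.
apply: (cfB CA); first by apply: (cf_le CA) (fsP _); rewrite leq_addr.
by rewrite mulrC; apply: (cfMr CA).
Qed.
End Weierstrass.

(** * Lowest terms and finite height *)

Section LowestTerm.
Variable R : comPzRingType.
Implicit Types f g : mps R unit.

Lemma unitdegE (n : mindex unit) : n = unitdeg (n tt).
Proof. by apply/ffunP => -[]; rewrite ffunE. Qed.
Lemma mdeg_unit (n : mindex unit) : mdeg n = n tt.
Proof. by rewrite /mdeg (big_pred1 tt) // => -[]. Qed.
Lemma mdeg_unitdeg n : mdeg (unitdeg n) = n.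
Proof. by rewrite mdeg_unit ffunE. Qed.

Lemma lowest_termM f g a b : order_ge a f -> order_ge b g ->
  (f * g) (unitdeg (a + b)) = f (unitdeg a) * g (unitdeg b).
Proof.
move=> Hf Hg; have -> : unitdeg (a + b) = madd (unitdeg a) (unitdeg b).
  by apply/ffunP => s; rewrite !ffunE.
rewrite mcoefM (bigD1_seq (unitdeg a)) ?below_uniq ?mem_below ?mle_addr //.
rewrite maddK big_seq_cond big1 => [|mu /andP[]]; first exact: addr0.
rewrite mem_below => le ne; have [lt|ge] := ltnP (mdeg mu) a; first by rewrite Hf ?mul0r.
rewrite [g _]Hg ?mulr0 // -(ltn_add2l (mdeg mu)) mdeg_sub // mdeg_add !mdeg_unitdeg.
rewrite ltn_add2r ltn_neqAle ge andbT; apply: contra ne => /eqP ->.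
by rewrite mdeg_unit -unitdegE.
Qed.

Lemma lowest_termX g b n : order_ge b g ->
  order_ge (n * b) (g ^+ n) /\ (g ^+ n) (unitdeg (n * b)) = g (unitdeg b) ^+ n.
Proof.
move=> Hg; elim: n => [|n [IH1 IH2]].
  rewrite mul0n; split=> //; rewrite !expr0 mcoef1; case: eqP => //.
by rewrite !exprS mulSn; split; [exact: order_geMM | rewrite lowest_termM // IH2].
Qed.
End LowestTerm.

Section FieldSeries.
Variable k : fieldType.
Implicit Types f g : mps k unit.

Lemma series_order f : f <> 0 -> exists d, order_ge d f /\ f (unitdeg d) != 0.
Proof.
move=> f0; have ex : exists d, f (unitdeg d) != 0.
  apply: contrapT => H; apply: f0; apply: mps_ext => n; rewrite mcoef0.
  by apply/eqP; apply: contraPT isT => ne _; apply: H; exists (n tt); rewrite -unitdegE.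
exists (ex_minn ex); case: ex_minnP => d fd min; split=> // n lt.
apply/eqP; apply: contraTT lt => ne; rewrite -leqNgt mdeg_unit; apply: min.
by rewrite -unitdegE.
Qed.

(** Orders multiply: in degree a b the coefficient of f(g) is f_a g_b^a, nonzero in a field.
    Positivity of b keeps the higher terms of f out of that degree. *)
Lemma subst_neq0 f g : f <> 0 -> g <> 0 -> g m0 = 0 -> subst f (fun=> g) <> 0.
Proof.
move=> /series_order[a [Hf fa]] /series_order[b [Hg gb]] g0.
have b_gt0 : (0 < b)%N.
  rewrite lt0n; apply/eqP => b0; move: gb; rewrite b0.
  suff -> : unitdeg 0 = m0 by rewrite g0 eqxx.
  by apply/ffunP => s; rewrite !ffunE.
move=> /(congr1 (fun h : mps k unit => h (unitdeg (a * b)))).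
rewrite mcoef0 (@subst_coef _ _ _ _ _ _ _ (maxn (a * b) a).+1) //; last first.
  by rewrite mdeg_unitdeg ltnS leq_maxl.
rewrite (bigD1_seq (unitdeg a)) ?mons_uniq ?mem_mons ?mdeg_unitdeg ?ltnS ?leq_maxr //.
have mE n : mono (fun _ : unit => g) n = g ^+ n tt by rewrite mono_unit_index.
rewrite mE ffunE (lowest_termX a Hg).2 big1 => [|n ne].
  by move=> /eqP; rewrite -[_ == 0]/(f (unitdeg a) * g (unitdeg b) ^+ a + 0 == 0)
    addr0 mulf_eq0 expf_eq0 (negPf fa) (negPf gb) andbF.
have [lt|ge] := ltnP (mdeg n) a; first by rewrite Hf ?mul0r.
rewrite mE (lowest_termX (n tt) Hg).1 ?mulr0 // mdeg_unitdeg ltn_pmul2r //.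
rewrite -mdeg_unit ltn_neqAle ge andbT; apply: contra ne => /eqP ->.
by rewrite mdeg_unit -unitdegE.
Qed.
End FieldSeries.

(** The height speaks of [p] only; as [p^m] is its m-fold iterate, [subst_neq0] propagates
    nonvanishing to every m. *)
Lemma fmul_pow_neq0 (R : comPzRingType) (F : group_law R) (k : fieldType)
    (rho : {rmorphism R -> k}) p m : is_group_law F ->
  fmul (map_law rho F) p (mpsX tt) <> 0 ->
  map_mps rho (fmul F (p ^ m) (mpsX tt)) <> 0.
Proof.
move=> FP p0; elim: m => [|m IH].
  rewrite expn0 /fmul /= fadd0r ?mpsX0 // map_mpsX.
  move=> /(congr1 (fun h : mps k unit => h (unitdeg 1))) /=.
  rewrite if_same; case: eqP => [_ /eqP|[]]; first by rewrite oner_eq0.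
  by apply/ffunP => -[]; rewrite !ffunE.
have x0 : mpsX tt m0 = 0 :> R by exact: mpsX0.
have -> : fmul F (p ^ m.+1) (mpsX tt) =
    subst (fmul F (p ^ m) (mpsX tt)) (fun=> fmul F p (mpsX tt)).
  rewrite (subst_fmul FP) ?subst_X // => *; try exact: fmul_const0.
  by rewrite expnSr fmul_mul.
rewrite map_subst; apply: subst_neq0 => //.
  by rewrite map_fmul map_mpsX.
by rewrite /= fmul_const0 // rmorph0.
Qed.

(** * Division by [p^m](x) - e over E^0 *)

Section Filtrations.

Lemma complete_filtration_bij (A B : comPzRingType) (h : {rmorphism A -> B}) F :
  bijective h -> complete_filtration F ->
  complete_filtration (fun m y => exists2 x, F m x & y = h x).
Proof.
move=> [g hK gK] CF; split.
- by move=> y; exists (g y); rewrite ?gK //; apply: (cf_all CF).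
- by move=> m; exists 0; rewrite ?rmorph0 //; apply: (cf0 CF).
- by move=> m _ _ [x Hx ->] [y Hy ->]; exists (x - y); rewrite ?rmorphB //; apply: (cfB CF).
- by move=> a b _ _ [x Hx ->] [y Hy ->]; exists (x * y); rewrite ?rmorphM //; apply: (cfM CF).
- by move=> m _ [x Hx ->]; exists x => //; apply: (cfS CF).
- move=> y H; rewrite -(gK y) (cf_sep CF (x := g y)) ?rmorph0 // => m.
  by have [x Hx ->] := H m; rewrite hK.
move=> s H; have [m|y Hy] := cf_lim CF (s := g \o s).
  have [x Hx e] := H m; suff -> : (g \o s) m.+1 - (g \o s) m = x by [].
  by apply: (can_inj hK); rewrite rmorphB /= !gK.
by exists (h y) => m; exists (y - g (s m)); rewrite // rmorphB gK.
Qed.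

(* Rescaled so that p has weight d + 1: see the weights in [p_series_division]. *)
Lemma padic_filtration (p d : nat) (W : comPzRingType) :
  is_completion (idfun : {rmorphism W -> W}) (eq p%:R) ->
  complete_filtration (fun m (x : W) => exists w, x = p%:R ^+ ((m + d) %/ d.+1) * w).
Proof.
have im : image_of (idfun : {rmorphism W -> W}) (eq p%:R) = eq p%:R.
  apply/funext => y; apply/propext; split=> [[_ <- ->]|<-] //.
  by exists p%:R.
rewrite /is_completion im => -[_ _ sep lim].
(* The ceiling of m / (d + 1): the least exponent of p of weight at least m. Its subadditivity gives
   the product axiom. *)
pose cd m := ((m + d) %/ d.+1)%N.
have cd_le a b : (a <= b)%N -> (cd a <= cd b)%N.
  by move=> le; apply: leq_div2r; rewrite leq_add2r.
have cdM m : cd (m * d.+1)%N = m by rewrite /cd divnMDl // divn_small ?addn0.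
have le_cdM m : (m <= cd m * d.+1)%N.
  by rewrite -ltnS -(ltn_add2r d) addSnnS [X in (_ < X)%N]addnC -mulSn ltn_ceil.
have cdD a b : (cd (a + b) <= cd a + cd b)%N.
  by rewrite -(cdM (cd a + cd b)%N); apply: cd_le; rewrite mulnDl leq_add.
pose G m (x : W) := exists w, x = p%:R ^+ m * w.
have G_le a b x : (a <= b)%N -> G b x -> G a x.
  by move=> /subnKC <- [w ->]; exists (p%:R ^+ (b - a) * w); rewrite exprD mulrA.
have GB m x y : G m x -> G m y -> G m (x - y).
  by move=> [w ->] [v ->]; exists (w - v); rewrite mulrBr.
split; rewrite -/(G _ _).
- by move=> x; exists x; rewrite add0n divn_small // mul1r.
- by move=> m; exists 0; rewrite mulr0.
- by move=> m x y; apply: GB.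
- move=> a b x y [w ->] [v ->]; apply: (G_le _ (cd a + cd b)%N); first exact: cdD.
  by exists (w * v); rewrite exprD mulrACA.
- by move=> m x; apply: G_le; apply: cd_le.
- move=> x H; apply: sep => m; apply/ideal_pow_principal.
  by have := H (m * d.+1)%N; rewrite -/(cd _) cdM.
move=> s H.
have Hs a b : (a <= b)%N -> G (cd a) (s b - s a).
  move=> /subnKC <-; elim: (b - a)%N => [|c IH].
    by exists 0; rewrite addn0 subrr mulr0.
  rewrite addnS -(subrK (s (a + c)%N) (s (a + c).+1)) -addrA.
  rewrite -[X in _ + X]opprK; apply: GB.
    by apply: G_le (H _); apply: cd_le; rewrite leq_addr.
  by have [w ->] := IH; exists (- w); rewrite mulrN.
(* At multiples of d + 1 the filtration is by whole powers of p, so p-adic completeness applies to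
   this subsequence. *)
have [m|y Hy] := lim (fun m => s (m * d.+1)%N).
  apply/ideal_pow_principal.
  by have := Hs (m * d.+1) (m.+1 * d.+1); rewrite cdM leq_pmul2r //; apply.
exists y => m; have /ideal_pow_principal := Hy (cd m).
rewrite -/(G _ _) => Hcd; rewrite -(subrK (s (cd m * d.+1)%N) y) -addrA -[X in _ + X]opprK.
apply: GB => //; have [w ->] := Hs _ _ (le_cdM m); by exists (- w); rewrite mulrN.
Qed.
End Filtrations.

Lemma mps_filtration_rename (R : comPzRingType) (F : nat -> R -> Prop)
    (I J : finType) (v : I -> J) (wt : J -> nat) m (f : mps R I) :
  complete_filtration F -> f m0 = 0 -> (forall s, (m <= wt (v s))%N) ->
  mps_filtration F wt m (rename v f).
Proof.
move=> CF f0 le; apply: (mps_filtration_subst CF) => // s nu /=.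
case: eqP => [->|_]; last exact: (cf0 CF).
suff -> : (m - wdeg wt [ffun r => nat_of_bool (r == v s)] = 0)%N by exact: (cf_all CF).
apply/eqP; rewrite subn_eq0; apply: leq_trans (le s) _.
by rewrite /wdeg (bigD1 (v s)) //= ffunE eqxx muln1 leq_addr.
Qed.

Section EtheoryDivision.
Variables (p n : nat) (Z : padic_integers p) (k : fieldType) (E : cohomology).
Variable M : morava_E Z n k E.
Local Notation R := (coef E).

Definition etheory_filtration (d m : nat) (y : R) : Prop :=
  exists2 x, mps_filtration (fun m (x : mE_witt M) =>
    exists w, x = p%:R ^+ ((m + d) %/ d.+1) * w) (fun=> d.+1) m x & y = mE_coef M x.

Lemma etheory_filtrationP d : complete_filtration (etheory_filtration d).
Proof.
apply: complete_filtration_bij; first exact: (mE_coefP M).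
apply: mps_filtrationP; apply: padic_filtration.
by have [] := mE_wittP M.
Qed.

(** The kernel of [mE_rho M] is the maximal ideal (p, u_1, ..., u_(n-1)): the constant term of an
    element is divisible by p, and every other term contains some u_j, each generator having weight
    d + 1. *)
Lemma etheory_filtration_ker d y : mE_rho M y = 0 -> etheory_filtration d d.+1 y.
Proof.
have [g gK hK] := mE_coefP M; rewrite -(hK y) mE_rhoP => r0; exists (g y) => // nu.
have [_ _ _ /(_ (g y m0))[/(_ r0)[w e] _]] := mE_wittP M.
have [->|ne] := eqVneq nu m0.
  have -> : wdeg (fun=> d.+1) (m0 : mindex 'I_n.-1) = 0%N.
    by rewrite /wdeg big1 // => s _; rewrite ffunE muln0.
  exists w; rewrite subn0 -{1}[d.+1]mul1n divnMDl // divn_small // addn0.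
  by rewrite e mulr_natl.
have : (0 < mdeg nu)%N by rewrite lt0n mdeg_eq0.
rewrite /wdeg -big_distrr /= -/(mdeg nu) => lt; exists (g y nu).
rewrite (_ : d.+1 - _ = 0)%N; last by apply/eqP; rewrite subn_eq0 leq_pmulr.
by rewrite add0n divn_small // mul1r.
Qed.

(** Here finite height enters: d is the order of [p^m](x) over the residue field, and c lifts the
    inverse of its lowest coefficient there. *)
Lemma p_series_division (I : finType) (e : mps R I) m (f : mps R (I + unit)%type) :
  e m0 = 0 -> exists d q r,
    f = q * (fmul (mE_law M) (p ^ m) (mpsX (inr tt)) - rename inl e) + r /\
    forall nu : mindex (I + unit)%type, (d <= nu (inr tt))%N -> r nu = 0.
Proof.
move=> e0; have FP := mE_lawP M; set P := fmul (mE_law M) (p ^ m) (mpsX tt : mps R unit).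
have P0 : map_mps (mE_rho M) P <> 0.
  apply: fmul_pow_neq0 => // H; have [_] := mE_height M.
  by apply; rewrite H mcoef0.
have [d [ordP Pd]] := series_order P0.
have [c Hc] : exists c, mE_rho M (1 - c * P (unitdeg d)) = 0.
  have [_ _ /(_ (mE_rho M (P (unitdeg d)))^-1)[x Hx] _] := mE_wittP M.
  exists (mE_coef M (mpsC _ x)); rewrite rmorphB rmorph1 rmorphM mE_rhoP /= eqxx Hx.
  by rewrite mulVf ?subrr.
have CF := etheory_filtrationP d.
(* p, the u_j and the variables in I weigh d + 1, so that every term of
   [p^m](x) - e other than that in x^d has weight greater than d. *)
pose wt (s : I + unit) := if s is inl _ then d.+1 else 1%N.
suff gP : mps_filtration (etheory_filtration d) wt d.+1
    (mpsC _ c * (fmul (mE_law M) (p ^ m) (mpsX (inr tt)) - rename inl e) - mpsX (inr tt) ^+ d).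
  have [q [r H]] := @weierstrass_division _ _ CF I wt d c (erefl _) _ gP f.
  by exists d, q, r.
have CA := mps_filtrationP CF wt.
have x0 s : mpsX (inr s : I + unit) m0 = 0 :> R by exact: mpsX0.
have -> : fmul (mE_law M) (p ^ m) (mpsX (inr tt : I + unit)) = rename inr P.
  by rewrite /rename (subst_fmul FP) ?subst_X // mpsX0.
rewrite mulrBr addrAC; apply: (cfB CA); last first.
  by apply: (cfMr CA); apply: mps_filtration_rename.
have -> : mpsC _ c * rename inr P - mpsX (inr tt : I + unit) ^+ d =
    rename inr (mpsC _ c * P - mpsX tt ^+ d).
  rewrite /rename substB // substM // subst_C //; congr (_ - _).
  by rewrite -[RHS]/(subst_rmorphism x0 _) rmorphXn /= subst_X.
move=> nu; rewrite rename_coef; last by move=> ? ? [].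
case: eqP => [->|_]; last exact: (cf0 CF).
rewrite push_indexK; last by move=> ? ? [].
set ka := pull_index _ _.
have -> : wdeg wt (push_index inr ka) = ka tt.
  rewrite /wdeg big_sumType /= big1 => [|s _]; last by rewrite ffunE big_pred0 ?muln0.
  by rewrite (big_pred1 tt) => [|[]] //; rewrite ffunE mul1n (big_pred1 tt) // => -[].
rewrite mcoefB mcoefCM mpsX_unit_exp [mps_delta _ _ _]/=.
(* Below degree d the coefficients of [p^m](x) reduce to 0; above it the power of x alone weighs
   enough; in degree d, c P_d - 1 reduces to 0. *)
have [lt|lt|eq] := ltngtP (ka tt) d.
- apply: (cf_le CF (b := d.+1)); first exact: leq_subr.
  apply: etheory_filtration_ker; rewrite rmorphB rmorphM.
  rewrite -[mE_rho M (P _)]/(map_mps (mE_rho M) P ka).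
  rewrite ordP ?mdeg_unit // mulr0; case: eqP => [kad|_]; last by rewrite rmorph0 subrr.
  by move: lt; rewrite kad ffunE ltnn.
- by rewrite (eqP (lt : d.+1 - _ == 0)%N); apply: (cf_all CF).
apply: (cf_le CF (b := d.+1)); first exact: leq_subr.
have -> : ka = unitdeg d by rewrite [ka]unitdegE eq.
rewrite eqxx -opprB; apply: (cfN CF); exact: etheory_filtration_ker.
Qed.
End EtheoryDivision.

Lemma partial_sum_reindex (R S : comPzRingType) (phi : {rmorphism R -> S})
    (I J : finType) (v : I -> J) (a : J -> S) (f : mps R I) M : bijective v ->
  partial_sum phi a (Mps (fun nu => f (pull_index v nu))) M =
  partial_sum phi (fun s => a (v s)) f M.
Proof.
move=> bv; have [w vK wK] := bv; rewrite !partial_sumE.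
have pK : cancel (pull_index v) (pull_index w).
  by move=> nu; apply/ffunP => r; rewrite !ffunE wK.
have pK' : cancel (pull_index w) (pull_index v).
  by move=> nu; apply/ffunP => r; rewrite !ffunE vK.
have dv nu : mdeg (pull_index v nu) = mdeg nu.
  rewrite /mdeg [RHS](reindex v) /=; last exact: onW_bij.
  by apply: eq_bigr => s _; rewrite ffunE.
transitivity (\sum_(nu <- [seq pull_index v mu | mu <- mons J M])
    phi (f nu) * mono (fun s => a (v s)) nu).
  rewrite big_map; apply: eq_bigr => nu _; congr (_ * _).
  rewrite /mono [LHS](reindex v) /=; last exact: onW_bij.
  by apply: eq_bigr => s _; rewrite ffunE.
apply: perm_big; apply: uniq_perm; rewrite ?mons_uniq //.
  by rewrite map_inj_uniq ?mons_uniq //; apply: can_inj pK.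
move=> nu; rewrite mem_mons; apply/mapP/idP => [[mu]|lt].
  by rewrite mem_mons => lt ->; rewrite dv.
by exists (pull_index w nu); rewrite ?pK' // mem_mons -dv pK'.
Qed.

(** * Characters and Euler classes *)

Section Skeleta.
Variable E : cohomology.

Lemma pull0_comp (X Y W : sSet) (f : smap X Y) (g : smap Y W) (h : smap X W)
    (x : coh0 E W) : (forall m s, h m s = g m (f m s)) ->
  pull0 h x = pull0 f (pull0 g x).
Proof. exact: (@pull_comp E 0 _ _ _ (absmap f) (absmap g) (absmap h) x). Qed.

Section Filtration.
Variable X : sSet.
Lemma skeletal0 s : skeletal_filtration s (0 : coh0 E X).
Proof. exact: raddf0. Qed.
Lemma skeletalB s (x y : coh0 E X) : skeletal_filtration s x ->
  skeletal_filtration s y -> skeletal_filtration s (x - y).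
Proof. by move=> Hx Hy; apply: etrans (rmorphB _ _ _) _; rewrite /= Hx Hy subr0. Qed.
Lemma skeletalM s (x y : coh0 E X) : skeletal_filtration s y ->
  skeletal_filtration s (x * y).
Proof. by move=> Hy; apply: etrans (rmorphM _ _ _) _; rewrite /= Hy mulr0. Qed.
End Filtration.

Lemma skeletal_pull (X Y : sSet) (f : smap X Y) s (y : coh0 E Y) :
  skeletal_filtration s y -> skeletal_filtration s (pull0 f y).
Proof.
rewrite /skeletal_filtration => H.
have fs m x : @sub (skeleton s X) m x -> @sub (skeleton s Y) m (f m x).
  by move=> [l [g [hg [z [le ->]]]]]; exists l, g, hg, (f l z); rewrite sfun_act.
pose F : Defs.pmap (skeleton s X) (skeleton s Y) := @PMap (skeleton s X) (skeleton s Y) f fs.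
pose h := Defs.scomp f (sub_incl (skeleton s X)).
rewrite -(@pull0_comp _ _ _ _ _ h) //.
rewrite (@pull0_comp _ _ _ (Defs.sub_map F) (sub_incl (skeleton s Y))) //.
by rewrite H raddf0.
Qed.

Lemma coh_value_pull (X Y : sSet) (f : smap X Y) (I : finType) (a : I -> coh0 E Y)
    (g : mps (coef E) I) y :
  coh_value a g y -> coh_value (fun s => pull0 f (a s)) g (pull0 f y).
Proof.
move=> H s; have [N HN] := H s; exists N => M /HN /(skeletal_pull f).
rewrite rmorphB; congr (skeletal_filtration s (_ - _)).
rewrite !partial_sumE rmorph_sum; apply: eq_bigr => nu _.
by rewrite rmorphM rmorph_mono; congr (_ * _); apply/esym/pull0_comp.
Qed.
End Skeleta.

Section EulerClasses.
Variables (p : nat) (Z : padic_integers p) (E : cohomology).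
Variable x : coh0 E (classifying (QpZp Z)).

Lemma pull_classifying (G H K : zmodType) (f : {additive G -> H})
    (g : {additive H -> K}) (h : {additive G -> K}) (y : coh0 E (classifying K)) :
  (forall s, h s = g (f s)) ->
  pull0 (classifying_map f) (pull0 (classifying_map g) y) = pull0 (classifying_map h) y.
Proof.
move=> e; apply/esym/pull0_comp => m s.
by apply: eq_exist; apply/funext => i; apply/funext => j; apply: e.
Qed.

Lemma pull_euler (G H : zmodType) (f : {additive G -> H})
    (chi : {additive H -> QpZp Z}) (chi' : {additive G -> QpZp Z}) :
  (forall s, chi' s = chi (f s)) ->
  pull0 (classifying_map f) (euler x chi) = euler x chi'.
Proof. exact: pull_classifying. Qed.

(* The zero character factors through the 0-skeleton. *)
Lemma euler0 (G : zmodType) (chi : {additive G -> QpZp Z}) :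
  skeletal_filtration 0 x -> (forall s, chi s = 0) -> euler x chi = 0.
Proof.
move=> x0 chi0.
pose z m : nerve_simplex (QpZp Z) m :=
  exist (@is_cocycle (QpZp Z) m) (fun _ _ => 0) (fun _ _ _ => addr0 0).
have mon m : monotone (fun _ : 'I_m.+1 => ord0 : 'I_1) by [].
have zs m : @sub (skeleton 0 (classifying (QpZp Z))) m (z m).
  by exists 0%N, (fun=> ord0), (mon m), (z 0%N); split=> //; apply: eq_exist.
have zact m l (f : 'I_m.+1 -> 'I_l.+1) (hf : monotone f) (s : classifying G l) :
  exist _ (z m) (zs m) =
  sact hf (exist _ (z l) (zs l) : subspace (skeleton 0 (classifying (QpZp Z))) l).
  by apply: eq_exist; apply: eq_exist.
pose f : smap (classifying G) (subspace (skeleton 0 (classifying (QpZp Z)))) :=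
  @SMap (classifying G) (subspace (skeleton 0 (classifying (QpZp Z))))
    (fun m _ => exist _ (z m) (zs m)) zact.
rewrite /euler (@pull0_comp _ _ _ _ f (sub_incl _)) ?x0 ?raddf0 // => m s.
by apply: eq_exist; apply/funext => i; apply/funext => j /=.
Qed.
End EulerClasses.

(** * Evaluation of series at characters *)

Section Evaluation.
Variables (p n : nat) (Z : padic_integers p) (k : fieldType) (E : cohomology).
Variable M : morava_E Z n k E.
Local Notation R := (coef E).
Local Notation QZ := (QpZp Z).
Local Notation e := (euler (mE_x M)).

Section Universal.
Variable I : finType.

(** [mE_xP] is about variables numbered by ['I_r]; for an arbitrary I the coordinates are numbered
    through [enum_rank]. *)
Definition torus : zmodType := 'rV[QZ]_#|I|.
Definition torus_coord (s : I) : {additive torus -> QZ} := coord_rV QZ (enum_rank s).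
Definition torus_class (s : I) : coh0 E (classifying torus) := e (torus_coord s).

Let reindex (f : mps R I) : mps R 'I_#|I| := Mps (fun nu => f (pull_index enum_rank nu)).

Let value_reindex f y : coh_value torus_class f y <->
  coh_value (fun j : 'I_#|I| => e (coord_rV QZ j)) (reindex f) y.
Proof.
rewrite /coh_value /is_value.
have E1 m := @partial_sum_reindex _ _ (pull0 (sconst (classifying torus))) _ _
  _ (fun j : 'I_#|I| => e (coord_rV QZ j)) f m (@enum_rank_bij I).
by split=> H s; have [N HN] := H s; exists N => m /HN; rewrite E1.
Qed.

(** By uniqueness of values: such a y is, like 0, a value of the zero series. It extends uniqueness
    from the coordinate classes to values at arbitrary classes on a torus. *)
Lemma torus_hausdorff (y : coh0 E (classifying torus)) :
  (forall s, skeletal_filtration s y) -> y = 0.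
Proof.
move=> H; have [_ U _ _] := mE_xP M #|I|; apply: (U 0) => s; exists 0%N => m _.
  rewrite partial_sumE big1 ?subr0 // => nu _.
  by rewrite mcoef0 rmorph0 mul0r.
rewrite partial_sumE big1 ?subr0; first exact: skeletal0.
by move=> nu _; rewrite mcoef0 rmorph0 mul0r.
Qed.

Lemma torus_value_unique (J : finType) (a : J -> coh0 E (classifying torus)) f y z :
  coh_value a f y -> coh_value a f z -> y = z.
Proof.
move=> Hy Hz; apply/eqP; rewrite -subr_eq0; apply/eqP; apply: torus_hausdorff => s.
have [N /(_ _ (leqnn N))] := is_valueB (@skeletalB E _) Hy Hz s.
rewrite partial_sumE big1 ?subr0 // => nu _.
by rewrite subrr mcoef0 rmorph0 mul0r.
Qed.

Lemma torus_value f : exists y, coh_value torus_class f y.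
Proof.
have [H _ _ _] := mE_xP M #|I|; have [y Hy] := H (reindex f).
by exists y; apply/value_reindex.
Qed.

Definition torus_eval f := sval (cid (torus_value f)).
Lemma torus_evalP f : coh_value torus_class f (torus_eval f).
Proof. exact: (svalP (cid (torus_value f))). Qed.

(** The Euler classes behave as topologically nilpotent elements because every series has a value at
    them. *)
Lemma torus_continuous : continuous_at (@skeletal_filtration E _) torus_class.
Proof.
by apply: values_continuous torus_value; apply: skeletalB.
Qed.

Lemma torus_eval_zmod : zmod_morphism torus_eval.
Proof.
move=> f g; apply: torus_value_unique (torus_evalP _) _.
by apply: is_valueB (torus_evalP f) (torus_evalP g); apply: skeletalB.
Qed.

Lemma torus_evalC c : torus_eval (mpsC I c) = pull0 (sconst _) c.
Proof.
apply: torus_value_unique (torus_evalP _) _.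
have := is_value_delta (pull0 (sconst (classifying torus))) (@skeletal0 E _) torus_class m0 c.
by rewrite delta0 mono0 !mulr1.
Qed.

Lemma torus_evalX s : torus_eval (mpsX s) = torus_class s.
Proof.
apply: torus_value_unique (torus_evalP _) _.
have := is_value_delta (pull0 (sconst (classifying torus))) (@skeletal0 E _) torus_class
  [ffun r => nat_of_bool (r == s)] 1.
by rewrite !rmorph1 !mul1r mono_unit.
Qed.

Lemma torus_eval_monoid : monoid_morphism torus_eval.
Proof.
split=> [|f g]; first by have := torus_evalC 1; rewrite !rmorph1.
apply: torus_value_unique (torus_evalP _) _.
apply: is_valueM (torus_evalP f) (torus_evalP g).
- exact: skeletal0.
- exact: skeletalB.
- exact: skeletalM.
- exact: torus_continuous.
Qed.

HB.instance Definition _ :=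
  GRing.isZmodMorphism.Build (mps R I) (coh0 E (classifying torus)) torus_eval torus_eval_zmod.
HB.instance Definition _ :=
  GRing.isMonoidMorphism.Build (mps R I) (coh0 E (classifying torus)) torus_eval torus_eval_monoid.

Lemma torus_eval_inj f : torus_eval f = 0 -> f = 0.
Proof.
move=> f0; have [_ _ _ H] := mE_xP M #|I|.
have /value_reindex := torus_evalP f; rewrite f0 => /H G0.
have {}G0 : reindex f = 0 by elim: G0.
apply: mps_ext => nu; have := congr1 (fun g : mps R 'I_#|I| => g (pull_index enum_val nu)) G0.
rewrite !mcoef0 /= => <-; congr (f _); apply/ffunP => s.
by rewrite !ffunE enum_rankK.
Qed.

Lemma torus_eval_surj y : exists f, torus_eval f = y.
Proof.
have [_ _ H _] := mE_xP M #|I|; have [g Hg] := H y.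
exists (Mps (fun nu => g (pull_index enum_val nu))).
apply: torus_value_unique (torus_evalP _) _; apply/value_reindex.
suff -> : reindex (Mps (fun nu : mindex I => g (pull_index enum_val nu))) = g by [].
apply: mps_ext => nu /=; congr (g _); apply/ffunP => j.
by rewrite !ffunE enum_valK.
Qed.

Section Characters.
Variable (G : zmodType) (chi : I -> {additive G -> QZ}).

Definition torus_map_fun (x : G) : torus := \row_j chi (enum_val j) x.
Lemma torus_map_zmod : zmod_morphism torus_map_fun.
Proof. by move=> x y; apply/rowP => j; rewrite !mxE raddfB. Qed.
Definition torus_map : {additive G -> torus} := mk_additive torus_map_zmod.

Lemma torus_coordE s x : torus_coord s (torus_map x) = chi s x.
Proof. by rewrite /= mxE enum_rankK. Qed.

(** Pulled back from the torus instead of being chosen as a limit in E^0(BG), where values may fail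
    to be unique; this makes it a ring morphism, natural in G, by construction. *)
Definition char_eval : mps R I -> coh0 E (classifying G) :=
  pull0 (classifying_map torus_map) \o torus_eval.
HB.instance Definition _ := GRing.RMorphism.on char_eval.

Lemma char_evalX s : char_eval (mpsX s) = e (chi s).
Proof. by rewrite /char_eval /= torus_evalX; apply: pull_euler => x; rewrite torus_coordE. Qed.

Lemma char_evalP f : coh_value (fun s => e (chi s)) f (char_eval f).
Proof.
have := coh_value_pull (classifying_map torus_map) (torus_evalP f).
congr (coh_value _ _ _); apply/funext => s; rewrite -char_evalX /char_eval /=.
by rewrite torus_evalX.
Qed.
End Characters.

Lemma pull_char_eval (G H : zmodType) (phi : {additive G -> H})
    (chi : I -> {additive H -> QZ}) (chi' : I -> {additive G -> QZ}) f :
  (forall s x, chi' s x = chi s (phi x)) ->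
  pull0 (classifying_map phi) (char_eval chi f) = char_eval chi' f.
Proof.
move=> chiE; apply: pull_classifying => x; apply/rowP => j.
by rewrite !mxE chiE.
Qed.

End Universal.

(** Both sides are values of f at the classes of the [psi s], one by composing evaluations, the
    other by pulling back, and values on a torus are unique. *)
Lemma torus_eval_subst (I J : finType) (a : I -> mps R J)
    (psi : I -> {additive torus J -> QZ}) f :
  (forall s, a s m0 = 0) -> (forall s, torus_eval (a s) = e (psi s)) ->
  torus_eval (subst f a) = char_eval psi f.
Proof.
move=> a0 ea; apply: torus_value_unique (char_evalP psi f).
have -> : (fun s => e (psi s)) = (fun s => torus_eval (a s)) by apply/funext => s.
refine (@is_value_subst_partial _ _ _ _ _ _ _ _ _ (@torus_class J) a (@torus_eval J) _ _ _ _ _ _).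
- exact: skeletal0.
- exact: skeletalB.
- exact: skeletalM.
- exact: torus_continuous.
- exact: torus_evalP.
- exact: torus_evalC.
- exact: subst_value.
Qed.

(* The pullback of the coordinate of B(Q_p/Z_p) along psi : (Q_p/Z_p)^J -> Q_p/Z_p
   is the value of the series a at the coordinates of B(Q_p/Z_p)^J. *)
Definition represents (J : finType) (a : mps R J) (psi : torus J -> QZ) : Prop :=
  a m0 = 0 /\ exists2 chi : {additive torus J -> QZ}, chi =1 psi & torus_eval a = e chi.

Section Represents.
Variable J : finType.
Implicit Types (a b : mps R J) (phi psi : torus J -> QZ).
Let FP := mE_lawP M.

Lemma eq_represents a phi psi : phi =1 psi -> represents a phi -> represents a psi.
Proof. by move=> eq_ [a0 [chi chiE ea]]; split=> //; exists chi => // x; rewrite chiE. Qed.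

Lemma representsX s : represents (mpsX s) (torus_coord s : torus J -> QZ).
Proof. by split; [exact: mpsX0 | exists (torus_coord s) => //; exact: torus_evalX]. Qed.

Lemma represents0 : represents 0 (fun _ : torus J => 0).
Proof.
split; first exact: mcoef0; exists (\0 : {additive torus J -> QZ}) => //.
by rewrite rmorph0 euler0 //; exact: mE_x0.
Qed.

Lemma represents_fadd a b phi psi : represents a phi -> represents b psi ->
  represents (fadd (mE_law M) a b) (fun x => phi x + psi x).
Proof.
move=> [a0 [chi chiE ea]] [b0 [eta etaE eb]]; split; first exact: fadd_const0.
exists (chi \+ eta : {additive torus J -> QZ}) => [x|]; first by rewrite /= chiE etaE.
pose c (s : unit + unit) := if s is inl _ then chi else eta.
rewrite /fadd (@torus_eval_subst _ _ _ c); [|by case|by case].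
apply: torus_value_unique (char_evalP _ _) _.
(* [mE_addP] is the addition formula on B(Q_p/Z_p)^2; its pullback along d = (chi, eta) is the
   wanted one. *)
pose d_fun (x : torus J) : (QZ * QZ)%type := (chi x, eta x).
have d_zmod : zmod_morphism d_fun by move=> x y; rewrite /d_fun !raddfB.
pose d : {additive torus J -> (QZ * QZ)%type} := mk_additive d_zmod.
have := coh_value_pull (classifying_map d) (mE_addP M).
rewrite (@pull_euler _ _ _ _ _ _ d _ (chi \+ eta : {additive torus J -> QZ})) //.
by congr (coh_value _ _ _); apply/funext => -[] s /=; apply: pull_euler.
Qed.

Lemma represents_fmul m a phi : represents a phi ->
  represents (fmul (mE_law M) m a) (fun x => phi x *+ m).
Proof.
move=> Ha; elim: m => [|m IH]; first exact: represents0.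
rewrite /fmul iterS; apply: eq_represents (represents_fadd Ha IH) => x.
by rewrite mulrS.
Qed.

Lemma represents_fcomb h (i : 'I_h -> nat) (a : 'I_h -> mps R J)
    (phi : 'I_h -> torus J -> QZ) : (forall j, represents (a j) (phi j)) ->
  represents (fcomb (mE_law M) i a) (fun x => \sum_j phi j x *+ i j).
Proof.
move=> Ha; suff : forall r : seq 'I_h,
    represents (\big[fadd (mE_law M) (I:=J)/0]_(j <- r) fmul (mE_law M) (i j) (a j))
      (fun x => \sum_(j <- r) phi j x *+ i j) by apply.
elim=> [|j r IH].
  by rewrite big_nil; apply: eq_represents represents0 => x; rewrite big_nil.
rewrite big_cons; apply: eq_represents (represents_fadd (represents_fmul (i j) (Ha j)) IH) => x.
by rewrite big_cons.
Qed.
End Represents.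

(** At the zero characters all Euler classes vanish and only the constant term survives, so the
    constant term of a series can be detected from its class. *)
Lemma char_eval_const0 (J : finType) (b : mps R J) :
  char_eval (fun=> \0 : {additive torus J -> QZ}) b = pull0 (sconst _) (b m0).
Proof.
apply: torus_value_unique (char_evalP _ _) _ => s; exists 1%N => m m_gt0.
rewrite partial_sumE (bigD1_seq m0) ?mons_uniq ?mem_mons ?mdeg0 // mono0 mulr1 big1; last first.
  move=> nu; rewrite -mdeg_eq0 -lt0n => nu_gt0.
  suff -> : mono (fun _ : J => e (\0 : {additive torus J -> QZ})) nu = 0 by rewrite mulr0.
  have [r nur] : exists r, nu r != 0%N.
    apply/existsP; move: nu_gt0; apply: contraLR; rewrite negb_exists => /forallP H.
    rewrite -leqNgt leqn0 mdeg_eq0; apply/eqP/ffunP => r.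
    by rewrite ffunE; apply/eqP; rewrite -[_ == _]negbK.
  rewrite /mono (bigD1 r) //= euler0 ?expr0n ?(negPf nur) ?mul0r //.
  exact: mE_x0.
by rewrite [X in _ - X]addr0 subrr; apply: skeletal0.
Qed.

(** The base point of the nerve splits the projection to a point. *)
Lemma sconst_inj (G : zmodType) (c : R) :
  pull0 (sconst (classifying G)) c = 0 -> c = 0.
Proof.
move=> c0; pose z m : nerve_simplex G m :=
  exist (@is_cocycle G m) (fun _ _ => 0) (fun _ _ _ => addr0 0).
have zact m l (f : 'I_m.+1 -> 'I_l.+1) (hf : monotone f) (s : spoint l) :
  z m = sact hf (z l : classifying G l) by apply: eq_exist.
pose f : smap spoint (classifying G) :=
  @SMap spoint (classifying G) (fun m _ => z m) zact.
pose i : smap spoint spoint := @SMap spoint spoint (fun m s => s) (fun _ _ _ _ _ => erefl).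
have <- : pull0 i c = c by apply: (@pull_id E 0 _ (absmap i)).
rewrite (@pull0_comp _ _ _ _ f (sconst (classifying G)) i) ?c0 ?raddf0 //.
by move=> m [].
Qed.

(** Of the inverse series only algebraic identities are given. The class of the character -x is the
    value of some series b; F(x, b) then has as value the class of the zero character, so it is 0,
    and uniqueness of formal inverses identifies b with [law_opp]. *)
Lemma torus_eval_opp : exists2 chi : {additive torus unit -> QZ},
  chi =1 (fun x => - torus_coord tt x) & torus_eval (law_opp (mE_law M)) = e chi.
Proof.
have FP := mE_lawP M.
exists (\- torus_coord tt : {additive torus unit -> QZ}) => //.
have [b eb] := torus_eval_surj (e (\- torus_coord tt : {additive torus unit -> QZ})).
have b0 : b m0 = 0.
  apply: (@sconst_inj (torus unit)); rewrite -char_eval_const0 /char_eval /= eb.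
  rewrite (@pull_euler _ _ _ _ _ _ _ _ (\0 : {additive torus unit -> QZ})).
    by apply: euler0 => //; exact: mE_x0.
  by move=> s /=; rewrite mxE oppr0.
have xb : fadd (mE_law M) (mpsX tt) b = 0.
  apply: torus_eval_inj.
  have [] := represents_fadd (representsX tt) (_ : represents b (fun x => - torus_coord tt x)).
    by split=> //; exists (\- torus_coord tt : {additive torus unit -> QZ}).
  move=> _ [chi chiE ->]; apply: euler0; first exact: mE_x0.
  by move=> s; rewrite chiE subrr.
rewrite -eb; congr torus_eval; apply/esym.
have x0 : mpsX tt m0 = 0 :> R by exact: mpsX0.
rewrite (fopp_unique FP x0 b0 xb) /fopp.
by rewrite (@eq_subst _ _ _ _ _ mpsX) ?subst_id // => -[].
Qed.

Section RepresentsMore.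
Variable J : finType.
Implicit Types (a b : mps R J) (phi psi : torus J -> QZ).

Lemma represents_fopp a phi : represents a phi ->
  represents (fopp (mE_law M) a) (fun x => - phi x).
Proof.
move=> [a0 [chi chiE ea]]; split; first exact: fopp_const0 (mE_lawP M) _ _ _.
exists (\- chi : {additive torus J -> QZ}) => [x|]; first by rewrite /= chiE.
rewrite /fopp (@torus_eval_subst _ _ _ (fun=> chi)) //.
have [opp oppE eo] := torus_eval_opp.
rewrite /char_eval /= eo; apply: pull_euler => x.
by rewrite oppE torus_coordE.
Qed.

Variables (G : zmodType) (chi : J -> {additive G -> QZ}).

Lemma char_eval_represents a phi (psi : {additive G -> QZ}) : represents a phi ->
  (forall x, psi x = phi (torus_map chi x)) -> char_eval chi a = e psi.
Proof.
move=> [_ [eta etaE ea]] psiE; rewrite /char_eval /= ea; apply: pull_euler => x.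
by rewrite etaE psiE.
Qed.

(** The device that turns an identity between characters of G into one between classes in E^0(BG)
    without uniqueness of values on BG. *)
Lemma char_eval_subst (I : finType) (a : I -> mps R J) (phi : I -> torus J -> QZ)
    (psi : I -> {additive G -> QZ}) f :
  (forall s, represents (a s) (phi s)) ->
  (forall s x, psi s x = phi s (torus_map chi x)) ->
  char_eval chi (subst f a) = char_eval psi f.
Proof.
move=> Ha psiE; have [a0 Ha'] := all_and2 Ha.
pose eta s := s2val (cid2 (Ha' s)).
rewrite [LHS]/char_eval /= (@torus_eval_subst _ _ _ eta) //; last first.
  by move=> s; apply: (s2valP' (cid2 (Ha' s))).
apply: pull_char_eval => s x; rewrite psiE.
by rewrite -(s2valP (cid2 (Ha' s)) (torus_map chi x)).
Qed.
End RepresentsMore.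
End Evaluation.

(** * Characters of the twist groups *)

Section CharacterIdentities.
Variables (p : nat) (Z : padic_integers p) (h k : nat).
Hypotheses (p_pr : prime p) (k_gt0 : (0 < k)%N).
Local Notation N := (p ^ k)%N.
Local Notation gam := (gamma Z h p_pr k_gt0).

Lemma char_std_pow g : char_std Z p_pr k_gt0 g *+ N = 0.
Proof.
rewrite -raddfMn -mulr_natl pchar_Zp ?mul0r ?raddf0 //.
exact: N_gt1.
Qed.

Lemma twist_class_surj (G : zmodType) (a : {additive 'rV[Z]_h -> G}) (w : twist a) :
  exists g s, w = twist_class a (g, s).
Proof. by exists (repr w).1, (repr w).2; rewrite -surjective_pairing /twist_class /= reprK. Qed.

Variable a : {additive 'rV[Z]_h -> 'Z_N}.

Lemma twist_fstE x : twist_fst p_pr k_gt0 a (twist_class _ x) = twist_class gam (x.1.1, x.2).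
Proof. exact: twist_liftE. Qed.
Lemma twist_sndE x : twist_snd p_pr k_gt0 a (twist_class _ x) = twist_class a (x.1.2, x.2).
Proof. exact: twist_liftE. Qed.
Lemma s_homE x : s_hom p_pr k_gt0 a (twist_class _ x) =
  x.1.2 - \sum_j x.1.1 0 j * hom_index a j.
Proof. exact: twist_liftE. Qed.
Lemma char_AE j x : char_A Z p_pr k_gt0 j (twist_class gam x) =
  char_std Z p_pr k_gt0 (x.1 0 j) + Defs.modZp Z (x.2 0 j / N%:R).
Proof. exact: twist_liftE. Qed.
Lemma char_xE x : char_x p_pr k_gt0 a (twist_class a x) = char_std Z p_pr k_gt0 x.1 +
  \sum_j Defs.modZp Z ((hom_index a j : nat)%:R * x.2 0 j / N%:R).
Proof. exact: twist_liftE. Qed.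
Lemma char_qE (G : zmodType) (b : {additive 'rV[Z]_h -> G}) j x :
  char_q b j (twist_class b x) = Defs.modZp Z (x.2 0 j).
Proof. exact: twist_liftE. Qed.

(** The terms i_j s_j / p^k from [char_x] and from the [char_A] cancel, which leaves (g - \sum_j i_j
    l_j) / p^k. The order of the two summands is that in [difference_series]. *)
Lemma char_std_s_hom w :
  char_std Z p_pr k_gt0 (s_hom p_pr k_gt0 a w) =
  - (\sum_j char_A Z p_pr k_gt0 j (twist_fst p_pr k_gt0 a w) *+ hom_index a j) +
  char_x p_pr k_gt0 a (twist_snd p_pr k_gt0 a w).
Proof.
have [[l g] [s ->]] := twist_class_surj w.
rewrite s_homE twist_fstE twist_sndE char_xE raddfB raddf_sum [_.2]/= [_.1]/=.
have e j : char_A Z p_pr k_gt0 j (twist_class gam (l, s)) *+ hom_index a j =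
    char_std Z p_pr k_gt0 (l 0 j * hom_index a j) +
    Defs.modZp Z ((hom_index a j : nat)%:R * s 0 j / N%:R).
  have -> : l 0 j * hom_index a j = l 0 j *+ hom_index a j.
    by rewrite -{1}[hom_index a j]natr_Zp mulr_natr.
  rewrite char_AE mulrnDl raddfMn; congr (_ + _); rewrite -raddfMn; congr (Defs.modZp Z _).
  by rewrite -mulrA [RHS]mulr_natl.
rewrite (eq_bigr _ (fun j _ => e j)) big_split opprD [LHS]addrC -addrA; congr (_ + _).
by rewrite addrCA addNr addr0.
Qed.

(** Multiplication by p^k kills the part g / p^k and clears the denominators of the rest. *)
Lemma char_x_pow (w : twist a) :
  char_x p_pr k_gt0 a w *+ N = \sum_j char_q a j w *+ hom_index a j.
Proof.
have [g [s ->]] := twist_class_surj w.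
rewrite char_xE mulrnDl char_std_pow add0r -sumrMnl.
apply: eq_bigr => j _; rewrite char_qE -[LHS]raddfMn -[RHS]raddfMn.
by congr (Defs.modZp Z _); rewrite -[LHS]mulr_natr divfK ?N_neq0 // mulr_natl.
Qed.

Lemma char_q_twist_map (G G' : zmodType) (b : {additive 'rV[Z]_h -> G})
    (b' : {additive 'rV[Z]_h -> G'}) (psi : {additive G -> G'})
    (psi_b : forall j, psi (b j) = b' j) j w :
  char_q b' j (twist_map psi_b w) = char_q b j w.
Proof.
have [g [s ->]] := twist_class_surj w.
by rewrite [twist_map psi_b _]twist_liftE !char_qE.
Qed.
End CharacterIdentities.

Section HomOfIndex.
Variables (p : nat) (Z : padic_integers p) (h k : nat).
Hypotheses (p_pr : prime p) (k_gt0 : (0 < k)%N).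
Local Notation N := (p ^ k)%N.

(** [tt_compL] describes the factor of index i only by way of a homomorphism of that index. The
    formula for it is forced by [hom_residue]. *)
Lemma hom_index_surj (i : 'rV['Z_N]_h) :
  exists a : {additive 'rV[Z]_h -> 'Z_N}, forall j, hom_index a j = i 0 j.
Proof.
pose a_fun (z : 'rV[Z]_h) : 'Z_N := \sum_j residue p_pr k_gt0 (z 0 j) * i 0 j.
have a_zmod : zmod_morphism a_fun.
  move=> x y; rewrite /a_fun -sumrB; apply: eq_bigr => j _.
  by rewrite !mxE residue_zmod mulrBl.
have r1 : residue p_pr k_gt0 (1 : Z) = 1.
  by apply: (@residue_int _ _ _ p_pr k_gt0 1 0 1); rewrite mulr0 rmorph1 subrr.
have r0 : residue p_pr k_gt0 (0 : Z) = 0.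
  by apply: (@residue_int _ _ _ p_pr k_gt0 0 0 0); rewrite mulr0 rmorph0 subrr.
exists (mk_additive a_zmod) => j; rewrite /hom_index /= /a_fun (bigD1 j) //= mxE !eqxx r1 mul1r.
by rewrite big1 ?addr0 // => l /negPf ne; rewrite mxE eqxx ne r0 mul0r.
Qed.
End HomOfIndex.

Lemma ring_quot_lift (R S : comPzRingType) (G : R -> Prop) (phi : {rmorphism R -> S}) :
  (forall x, G x -> phi x = 0) ->
  exists psi : {rmorphism ring_quot G -> S}, forall x, psi (rpi G x) = phi x.
Proof.
move=> phiG; have phi0 x : in_ideal G x -> phi x = 0.
  by elim=> [|c g y Gg _ IH]; rewrite ?rmorph0 // rmorphD rmorphM (phiG _ Gg) mulr0 IH addr0.
pose f (x : ring_quot G) := phi (repr x).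
have fE x : f (rpi G x) = phi x.
  apply/eqP; rewrite -subr_eq0 -rmorphB; apply/eqP/phi0/rpiP.
  exact: rpi_repr.
have f_zmod : zmod_morphism f.
  move=> x y; have [x' ->] := rpi_surj x; have [y' ->] := rpi_surj y.
  by rewrite -rmorphB !fE rmorphB.
have f_monoid : monoid_morphism f.
  split=> [|x y]; first by rewrite -(rmorph1 (rpi G)) fE rmorph1.
  have [x' ->] := rpi_surj x; have [y' ->] := rpi_surj y.
  by rewrite -rmorphM !fE rmorphM.
by exists (mk_rmorphism f_zmod f_monoid).
Qed.

(** * The ring B_t and the twisted character map *)

Section BtMaps.
Variables (p h t : nat) (R : comPzRingType) (F : group_law R) (u : nat -> R).
Variables (Lt : comPzRingType) (ell : {rmorphism R -> Lt}).
Variable B : Bt_model p h t F u ell.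

Definition stage_rmorphism m : {rmorphism mps R ('I_h + 'I_h)%type -> B} :=
  Bt_comp2 B \o (Bt_locmap B \o (Bt_comp1 B \o (Bt_in B m \o
    (Bt_CE B m \o rpi (@stage_rel p h R F m))))).
Lemma stage_rmorphismE m f : stage_rmorphism m f = Bt_of_stage B m f.
Proof. by []. Qed.

Definition Lq_rmorphism : {rmorphism mps Lt 'I_h -> B} :=
  Bt_comp2 B \o (Bt_locmap B \o (Bt_comp1 B \o (Bt_in B 0 \o
    (Bt_CL B 0 \o rpi (@Lq_rel h t Lt))))).
Lemma Bt_of_stage_q m f : Bt_of_stage B m (rename inl f) = Bt_of_Lq B (map_mps ell f).
Proof.
rewrite /Bt_of_stage /Bt_of_Lq /Bt_stage' /Bt_Lq'; do 3 congr (GRing.RMorphism.sort _ _).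
have [/(_ f)/= <- _] := Bt_CP B m.
(* L_t[[q]] maps to B_t through stage 0, but here q arrives through stage m; compatibility with the
   transition maps identifies the two. *)
elim: m => [|m IH] //; rewrite -IH -Bt_trL.
by have [H _] := Bt_inP B; apply: H.
Qed.

Lemma Bt_of_stage_C m c : Bt_of_stage B m (mpsC _ c) = Bt_of_coef B c.
Proof.
have <- : rename inl (mpsC 'I_h c) = mpsC ('I_h + 'I_h)%type c.
  by rewrite /rename subst_C // => s; apply: mpsX0.
by rewrite Bt_of_stage_q map_mpsC.
Qed.
End BtMaps.

Lemma is_value_X_exp (R S : comPzRingType) (phi : {rmorphism R -> S})
    (Fil : nat -> S -> Prop) (I : finType) (a : I -> S) s j :
  (forall m, Fil m 0) -> is_value phi Fil a (mpsX s ^+ j) (a s ^+ j).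
Proof.
move=> Fil0; have := is_value_delta phi Fil0 a [ffun r => (s == r) * j]%N 1.
rewrite !rmorph1 !mul1r -mpsX_exp; congr (is_value _ _ _ _ _).
rewrite /mono (bigD1 s) //= ffunE eqxx mul1n big1 ?mulr1 // => r /negPf ne.
by rewrite ffunE eq_sym ne.
Qed.

Lemma pull_sincl_ext (E : cohomology) (T : Type) (X : T -> sSet) (y z : coh0 E (scoprod X)) :
  (forall a, pull0 (sincl X a) y = pull0 (sincl X a) z) -> y = z.
Proof.
move=> yz; have [w [_ U]] := additivity (c := E) (i := 0) (X := X) (fun a => pull0 (sincl X a) y).
by rewrite -(U y) //; apply: U => a; apply/esym/yz.
Qed.

Lemma sincl_exists (E : cohomology) (T : Type) (X : T -> sSet) (y : forall a, coh0 E (X a)) :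
  exists z : coh0 E (scoprod X), forall a, pull0 (sincl X a) z = y a.
Proof. by have [w [H _]] := additivity (c := E) (i := 0) (X := X) y; exists w. Qed.

Section FactorRings.
Variables (p h t : nat) (R : comPzRingType) (F : group_law R) (u : nat -> R).
Variables (Lt : comPzRingType) (ell : {rmorphism R -> Lt}).
Variable B : Bt_model p h t F u ell.
Variables (m : nat) (i : torsion_vectors p h m).
Hypothesis FP : is_group_law F.

Definition factor_rmorphism : {rmorphism mps B unit -> factor_ring B i} :=
  rpi (division_rel F (Bt_of_coef B) (p ^ m) (sum_q B i)).
Lemma factor_rmorphismE f : factor_rmorphism f = to_factor i f.
Proof. by []. Qed.

(** Acts on the coefficients of the powers of x, so no convergence in B_t is asked of the elements
    A_j^(m). *)
Definition stage_x_rmorphism : {rmorphism mps R (('I_h + 'I_h) + unit)%type -> mps B unit} :=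
  map_mps_rmorphism (stage_rmorphism B m) unit \o nest_rmorphism R ('I_h + 'I_h)%type.

Lemma factor_of_Lqx_X j :
  factor_of_Lqx B i (mpsX (inr tt) ^+ j) = to_factor i (mpsX tt ^+ j).
Proof.
congr (to_factor i _).
transitivity (map_mps_rmorphism (Lq_rmorphism B) unit (nest (mpsX (inr tt) ^+ j))) => //.
by rewrite nest_rmorphismE !rmorphXn -nest_rmorphismE nest_X /= map_mpsX.
Qed.

Let w : mps R ('I_h + 'I_h)%type := fopp F (vcomb F i (fun j => var_A R j)).
Lemma vcomb_A0 : vcomb F i (fun j => var_A R j) m0 = 0.
Proof. by apply: fcomb_const0 => // j; apply: mpsX0. Qed.
Let w0 : w m0 = 0.
Proof. exact: fopp_const0 vcomb_A0. Qed.

(* x -_F [i](A) *)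
Definition difference_series : mps R (('I_h + 'I_h) + unit)%type :=
  fadd F (rename inl w) (mpsX (inr tt)).

(** Expresses the map on global sections by the same series in E^0[[q, A, x]] to which [pull_s_hom]
    reduces Bs_a, so that one division serves both sides. *)
Lemma differenceE f :
  difference B i f = to_factor i (stage_x_rmorphism (subst f (fun=> difference_series))).
Proof.
congr (to_factor i _).
have <- : subst (subst f (fun=> law_add F)) (inl_or_x w) =
  subst f (fun=> difference_series).
  rewrite subst_comp //; first by move=> _; exact: law_add0.
  by move=> s; apply: inl_or_x0.
by rewrite /= nest_translate.
Qed.

(** The divisor involves only x and q, and the images of series in q come from L_t[[q]]; it
    therefore becomes the relation that defines the factor ring. *)
Lemma stage_x_relation : to_factor i (stage_x_rmorphism
  (fmul F (p ^ m) (mpsX (inr tt)) - rename inl (vcomb F i (fun j => var_q R j)))) = 0.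
Proof.
rewrite -factor_rmorphismE -(rmorph0 factor_rmorphism); apply/rpiP; rewrite subr0.
rewrite -[X in in_ideal _ X]addr0 -[X in X + 0]mul1r; apply: in_idealD; last exact: in_ideal0.
rewrite /division_rel rmorphB; congr (_ - _).
  have -> : fmul F (p ^ m) (mpsX (inr tt)) =
      rename inr (fmul F (p ^ m) (mpsX tt)) :> mps R (('I_h + 'I_h) + unit)%type.
    by rewrite /rename (subst_fmul FP) ?subst_X ?mpsX0 // => *; apply: mpsX0.
  rewrite /= nest_inr; apply: mps_ext => nu.
  exact/esym/Bt_of_stage_C.
rewrite /= nest_inl map_mpsC stage_rmorphismE; congr (mpsC _ _).
have -> : vcomb F i (fun j => var_q R j) = rename inl (vcomb F i (fun j => mpsX j)).
  rewrite /rename (subst_fcomb FP) => [||j]; try by move=> *; apply: mpsX0.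
    by congr (fcomb F _ _); apply/funext => j; rewrite subst_X // => ?; apply: mpsX0.
by rewrite Bt_of_stage_q.
Qed.

Lemma stage_x_poly d (r : mps R (('I_h + 'I_h) + unit)%type) :
  (forall nu : mindex (('I_h + 'I_h) + unit)%type, (d <= nu (inr tt))%N -> r nu = 0) ->
  to_factor i (stage_x_rmorphism r) =
  \sum_(j < d) to_factor i (mpsC _ (Bt_of_stage B m (coef_in_right r (unitdeg j)))) *
    to_factor i (mpsX tt ^+ j).
Proof.
move=> /nest_poly {1}->; rewrite -factor_rmorphismE !rmorph_sum; apply: eq_bigr => j _.
rewrite -!factor_rmorphismE !rmorphM !rmorphXn.
congr (_ * _ ^+ _); congr (factor_rmorphism _).
  by rewrite /= nest_inl map_mpsC.
by rewrite /= nest_X map_mpsX.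
Qed.
End FactorRings.

(** * The twisted character map in coordinates *)

Section TwistedCharacter.
Variables (p n t k : nat) (p_pr : prime p) (k_gt0 : (0 < k)%N).
Variables (Z : padic_integers p) (kk : fieldType) (E : cohomology) (M : morava_E Z n kk E).
Local Notation h := (n - t)%N.
Local Notation N := (p ^ k)%N.
Local Notation F := (mE_law M).
Local Notation R := (coef E).
Local Notation J := ('I_h + 'I_h)%type.
Local Notation K := (J + unit)%type.
Local Notation hom_type := {additive 'rV[Z]_h -> 'Z_N}.
Local Notation gam := (gamma Z h p_pr k_gt0).

Definition std_eval : mps R unit -> coh0 E (B_cyclic p k) :=
  char_eval M (fun _ : unit => char_std Z p_pr k_gt0).
HB.instance Definition _ := GRing.RMorphism.on std_eval.

Lemma std_eval_relation : std_eval (fmul F N (mpsX tt)) = 0.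
Proof.
rewrite /std_eval (char_eval_represents (phi := fun x => torus_coord Z tt x *+ N)
  (psi := \0 : {additive 'Z_N -> QpZp Z})).
- by apply: euler0 => //; exact: mE_x0.
- exact: represents_fmul (representsX M tt).
- by move=> x; rewrite torus_coordE char_std_pow.
Qed.

Definition gamma_chars (s : J) : {additive twist gam -> QpZp Z} :=
  match s with inl j => char_q gam j | inr j => char_A Z p_pr k_gt0 j end.

Lemma qA_gammaE : qA_gamma p_pr k_gt0 M = fun s => euler (mE_x M) (gamma_chars s).
Proof. by apply/funext => -[]. Qed.

Section Component.
Variable a : hom_type.
Local Notation i := (index_of a : torsion_vectors p h k).

Definition prod_chars (s : K) : {additive twist (gamma_prod p_pr k_gt0 a) -> QpZp Z} :=
  match s with
  | inl s => gamma_chars s \o twist_fst p_pr k_gt0 a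
  | inr _ => char_x p_pr k_gt0 a \o twist_snd p_pr k_gt0 a
  end.

Let X0 (I : finType) (s : I) : mpsX s m0 = 0 :> R.
Proof. exact: mpsX0. Qed.

Lemma represents_difference : represents M (difference_series F i : mps R K)
  (fun x => - (\sum_j torus_coord Z (inl (inr j) : K) x *+ i 0 j) +
    torus_coord Z (inr tt : K) x).
Proof.
apply: represents_fadd; last exact: representsX.
have FP := mE_lawP M.
rewrite /rename subst_fopp ?vcomb_A0 //; apply: represents_fopp.
rewrite /vcomb (subst_fcomb FP) //; last by move=> j; exact: X0.
apply: represents_fcomb => j.
by rewrite subst_X //; exact: representsX.
Qed.

Lemma pull_s_hom f :
  pull0 (classifying_map (s_hom p_pr k_gt0 a)) (std_eval f) =
  char_eval M prod_chars (subst f (fun=> difference_series F i)).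
Proof.
rewrite (char_eval_subst (phi := fun _ : unit => _)
  (psi := fun=> char_std Z p_pr k_gt0 \o s_hom p_pr k_gt0 a) f (fun=> represents_difference)).
  exact: pull_char_eval.
move=> _ x; apply: etrans (char_std_s_hom x) _.
rewrite torus_coordE; congr (- _ + _); apply: eq_bigr => j _.
by rewrite torus_coordE mxE.
Qed.

(** By [char_x_pow], [p^k](x) and [i](q) evaluate to the class of one and the same character. *)
Lemma char_eval_relation :
  char_eval M prod_chars
    (fmul F N (mpsX (inr tt)) - rename inl (vcomb F i (fun j => var_q R j))) = 0.
Proof.
have FP := mE_lawP M.
have N_add : zmod_morphism (fun x => prod_chars (inr tt) x *+ N).
  by move=> x y; rewrite raddfB mulrnBl.
pose psi := mk_additive N_add.
rewrite rmorphB /= (char_eval_represents (psi := psi) (represents_fmul N (representsX M (inr tt)))).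
  rewrite /rename /vcomb (subst_fcomb FP) //; last by move=> j; exact: X0.
  rewrite (char_eval_represents (psi := psi)
    (@represents_fcomb _ _ _ _ _ M _ _ _ _
      (fun j x => torus_coord Z (inl (inl j) : K) x) _)) ?subrr //.
    by move=> j; rewrite subst_X //; exact: representsX.
  move=> x; apply: etrans (char_x_pow _ _ _) _; apply: eq_bigr => j _; rewrite torus_coordE mxE.
  by congr (_ *+ _); apply: etrans (char_q_twist_map _ _ _) (esym (char_q_twist_map _ _ _)).
by move=> x; rewrite torus_coordE.
Qed.

Lemma char_eval_rename r : char_eval M prod_chars (rename inl r) =
  pull0 (classifying_map (twist_fst p_pr k_gt0 a)) (char_eval M gamma_chars r).
Proof.
rewrite /rename (char_eval_subst (phi := fun s => torus_coord Z (inl s : K))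
   (psi := fun s => gamma_chars s \o twist_fst p_pr k_gt0 a)).
- by apply/esym/pull_char_eval.
- by move=> s; exact: representsX.
- by move=> s x; rewrite torus_coordE.
Qed.

Lemma pull_s_hom_poly f d (q r : mps R K) :
  subst f (fun=> difference_series F i) =
    q * (fmul F N (mpsX (inr tt)) - rename inl (vcomb F i (fun j => var_q R j))) + r ->
  (forall nu : mindex K, (d <= nu (inr tt))%N -> r nu = 0) ->
  pull0 (classifying_map (s_hom p_pr k_gt0 a)) (std_eval f) =
  \sum_(j < d) pull0 (classifying_map (twist_fst p_pr k_gt0 a))
      (char_eval M gamma_chars (coef_in_right r (unitdeg j))) *
    pull0 (classifying_map (twist_snd p_pr k_gt0 a))
      (euler (mE_x M) (char_x p_pr k_gt0 a) ^+ j).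
Proof.
move=> e /nest_poly er; rewrite pull_s_hom e rmorphD rmorphM.
rewrite [X in _ * X]char_eval_relation mulr0 add0r.
rewrite {1}er rmorph_sum; apply: eq_bigr => j _; rewrite rmorphM rmorphXn /=.
rewrite char_eval_rename char_evalX rmorphXn /=; congr (_ * _ ^+ _).
by apply/esym/pull_euler.
Qed.
End Component.

Section Global.
Variable i : torsion_vectors p h k.
Local Notation tspace := (twist_space Z n t k).

(** For j = 0 this is the idempotent of the components of index i, otherwise its multiple by x^j.
    [tt_L] accepts only classes on the whole disjoint union; additivity provides these. *)
Definition is_twist_power j (y : coh0 E tspace) : Prop := forall a : hom_type,
  pull0 (sincl (fun a : hom_type => classifying (twist a)) a) y =
  if index_of a == i then euler (mE_x M) (char_x p_pr k_gt0 a) ^+ j else 0.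

Lemma twist_power_exists j : exists y, is_twist_power j y.
Proof.
exact: (sincl_exists (X := fun a : hom_type => classifying (twist a))
  (fun a => if index_of a == i then euler (mE_x M) (char_x p_pr k_gt0 a) ^+ j else 0)).
Qed.

(** The division is made for one i and computes Bs_a only on components of that index; the factor
    [xi 0] removes the others on the left, as the [xi j] do on the right. *)
Lemma twisted_expansion f d (q r : mps R K) (xi : nat -> coh0 E tspace) :
  (forall j, is_twist_power j (xi j)) ->
  subst f (fun=> difference_series F i) =
    q * (fmul F N (mpsX (inr tt)) - rename inl (vcomb F i (fun j => var_q R j))) + r ->
  (forall nu : mindex K, (d <= nu (inr tt))%N -> r nu = 0) ->
  pull0 (prod_to_twist Z n t p_pr k_gt0) (xi 0%N) *
    pull0 (prod_to_cyclic Z n t p_pr k_gt0) (std_eval f) =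
  \sum_(j < d) pull0 (prod_to_gamma Z n t p_pr k_gt0)
      (char_eval M gamma_chars (coef_in_right r (unitdeg j))) *
    pull0 (prod_to_twist Z n t p_pr k_gt0) (xi j).
Proof.
move=> xiP er r0; apply: pull_sincl_ext => a.
have P1 (y : coh0 E tspace) :
    pull0 (sincl (fun a => classifying (twist (gamma_prod p_pr k_gt0 a))) a)
      (pull0 (prod_to_twist Z n t p_pr k_gt0) y) =
    pull0 (classifying_map (twist_snd p_pr k_gt0 a)) (pull0 (sincl _ a) y).
  rewrite -(@pull0_comp _ _ _ _ _ _ (Defs.scomp
    (sincl (fun a : hom_type => classifying (twist a)) a)
    (classifying_map (twist_snd p_pr k_gt0 a)))) //.
  by apply/esym/pull0_comp.
have P2 y : pull0 (sincl (fun a => classifying (twist (gamma_prod p_pr k_gt0 a))) a)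
      (pull0 (prod_to_gamma Z n t p_pr k_gt0) y) =
    pull0 (classifying_map (twist_fst p_pr k_gt0 a)) y.
  by apply/esym/pull0_comp.
have P3 y : pull0 (sincl (fun a => classifying (twist (gamma_prod p_pr k_gt0 a))) a)
      (pull0 (prod_to_cyclic Z n t p_pr k_gt0) y) =
    pull0 (classifying_map (s_hom p_pr k_gt0 a)) y.
  by apply/esym/pull0_comp.
rewrite rmorphM rmorph_sum /= P1 P3 xiP; case: eqP => [ai|ai].
  rewrite expr0 rmorph1 mul1r; rewrite -ai in er.
  rewrite (pull_s_hom_poly er r0); apply: eq_bigr => j _.
  by rewrite rmorphM /= P1 P2 xiP ai eqxx.
rewrite rmorph0 mul0r big1 // => j _.
by rewrite rmorphM /= P1 xiP (introF eqP ai) rmorph0 mulr0.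
Qed.
End Global.

Section Main.
Variables (L : cohomology) (eta : coh_transformation E L).
Variable B : Bt_model p h t F (mE_u M) (trans_coef eta).
Variable P : twisted_target p_pr k_gt0 B.
Variable Upsilon : {rmorphism coh0 E (B_cyclic p k) -> P}.
Hypothesis UpsilonP : is_twisted_character_map Upsilon.

Lemma twisted_component_power i j (xi : coh0 E (twist_space Z n t k)) :
  is_twist_power i j xi ->
  tt_comp P i (tt_L P (trans0 eta xi)) = to_factor i (mpsX tt ^+ j).
Proof.
move=> xiP; have [a ai] := hom_index_surj Z p_pr k_gt0 i.
have {}ai : index_of a = i by apply/rowP => l; rewrite mxE ai.
rewrite -factor_of_Lqx_X; apply: (tt_compL P (a := a)) => //.
have -> : pull0 (sincl (fun a : hom_type => classifying (twist a)) a) (trans0 eta xi) =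
    qx_twist p_pr k_gt0 M eta a (inr tt) ^+ j.
  transitivity (trans0 eta (pull0 (sincl (fun a : hom_type => classifying (twist a)) a) xi)).
    exact/esym/trans_pull.
  by rewrite xiP ai eqxx rmorphXn.
by apply: is_value_X_exp => s; exact: skeletal0.
Qed.

Theorem twisted_character_component i f :
  tt_comp P i (Upsilon (std_eval f)) = difference B i f.
Proof.
have [lam [v [lamP vG vT UE]]] := UpsilonP; have FP := mE_lawP M.
have [d [q [r [er r0]]]] := @p_series_division _ _ _ _ _ M _
  (vcomb F i (fun j => var_q R j)) k (subst f (fun=> difference_series F i))
  (fcomb_const0 FP _ (fun j => mpsX0 _ _)).
have [xi xiP] : exists xi, forall j, is_twist_power i j (xi j).
  by exists (fun j => sval (cid (twist_power_exists i j))) => j; apply: (svalP (cid _)).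
have := congr1 (fun z => tt_comp P i (v z)) (twisted_expansion xiP er r0).
rewrite /= !rmorphM !rmorph_sum /= vT (twisted_component_power (xiP _)) -UE.
(* The idempotent becomes 1 in the factor of index i and disappears. *)
have -> : to_factor i (mpsX tt ^+ 0) = 1 :> factor_ring B i.
  by rewrite expr0 -factor_rmorphismE rmorph1.
rewrite mul1r => ->; rewrite differenceE // er rmorphD rmorphM.
rewrite -factor_rmorphismE rmorphD rmorphM !factor_rmorphismE stage_x_relation // mulr0 add0r.
rewrite (stage_x_poly _ _ r0); apply: eq_bigr => j _; rewrite !rmorphM /= vG vT.
rewrite (twisted_component_power (xiP _)) tt_compB; congr (to_factor i (mpsC _ _) * _).
by apply: lamP; rewrite qA_gammaE; exact: char_evalP.
Qed.
End Main.
End TwistedCharacter.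

Theorem theorem4p23 (p n t k : nat) (p_pr : prime p) (t_lt_n : (t < n)%N)
  (k_gt0 : (0 < k)%N) (Z : padic_integers p)
  (kk : fieldType) (kk_char : p \in [pchar kk])
  (kk_perfect : forall a : kk, exists b : kk, b ^+ p = a)
  (E : cohomology) (M : morava_E Z n kk E)
  (L : cohomology) (eta : coh_transformation E L)
  (L_loc : is_Kt_localization eta (mE_u M) t)
  (ident : standard_identifications t p_pr k_gt0 M eta)
  (B : Bt_model p (n - t) t (mE_law M) (mE_u M) (trans_coef eta))
  (P : twisted_target p_pr k_gt0 B)
  (Upsilon : {rmorphism coh0 E (B_cyclic p k) -> P})
  (UpsilonP : is_twisted_character_map Upsilon) :
  exists psi : forall i : torsion_vectors p (n - t) k,
      {rmorphism torsion_ring p (mE_law M) k -> factor_ring B i},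
    (forall i f, psi i (to_torsion p (mE_law M) k f) = difference B i f) /\
    (forall i f y, coh_value (x_cyclic p_pr k_gt0 M) f y ->
      tt_comp P i (Upsilon y) = psi i (to_torsion p (mE_law M) k f)).
Proof.
have lift (i : torsion_vectors p (n - t) k) : exists psi :
      {rmorphism torsion_ring p (mE_law M) k -> factor_ring B i},
    forall f, psi (to_torsion p (mE_law M) k f) = difference B i f.
  (* That [difference] is a ring morphism and kills [p^k](x) is read off from the topological side:
     the composite with [Upsilon] has both properties, and the component formula identifies the
     two. *)
  have [|psi psiE] := @ring_quot_lift _ _ (eq (fmul (mE_law M) (p ^ k) (mpsX tt)))
    (tt_comp P i \o (Upsilon \o std_eval p_pr k_gt0 M)).
    by move=> _ <-; rewrite /= std_eval_relation !rmorph0.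
  by exists psi => f; rewrite [LHS]psiE /= twisted_character_component.
exists (fun i => sval (cid (lift i))); split=> i f; first exact: (svalP (cid (lift i))).
move=> y fy; have [_ U _ _] := id_cyclic ident.
(* By [id_cyclic], f has only one value in E^0(BZ/p^k). *)
have -> : y = std_eval p_pr k_gt0 M f by apply: U fy _; exact: char_evalP.
by rewrite twisted_character_component // (svalP (cid (lift i))).
Qed.
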